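(* Let $\hbar>0$ and $n\geq 1$. Let $X\subset\mathbb{R}^n_x$ and $P\subset\mathbb{R}^n_p$ be centrally symmetric convex bodies such that $(X,P)$ is a $\hbar$-polar quantum pair, i.e. $X^{\hbar}\subset P$. Then $$c_{\max}(X\times P)=c_{\mathrm{HZ}}(X\times P)\geq 4\hbar,$$ with equality if $X^{\hbar}=P$.
   Context: A convex body is a compact convex set with nonempty interior; it is centrally symmetric if $X=-X$. For a centrally symmetric convex body $X\subset\mathbb{R}^n_x$, its $\hbar$-polar set is $X^{\hbar}=\{p\in\mathbb{R}^n_p: p^Tx\leq\hbar \text{ for all } x\in X\}$. A pair $(X,P)$ of centrally symmetric convex bodies in $\mathbb{R}^n$ is called a $\hbar$-polar quantum pair if $X^{\hbar}\subset P$. Phase space is $\mathbb{R}^{2n}=\mathbb{R}^n_x\times\mathbb{R}^n_p$ with coordinates $z=(x,p)$ and standard symplectic form $\sigma(z,z')=(z')^TJz$, $J=\begin{pmatrix}0&I_n\\-I_n&0\end{pmatrix}$. For $\Omega\subset\mathbb{R}^{2n}$, $c_{\max}(\Omega)=\inf\{\pi R^2: f(\Omega)\subset Z_j^{2n}(R)\}$, the infimum over all symplectomorphisms $f$ of $(\mathbb{R}^{2n},\sigma)$, where $Z_j^{2n}(R)=\{z: x_j^2+p_j^2\leq R^2\}$ is a cylinder. $c_{\mathrm{HZ}}$ denotes the Hofer–Zehnder symplectic capacity; for a compact convex set $\Omega$ with nonempty interior it equals the action $\oint_{\gamma_{\min}}p\,dx$ (taken positive) of the closed characteristic (periodic Hamiltonian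 orbit on the boundary $\partial\Omega$, viewed as an energy hypersurface) of minimal action. *)

(* Defs.v *)
From HB Require Import structures.
From mathcomp Require Import all_boot all_order all_algebra.
From mathcomp Require Import all_classical all_reals all_analysis.
Set Implicit Arguments. Unset Strict Implicit. Unset Printing Implicit Defensive.
Import Order.TTheory GRing.Theory Num.Theory.
Import numFieldNormedType.Exports.
Local Open Scope classical_set_scope.
Local Open Scope ring_scope.

Section Defs.
Variable R : realType.

Definition dotv (n : nat) (x y : 'rV[R]_n) : R := \sum_(i < n) x 0 i * y 0 i.

Definition convex_set_of (n : nat) (A : set 'rV[R]_n) : Prop :=
  forall x y, A x -> A y -> forall t : R, 0 <= t -> t <= 1 ->
    A (t *: x + (1 - t) *: y).

Definition convex_body (n : nat) (A : set 'rV[R]_n) : Prop :=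
  compact A /\ convex_set_of A /\ (A° !=set0).

Definition centrally_symmetric (n : nat) (A : set 'rV[R]_n) : Prop :=
  A = [set - x | x in A].

Definition hpolar (n : nat) (hbar : R) (X : set 'rV[R]_n) : set 'rV[R]_n :=
  [set p | forall x, X x -> dotv p x <= hbar].

Definition prodXP (n : nat) (X P : set 'rV[R]_n) : set 'rV[R]_(n + n) :=
  [set z | X (lsubmx z) /\ P (rsubmx z)].

Definition Jmx (n : nat) : 'M[R]_(n + n) :=
  block_mx 0 1%:M (- 1%:M) 0.

Definition sigma (n : nat) (z z' : 'rV[R]_(n + n)) : R :=
  (z' *m Jmx n *m z^T) 0 0.

Fixpoint iterD (V W : normedModType R) (vs : seq V) (f : V -> W) : V -> W :=
  match vs with
  | [::] => f
  | v :: vs' => fun x => 'D_v (iterD vs' f) x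
  end.

Definition smooth (V W : normedModType R) (f : V -> W) : Prop :=
  forall (vs : seq V) x, differentiable (iterD vs f) x.

Definition symplectomorphism (n : nat) (f : 'rV[R]_(n + n) -> 'rV[R]_(n + n)) : Prop :=
  exists g, [/\ cancel f g, cancel g f, smooth f, smooth g &
    forall z u v, sigma ('D_u f z) ('D_v f z) = sigma u v].

Definition cylinder (n : nat) (j : 'I_n) (r : R) : set 'rV[R]_(n + n) :=
  [set z | (z 0 (lshift n j)) ^+ 2 + (z 0 (rshift n j)) ^+ 2 <= r ^+ 2].

Definition c_max (n : nat) (O : set 'rV[R]_(n + n)) : \bar R :=
  ereal_inf [set ((pi : R) * r ^+ 2)%:E | r in
    [set r : R | 0 < r /\ exists f j, symplectomorphism f /\ f @` O `<=` cylinder j r]].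

Definition grad (n : nat) (H : 'rV[R]_n -> R) (z : 'rV[R]_n) : 'rV[R]_n :=
  \row_i 'D_(delta_mx 0 i : 'rV[R]_n) H z.

Definition hamvf (n : nat) (H : 'rV[R]_(n + n) -> R) (z : 'rV[R]_(n + n)) :=
  grad H z *m (Jmx n)^T.

Definition periodic_solution (n : nat) (H : 'rV[R]_(n + n) -> R)
    (g : R -> 'rV[R]_(n + n)) (T : R) : Prop :=
  (forall t, derivable g t 1) /\ (forall t, derive1 g t = hamvf H (g t)) /\
  (forall t, g (t + T) = g t).

Definition HZ_admissible (n : nat) (O : set 'rV[R]_(n + n))
    (H : 'rV[R]_(n + n) -> R) (m : R) : Prop :=
  [/\ smooth H,
      (exists K, [/\ compact K, K `<=` O° & forall z, ~ K z -> H z = 0]),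
      (exists V, [/\ open V, V !=set0, V `<=` O & forall z, V z -> H z = m]),
      (forall z, 0 <= H z /\ H z <= m) &
      (forall g T, 0 < T -> T <= 1 -> periodic_solution H g T ->
         forall t s, g t = g s)].

Definition c_HZ (n : nat) (O : set 'rV[R]_(n + n)) : \bar R :=
  ereal_sup [set m%:E | m in [set m : R | exists H, HZ_admissible O H m]].

End Defs.

(* Main.v *)
(* Both capacities of [X * P] equal [4 r], where [r] is the largest number with
   [X^r] included in [P]; for a polar quantum pair [r >= hbar], with equality
   when [X^hbar = P].

   [c_HZ <= c_max] is Hofer-Zehnder nonsqueezing. Given an admissible [H] of
   maximum [m] and an embedding into a cylinder of radius [R] with
   [pi R^2 < m], transport [max H - H] and let it grow quadratically outside an
   ellipsoid filling the cylinder. A linking argument for the action functional,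
   carried out on the finite-dimensional space of discrete loops (where
   Poincare-Miranda replaces degree theory), gives almost critical loops of
   positive action; their limit along an ultrafilter is a nonconstant orbit of
   [H] of period at most 1.

   [c_max <= 4 s] if [X^s] is not included in [P]: separating a point of [X^s]
   from [P] yields dual covectors and a linear symplectic map sending [X * P]
   over a rectangle of area [4 s] in one symplectic plane; the lift of a change
   of position coordinate squeezes the rectangle into a disc of nearly the same
   area.

   [4 s <= c_HZ] if [X^s] is included in [P]: approximate the gauge of
   [X * X^s] by the [2k]-norm of finitely many linear forms and take a cutoff
   function of it of slope slightly below [4 s]. On a closed orbit the action is
   bounded by a quarter of the product of the lengths of its two projections,
   and this isoperimetric inequality forces the period to exceed 1. *)
Require Import Defs.
From HB Require Import structures.
From mathcomp Require Import all_boot all_order all_algebra.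
From mathcomp Require Import all_classical all_reals all_analysis.
From mathcomp Require Import zify ring lra.
Import Order.TTheory GRing.Theory Num.Theory.
Import numFieldNormedType.Exports.
Local Open Scope classical_set_scope.
Local Open Scope ring_scope.
Set Implicit Arguments. Unset Strict Implicit. Unset Printing Implicit Defensive.

(** Discretization removes infinite-dimensional degree theory, but the level given by linking for
    loops of [N] points tends to zero as [N] grows, so positive action is lost in the limit and
    cannot be what makes the limit orbit nonconstant. Two substitutes survive. Some point of the
    orbit has nonnegative action integrand, which confines the orbit to the ellipsoid and excludes
    constants where [Hb] is positive. And the gradient is required to be small compared with the
    level, so that a loop close to a point where [dH] is flat would enclose too little area. To make
    the zeros of the transported function flat, it is composed with [huber]; the slope of [huber],
    being at most 1, only shortens periods. The critical number [r] is never constructed: for every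
    [s] either the upper bound for [c_max] or the lower bound for [c_HZ] holds at [4 * s], so no
    such value lies strictly between the capacities. Smoothness means that all iterated directional
    derivatives are differentiable; it is proved for whole algebras of functions stable under
    differentiation. *)

Section ContinuityCombinators.
Variables (R : realType) (T : topologicalType).
Implicit Types (f g : T -> R).

Lemma fctD_continuous (V : normedModType R) (f g : T -> V) :
  continuous f -> continuous g -> continuous (fun x => f x + g x).
Proof. by move=> fc gc x; apply: cvgD; [exact: fc|exact: gc]. Qed.

Lemma fctB_continuous (V : normedModType R) (f g : T -> V) :
  continuous f -> continuous g -> continuous (fun x => f x - g x).
Proof. by move=> fc gc x; apply: cvgB; [exact: fc|exact: gc]. Qed.

Lemma fctZ_continuous (V : normedModType R) (f : T -> R) (g : T -> V) :
  continuous f -> continuous g -> continuous (fun x => f x *: g x).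
Proof. by move=> fc gc x; apply: cvgZ; [exact: fc|exact: gc]. Qed.

Lemma fctM_continuous f g :
  continuous f -> continuous g -> continuous (fun x => f x * g x).
Proof. by move=> fc gc x; apply: cvgM; [exact: fc|exact: gc]. Qed.

Lemma fct_sum_continuous (I : Type) (r : seq I) (P : pred I) (f : I -> T -> R) :
  (forall i, continuous (f i)) -> continuous (fun x => \sum_(i <- r | P i) f i x).
Proof.
move=> fc; elim: r => [|i r IH].
  by under eq_fun do rewrite big_nil; exact: cst_continuous.
under eq_fun do rewrite big_cons.
case: (P i) => //; exact: fctD_continuous.
Qed.

Lemma fct_norm_continuous (V : normedModType R) (f : T -> V) :
  continuous f -> continuous (fun x => `|f x|).
Proof. by move=> fc x; apply: cvg_norm; exact: fc. Qed.

Lemma fct_max_continuous f g :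
  continuous f -> continuous g -> continuous (fun x => Num.max (f x) (g x)).
Proof. by move=> fc gc x; apply: continuous_max; [exact: fc|exact: gc]. Qed.

Lemma fct_min_continuous f g :
  continuous f -> continuous g -> continuous (fun x => Num.min (f x) (g x)).
Proof. by move=> fc gc x; apply: continuous_min; [exact: fc|exact: gc]. Qed.

Lemma fct_cst_continuous (U : topologicalType) (a : U) : continuous (fun _ : T => a).
Proof. by move=> x; exact: cvg_cst. Qed.

Lemma fct_comp_continuous (U W : topologicalType) (f : T -> U) (g : U -> W) :
  continuous f -> continuous g -> continuous (fun x => g (f x)).
Proof. by move=> fc gc x; apply: continuous_comp; [exact: fc|exact: gc]. Qed.

Lemma mx_continuous (m n : nat) (f : T -> 'M[R]_(m, n)) :
  (forall i j, continuous (fun x => f x i j)) -> continuous f.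
Proof.
move=> fc x A [P fP PA].
have : \forall y \near x, forall i j, P i j (f y i j).
  apply: filter_forall => i; apply: filter_forall => j; exact: (fc i j x _ (fP i j)).
by apply: filterS => y hy; apply: PA.
Qed.

End ContinuityCombinators.

(** * The Poincare-Miranda theorem *)

Section CubicalCup.
Variable d : nat.
Implicit Types (v w : 'I_d -> nat) (S : {set 'I_d}) (f : ('I_d -> nat) -> bool).

Definition inc (j : 'I_d) v : 'I_d -> nat := fun i => (v i + (i == j))%N.
Definition upd (j : 'I_d) (a : nat) v : 'I_d -> nat :=
  fun i => if i == j then a else v i.

(* The cup product over F_2 of the coboundaries [df], [f] in [fs], evaluated on
   the cube with lowest vertex [v] and edge directions [S]; by Stokes
   ([cup_closed]) its sum over a grid depends on the boundary values only, so under
   the hypotheses of [gsum_cup] some cube carries a 1: there every [f] changes value. *)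
Fixpoint cup (fs : seq (('I_d -> nat) -> bool)) S v : bool :=
  if fs is f :: fs' then
    \big[addb/false]_(j in S) ((f (inc j v) (+) f v) && cup fs' (S :\ j) (inc j v))
  else true.

Lemma incC j k v : inc j (inc k v) = inc k (inc j v).
Proof. by apply/funext => i; rewrite /inc addnAC. Qed.

(** Modulo 2 the terms of the ordered pairs [(j, k)] and [(k, j)] cancel. *)
Lemma big_addb_sym S (g : 'I_d -> 'I_d -> bool) : (forall j k, g j k = g k j) ->
  \big[addb/false]_(j in S) \big[addb/false]_(k in S :\ j) g j k = false.
Proof.
move=> gC.
have split_sum j : \big[addb/false]_(k in S :\ j) g j k =
    \big[addb/false]_(k in S | (k < j)%N) g j k (+)
    \big[addb/false]_(k in S | (j < k)%N) g j k.
  rewrite (bigID (fun k : 'I_d => (k < j)%N)) /=; congr addb; apply: eq_bigl => k.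
  - rewrite !inE; case: (eqVneq k j) => [->|_] /=; last by [].
    by rewrite ltnn andbF.
  - rewrite !inE -leqNgt leq_eqVlt -(inj_eq val_inj) /= eq_sym.
    by case: ltngtP => //=; rewrite ?andbT ?andbF.
under eq_bigr do rewrite split_sum.
rewrite big_split /= [X in _ (+) X](exchange_big_dep (fun k => k \in S)) /=; last by move=> j k _ /andP[].
apply/negbTE; rewrite -[_ (+) _]negbK; apply/negPn; rewrite negb_add; apply/eqP.
apply: eq_bigr => j jS; apply: eq_big => k; first by rewrite jS.
by move=> _; rewrite gC.
Qed.

(** Leibniz rule and induction on [fs]: over ordered pairs of distinct directions symmetric terms
    cancel, and the remaining inner sums vanish by the induction hypothesis. *)
Lemma cup_closed fs S v :
  \big[addb/false]_(j in S) (cup fs (S :\ j) (inc j v) (+) cup fs (S :\ j) v) = false.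
Proof.
elim: fs S v => [|f fs IH] S v /=; first by rewrite big1.
pose W j k x := cup fs (S :\ j :\ k) x.
have WC j k x : W j k x = W k j x by rewrite /W !finset.setDDl finset.setUC.
(* The first of the four terms is symmetric in [j] and [k]; the last becomes so once the induction
   hypothesis replaces [inc k v] by [v]. Exchanging [j] and [k] in the third lets it combine with
   the second into the induction hypothesis at [inc j v]. *)
transitivity (\big[addb/false]_(j in S) \big[addb/false]_(k in S :\ j)
   ((f (inc k (inc j v)) && W j k (inc k (inc j v))) (+)
    ((f (inc j v) && W j k (inc k (inc j v))) (+)
    ((f (inc k v) && W j k (inc k v)) (+) (f v && W j k (inc k v)))))).
  apply: eq_bigr => j jS; rewrite -big_split /=; apply: eq_bigr => k _.
  by rewrite -/(W j k _) -/(W j k _) !andb_addl -addbA.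
under eq_bigr do rewrite !big_split /=.
rewrite !big_split /= big_addb_sym ?addFb; last by move=> j k; rewrite incC WC.
have -> : \big[addb/false]_(j in S) \big[addb/false]_(k in S :\ j) (f v && W j k (inc k v)) = false.
  transitivity (\big[addb/false]_(j in S) \big[addb/false]_(k in S :\ j) (f v && W j k v)).
    apply: eq_bigr => j jS; rewrite -!big_distrr /=; congr andb.
    by apply/eqP; rewrite -negb_add -big_split /= IH.
  by apply: big_addb_sym => j k; rewrite WC.
rewrite addbF.
have -> : \big[addb/false]_(j in S) \big[addb/false]_(k in S :\ j) (f (inc k v) && W j k (inc k v)) =
   \big[addb/false]_(j in S) \big[addb/false]_(k in S :\ j) (f (inc j v) && W j k (inc j v)).
  rewrite (exchange_big_dep (fun k => k \in S)) /=; last by move=> j k _; rewrite !inE => /andP[].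
  apply: eq_bigr => k kS; apply: eq_big => j; first by rewrite !inE kS andbT andbC eq_sym.
  by rewrite WC.
rewrite -big_split /= big1 // => j jS.
by rewrite -!big_distrr -andb_addr -big_split /= IH andbF.
Qed.

Fixpoint gsum m (s : seq 'I_d) (F : ('I_d -> nat) -> bool) v : bool :=
  if s is j :: s' then \big[addb/false]_(a < m) gsum m s' F (upd j a v) else F v.

Lemma updC j k a b v : j != k -> upd j a (upd k b v) = upd k b (upd j a v).
Proof.
move=> jk; apply/funext => i; rewrite /upd.
by case: eqP => // ->; rewrite (negbTE jk).
Qed.

Lemma gsum_addb m s T (r : seq T) (P : pred T) (F : T -> ('I_d -> nat) -> bool) v :
  gsum m s (fun v => \big[addb/false]_(j <- r | P j) F j v) v =
  \big[addb/false]_(j <- r | P j) gsum m s (F j) v.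
Proof.
elim: s v => //= k s IH v; rewrite exchange_big /=.
by apply: eq_bigr => a _; rewrite IH.
Qed.

Lemma eq_gsum m s F F' v : (forall v, F v = F' v) -> gsum m s F v = gsum m s F' v.
Proof. by move=> e; congr (gsum _ _ _ _); apply/funext. Qed.

Lemma gsum_upd m j a s F v : j \notin s ->
  gsum m s (fun w => F (upd j a w)) v = gsum m s F (upd j a v).
Proof.
elim: s v => //= k s IH v; rewrite inE negb_or => /andP[jk js].
by apply: eq_bigr => b _; rewrite IH // (updC _ _ _ jk).
Qed.

Lemma gsum_last m j s F v : j \notin s ->
  gsum m (j :: s) F v = gsum m s (fun v => \big[addb/false]_(a < m) F (upd j a v)) v.
Proof.
by move=> js; rewrite gsum_addb; apply: eq_bigr => a _; rewrite gsum_upd.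
Qed.

Lemma gsum_rem m j s F v : uniq s -> j \in s ->
  gsum m s F v = gsum m (rem j s) (fun v => \big[addb/false]_(a < m) F (upd j a v)) v.
Proof.
elim: s v => // k s IH v /= /andP[ks us]; rewrite inE eq_sym.
case: eqVneq => [<- _|kj /= js]; first by rewrite -gsum_last.
by apply: eq_bigr => a _; rewrite IH.
Qed.

Lemma inc_upd j a v : inc j (upd j a v) = upd j a.+1 v.
Proof. by apply/funext => i; rewrite /inc /upd; case: eqP => _; rewrite ?addn1 ?addn0. Qed.

Lemma big_addb_telescope (H : nat -> bool) m :
  \big[addb/false]_(a < m) (H a.+1 (+) H a) = H m (+) H 0%N.
Proof.
elim: m => [|m IH]; first by rewrite big_ord0 addbb.
by rewrite big_ord_recr /= IH addbC -addbA (addbA (H m)) addbb.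
Qed.

(** The coboundary of [F j] vanishes on the edges of a cube that lies in a face where [F j] is
    constant. *)
Lemma cup_slice (F : 'I_d -> ('I_d -> nat) -> bool) s S v j (b : bool) :
  j \in s -> j \notin S -> (forall w, w j = v j -> F j w = b) ->
  cup (map F s) S v = false.
Proof.
elim: s S v => // i s IH S v; rewrite inE => jis jS Fb /=; apply: big1 => k kS.
have kj : j != k by apply: contraNneq jS => ->.
have incj : inc k v j = v j by rewrite /inc (negbTE kj) addn0.
move: jis => /orP[/eqP<-|js]; first by rewrite !Fb ?addbb.
rewrite [cup _ _ _]IH ?andbF //; first by rewrite !inE negb_and jS orbT.
by move=> w; rewrite incj; apply: Fb.
Qed.

(** Induction on the dimension, as in Sperner's lemma: [cup_closed] turns the integrand into the
    coboundary of [F i] times the remaining product, and telescoping leaves boundary faces. The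
    faces in directions [j != i] vanish by [cup_slice], the face [w i = 0] because [F i] is false
    there, and the face [w i = m] is the case of [s]. *)
Lemma gsum_cup (F : 'I_d -> ('I_d -> nat) -> bool) m s v :
  (forall i w, w i = 0%N -> F i w = false) -> (forall i w, w i = m -> F i w = true) ->
  uniq s -> gsum m s (cup (map F s) [set i in s]) v = true.
Proof.
move=> F0 Fm; elim: s v => // i s IH v us.
have /andP[is_ us1] := us.
pose S := [set k in i :: s].
pose H j w := F i w && cup (map F s) (S :\ j) w.
transitivity (gsum m (i :: s) (fun w => \big[addb/false]_(j in S) (H j (inc j w) (+) H j w)) v).
  apply: eq_gsum => w /=; apply/eqP; rewrite -negb_add -big_split /=.
  rewrite (eq_bigr (fun j => F i w && (cup (map F s) (S :\ j) (inc j w) (+)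
     cup (map F s) (S :\ j) w))); last first.
    move=> j _; rewrite /H -/S.
    by case: (F i w); case: (F i (inc j w)); case: (cup _ _ _); case: (cup _ _ _).
  by rewrite -big_distrr /= cup_closed andbF.
rewrite gsum_addb (eq_bigr (fun j => j == i)); last first.
  move=> j; rewrite inE => jS.
  rewrite (@gsum_rem _ j) //.
  rewrite (@eq_gsum _ _ _ (fun w => H j (upd j m w) (+) H j (upd j 0 w))); last first.
    move=> w; under eq_bigr do rewrite inc_upd.
    exact: (big_addb_telescope (fun a => H j (upd j a w))).
  have updj a w : upd j a w j = a by rewrite /upd eqxx.
  case: (eqVneq j i) => [ji|ji].
    rewrite ji /= eqxx; rewrite -(IH (upd i m v)) //.
    transitivity (gsum m s (fun w => cup (map F s) [set k in s] (upd i m w)) v).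
      apply: eq_gsum => w; rewrite /H (F0 i (upd i 0 w)) ?addbF ?(Fm i (upd i m w)) -?ji //=.
      rewrite ji; congr cup.
      by apply/setP => k; rewrite !inE; case: eqVneq => //= ->; rewrite (negbTE is_).
    exact: gsum_upd.
  have js : j \in s by move: jS; rewrite inE (negbTE ji).
  transitivity (gsum m (rem j (i :: s)) (fun _ => false) v).
    have nj : j \notin S :\ j by rewrite !inE eqxx.
    apply: eq_gsum => w; rewrite /H.
    have -> : cup (map F s) (S :\ j) (upd j m w) = false.
      by apply: (cup_slice (b := true) js nj) => w'; rewrite updj; apply: Fm.
    have -> : cup (map F s) (S :\ j) (upd j 0 w) = false.
      by apply: (cup_slice (b := false) js nj) => w'; rewrite updj; apply: F0.
    by rewrite !andbF.
  by elim: (rem _ _) v => //= k r IHr v; rewrite big1.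
rewrite (bigD1 i) ?inE ?eqxx //= big1 // => j /andP[_ /negbTE]; by [].
Qed.

Lemma gsum_true m s F v : gsum m s F v = true -> exists w, F w = true.
Proof.
elim: s v => [|k s IH] v /=; first by exists v.
apply: contraPP => nF; rewrite big1 // => a _.
by apply/negbTE/negP => /IH.
Qed.

Lemma cup_true fs S v : cup fs S v = true -> forall f, List.In f fs ->
  exists w w', (forall i, v i <= w i <= (v i).+1)%N /\
    (forall i, v i <= w' i <= (v i).+1)%N /\ f w = true /\ f w' = false.
Proof.
suff H : cup fs S v = true -> forall f, List.In f fs ->
  exists w w', (forall i, v i <= w i <= v i + (i \in S))%N /\
    (forall i, v i <= w' i <= v i + (i \in S))%N /\ f w = true /\ f w' = false.
  move=> /H {}H f /H [w [w' [hw [hw' h]]]]; exists w, w'.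
  have e x : (v x + (x \in S) <= (v x).+1)%N by rewrite -addn1 leq_add2l leq_b1.
  by split; [|split] => // i; [have := hw i|have := hw' i] => /andP[-> h1];
    apply: (leq_trans h1).
elim: fs S v => // g fs IH S v /= /eqP.
case: (boolP [exists j in S, (g (inc j v) (+) g v) && cup fs (S :\ j) (inc j v)]); last first.
  move=> /existsPn hn; rewrite big1 // => j jS; apply/negbTE.
  by have := hn j; rewrite jS.
move=> /existsP[j /and3P[jS gj cj]] _ f.
have incS i : (inc j v i <= v i + (i \in S))%N.
  by rewrite /inc leq_add2l; case: eqVneq => // ->; rewrite jS.
have incv i : (v i <= inc j v i)%N by rewrite leq_addr.
move=> [<-|/(IH _ _ cj) [w [w' [hw [hw' h]]]]].
  case gv : (g v) gj; case gi : (g (inc j v)) => // _.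
  - by exists v, (inc j v); split=> [i|]; [|split=> [i|]]; rewrite ?gv ?gi ?leqnn ?leq_addr ?incv ?incS.
  - by exists (inc j v), v; split=> [i|]; [|split=> [i|]]; rewrite ?gv ?gi ?leqnn ?leq_addr ?incv ?incS.
exists w, w'.
have e i : (inc j v i + (i \in S :\ j) <= v i + (i \in S))%N.
  rewrite /inc -addnA leq_add2l !inE; case: eqVneq => [->|_] /=; by rewrite ?jS ?addn0 ?add0n.
by split; [|split] => // i; [have := hw i|have := hw' i] => /andP[h0 h1];
  rewrite (leq_trans (incv i) h0) (leq_trans h1 (e i)).
Qed.

Lemma chessboard (F : 'I_d -> ('I_d -> nat) -> bool) m :
  (forall i w, w i = 0%N -> F i w = false) -> (forall i w, w i = m -> F i w = true) ->
  exists v, forall i, exists w w', (forall j, v j <= w j <= (v j).+1)%N /\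
    (forall j, v j <= w' j <= (v j).+1)%N /\ F i w = true /\ F i w' = false.
Proof.
move=> F0 Fm; have := gsum_cup (fun _ => 0%N) F0 Fm (enum_uniq 'I_d).
move=> /gsum_true [v hv]; exists v => i.
apply: (cup_true hv).
have : i \in enum 'I_d by rewrite mem_enum.
elim: (enum 'I_d) => // k r IH; rewrite inE => /orP[/eqP ->|/IH]; [by left|by right].
Qed.

End CubicalCup.

Section PoincareMiranda.
Variable R : realType.

Lemma rV_near_ball (n : nat) (y : 'rV[R]_n) (A : set 'rV[R]_n) :
  nbhs y A -> exists2 e : R, 0 < e & forall z : 'rV[R]_n, (forall k, `|z 0 k - y 0 k| < e) -> A z.
Proof.
move=> /nbhs_ballP [e /= e0 eA]; exists e => // z hz; apply: eA; split => // i j.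
by rewrite ord1 /ball /= distrC hz.
Qed.

Lemma box_compact (d : nat) (a b : 'I_d -> R) :
  compact [set y : 'rV[R]_d | forall k, a k <= y 0 k <= b k].
Proof.
have := @rV_compact R d (fun k => [set` `[a k, b k]]) (fun k => @segment_compact _ _ _).
congr compact; apply/seteqP; split=> y /= h k; have := h k; by rewrite in_itv.
Qed.

(** A cluster point of the cubes given by [chessboard] on finer and finer grids: arbitrarily close
    to it every [F i] takes both a positive and a nonpositive value. *)
Lemma poincare_miranda (d : nat) (a b : 'I_d -> R) (F : 'I_d -> 'rV[R]_d -> R) :
  (forall i, a i < b i) -> (forall i, continuous (F i)) ->
  (forall i (y : 'rV[R]_d), (forall k, a k <= y 0 k <= b k) -> y 0 i = a i -> F i y < 0) ->
  (forall i (y : 'rV[R]_d), (forall k, a k <= y 0 k <= b k) -> y 0 i = b i -> 0 < F i y) ->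
  exists y : 'rV[R]_d, (forall k, a k <= y 0 k <= b k) /\ forall i, F i y = 0.
Proof.
move=> ab Fc Fa Fb.
pose B := [set y : 'rV[R]_d | forall k, a k <= y 0 k <= b k].
(* [minn] clamps the index, since the cube of [chessboard] is not known to lie in the grid. *)
pose pt (m : nat) (v : 'I_d -> nat) : 'rV[R]_d :=
  \row_k (a k + (b k - a k) * ((minn (v k) m.+1)%:R / m.+1%:R)).
have ptB m v : B (pt m v).
  move=> k; rewrite mxE; have := ab k => abk.
  have h0 : 0 <= (minn (v k) m.+1)%:R / m.+1%:R :> R by rewrite divr_ge0.
  have h1 : (minn (v k) m.+1)%:R / m.+1%:R <= 1 :> R.
    by rewrite ler_pdivrMr ?ltr0n // mul1r ler_nat geq_minr.
  by move: h0 h1 abk; move: (_ / _) (a k) (b k) => t x z h0 h1 abk; apply/andP; split; nra.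
have ex m : exists v, forall i, exists w w',
    (forall j, v j <= w j <= (v j).+1)%N /\ (forall j, v j <= w' j <= (v j).+1)%N /\
    (0 < F i (pt m w)) = true /\ (0 < F i (pt m w')) = false.
  apply: (@chessboard d (fun i w => 0 < F i (pt m w)) m.+1) => i w wi.
    apply/negbTE; rewrite -leNgt; apply/ltW/Fa; first exact: ptB.
    by rewrite mxE wi min0n mul0r mulr0 addr0.
  apply: Fb; first exact: ptB.
  by rewrite mxE wi minnn divff ?pnatr_eq0 // mulr1 addrC subrK.
pose y m := pt m (projT1 (cid (ex m))).
have [z [Bz zc]] : B `&` cluster (y @ \oo) !=set0.
  apply: (@box_compact d a b); exists 0%N => // m _; apply: ptB.
exists z; split=> // i.
have close (e : R) : 0 < e -> exists m w w', [/\ forall k, `|pt m w 0 k - z 0 k| < e,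
   forall k, `|pt m w' 0 k - z 0 k| < e, 0 < F i (pt m w) & F i (pt m w') <= 0].
  move=> e0.
  pose L := \sum_k (b k - a k).
  have L0 k : b k - a k <= L.
    by rewrite /L (bigD1 k) //= lerDl sumr_ge0 // => j _; rewrite subr_ge0 ltW.
  have [M hM] : exists M : nat, forall m, (M <= m)%N -> L / m.+1%:R < e / 2.
    exists (Num.truncn (L / (e / 2))).+1 => m hm; rewrite ltr_pdivrMr ?ltr0n //.
    rewrite mulrC -ltr_pdivrMr ?divr_gt0 //.
    by apply: (lt_le_trans (truncnS_gt _)); rewrite ler_nat leqW.
  have hM1 : (y @ \oo) [set y m | m in [set m | (M <= m)%N]].
    by exists M => // m /= hm; exists m.
  have nz : nbhs z [set x : 'rV[R]_d | forall k, `|x 0 k - z 0 k| < e / 2].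
    apply/nbhs_ballP; exists (e / 2) => /=; first by rewrite divr_gt0.
    by move=> x [_ hx] k; have := hx 0 k; rewrite /ball /= distrC.
  have [_ [[m /= Mm <-]]] := zc _ _ hM1 nz.
  rewrite /y; case: (cid _) => v hv /= hyz.
  have {hv} [w [w' [hw [hw' [Fw Fw']]]]] := hv i.
  have pt_close u k : (forall j, v j <= u j <= (v j).+1)%N -> `|pt m u 0 k - pt m v 0 k| < e / 2.
    move=> /(_ k) hu; rewrite !mxE.
    have -> : a k + (b k - a k) * ((minn (u k) m.+1)%:R / m.+1%:R) -
      (a k + (b k - a k) * ((minn (v k) m.+1)%:R / m.+1%:R)) =
      (b k - a k) / m.+1%:R * ((minn (u k) m.+1)%:R - (minn (v k) m.+1)%:R) by ring.
    apply: le_lt_trans (hM m Mm); rewrite normrM.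
    have hk : 0 < b k - a k by rewrite subr_gt0.
    rewrite [X in X * _]gtr0_norm; last by rewrite divr_gt0 ?ltr0n.
    rewrite -[leRHS]mulr1; apply: ler_pM => //.
    - by rewrite divr_ge0 // ltW.
    - by rewrite ler_pM2r ?invr_gt0 ?ltr0n.
    have h1 : (minn (v k) m.+1 <= minn (u k) m.+1)%N by lia.
    have h2 : (minn (u k) m.+1 <= minn (v k) m.+1 + 1)%N by lia.
    move: h1 h2; rewrite -!(ler_nat R) natrD ler_norml => h1 h2.
    by apply/andP; split; lra.
  exists m, w, w'; split.
  - move=> k; have := pt_close w k hw; have := hyz k.
    rewrite !ltr_norml => /andP[? ?] /andP[? ?]; apply/andP; split; lra.
  - move=> k; have := pt_close w' k hw'; have := hyz k.
    rewrite !ltr_norml => /andP[? ?] /andP[? ?]; apply/andP; split; lra.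
  - by rewrite Fw.
  - by rewrite leNgt Fw'.
apply/eqP; rewrite eq_le; apply/andP; split; rewrite leNgt; apply/negP => hF.
- have /rV_near_ball[e e0 he] : nbhs z [set x | 0 < F i x].
    exact: (Fc i z _ (lt_nbhsr hF)).
  have [m [w [w' [_ /he /= h _]]]] := close e e0.
  by rewrite leNgt h.
- have /rV_near_ball[e e0 he] : nbhs z [set x | F i x < 0].
    exact: (Fc i z _ (lt_nbhsl hF)).
  have [m [w [w' [/he /= h _ h' _]]]] := close e e0.
  by have := lt_trans h h'; rewrite ltxx.
Unshelve. all: by end_near. Qed.

End PoincareMiranda.

(** * Linking and the discrete action of loops *)

Section Linking.
Variable R : realType.

(* Minimax without a flow: the box [iota] links [Psi = 0], hence Poincare-Miranda
   applied to [Psi] after [j] explicit gradient steps (switched off near the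
   boundary by a collar) yields a point of [iota] that the steps carry into
   [Phi >= beta]; were the gradient large all along, [Phi] would have dropped
   below [beta]. *)
Lemma linking (E : normedModType R) (Phi : E -> R) (F : E -> E) (sq : E -> R)
    (eps beta M : R) (d : nat) (a b c : 'I_d -> R) (iota : 'rV[R]_d -> E)
    (Psi : 'I_d -> E -> R) :
  continuous F -> 0 < eps ->
  (forall z s, 0 <= s -> s <= eps -> Phi (z - s *: F z) <= Phi z - s / 2 * sq (F z)) ->
  (forall v, 0 <= sq v) ->
  continuous iota -> (forall i, continuous (Psi i)) ->
  (forall i, a i < c i) -> (forall i, c i < b i) ->
  (forall u : 'rV[R]_d, (forall k, a k <= u 0 k <= b k) ->
     forall i, Psi i (iota u) = u 0 i - c i) ->
  (forall z, (forall i, Psi i z = 0) -> beta <= Phi z) ->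
  (forall u : 'rV[R]_d, (forall k, a k <= u 0 k <= b k) ->
     (exists i, u 0 i = a i \/ u 0 i = b i) -> Phi (iota u) < beta) ->
  (forall u : 'rV[R]_d, (forall k, a k <= u 0 k <= b k) -> Phi (iota u) <= M) ->
  forall delta, 0 < delta -> exists z, beta <= Phi z /\ sq (F z) <= delta.
Proof.
move=> Fc eps0 descent sq0 iotac Psic ac cb Psi_iota Psi0 bdry ubM delta delta0.
apply: contrapT => /forallNP noz.
have big z : beta <= Phi z -> delta < sq (F z).
  by move=> bz; rewrite ltNge; apply/negP => h; apply: (noz z).
have [j hj] : exists j : nat, M - beta < j%:R * (eps * delta / 2).
  exists (Num.truncn ((M - beta) / (eps * delta / 2))).+1.
  by rewrite -ltr_pdivrMr ?truncnS_gt // divr_gt0 ?mulr_gt0.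
pose st (t : R) (z : E) := z - (t * eps) *: F z.
pose h t := iter j (st t).
have stc (g : 'rV[R]_d -> R) (k : 'rV[R]_d -> E) :
    continuous g -> continuous k -> continuous (fun y => st (g y) (k y)).
  move=> gc kc; apply: fctB_continuous => //; apply: fctZ_continuous.
    by apply: fctM_continuous => //; exact: fct_cst_continuous.
  exact: fct_comp_continuous.
have hc (g : 'rV[R]_d -> R) (k : 'rV[R]_d -> E) :
    continuous g -> continuous k -> continuous (fun y => h (g y) (k y)).
  move=> gc kc; rewrite /h; elim: (j) => [|i IH] //=.
  exact: stc.
have st_le t z : 0 <= t <= 1 -> Phi (st t z) <= Phi z.
  move=> /andP[t0 t1]; apply: le_trans (descent _ _ _ _) _.
  - by rewrite mulr_ge0 // ltW.
  - by rewrite ger_pMl.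
  - by rewrite gerBl mulr_ge0 ?sq0 // divr_ge0 // mulr_ge0 // ltW.
have h_le t z i : 0 <= t <= 1 -> Phi (iter i (st t) z) <= Phi z.
  by move=> t01; elim: i => //= i IH; exact: le_trans (st_le _ _ _) IH.
(* [cl] projects onto the box and [e] is the distance to it in the sum norm. At distance 1 the
   descent is off, so on the boundary of the box enlarged by 1 the map is [cl y - c], with the signs
   that Poincare-Miranda requires. *)
pose cl (y : 'rV[R]_d) : 'rV[R]_d := \row_k Num.max (a k) (Num.min (b k) (y 0 k)).
pose e (y : 'rV[R]_d) : R := \sum_k `|y 0 k - cl y 0 k|.
pose tau y := Num.max 0 (1 - e y).
have ab k : a k < b k by apply: lt_trans (ac k) (cb k).
have clb y k : a k <= cl y 0 k <= b k.
  rewrite mxE le_max lexx /= ge_max ge_min lexx /= andbT; exact/ltW.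
have ycc k : continuous (fun y : 'rV[R]_d => y 0 k) by exact: coord_continuous.
have clkc k : continuous (fun y => cl y 0 k).
  have -> : (fun y => cl y 0 k) = (fun y => Num.max (a k) (Num.min (b k) (y 0 k))).
    by apply/funext => y; rewrite mxE.
  apply: fct_max_continuous; first exact: fct_cst_continuous.
  by apply: fct_min_continuous => //; exact: fct_cst_continuous.
have clc : continuous cl.
  by apply: mx_continuous => i k; rewrite ord1; exact: clkc.
have e0 y : 0 <= e y by apply: sumr_ge0.
have tauc : continuous tau.
  apply: fct_max_continuous; first exact: fct_cst_continuous.
  apply: fctB_continuous; first exact: fct_cst_continuous.
  by apply: fct_sum_continuous => k; apply: fct_norm_continuous; exact: fctB_continuous.
have tau01 y : 0 <= tau y <= 1.
  by rewrite /tau le_max lexx /= ge_max ler01 gerBl e0.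
pose G i y := Psi i (h (tau y) (iota (cl y))).
have hj0 z : h 0 z = z.
  by rewrite /h; elim: (j) => //= i ->; rewrite /st mul0r scale0r subr0.
have outer i (y : 'rV[R]_d) : 1 <= `|y 0 i - cl y 0 i| -> G i y = cl y 0 i - c i.
  move=> h1; rewrite /G.
  have -> : tau y = 0.
    apply/max_idPl; rewrite subr_le0; apply: le_trans h1 _.
    by rewrite /e (bigD1 i) //= lerDl sumr_ge0.
  by rewrite hj0 Psi_iota.
have [||||y [yb Gy]] := @poincare_miranda R d (fun k => a k - 1) (fun k => b k + 1) G.
- by move=> i; have := ab i; lra.
- move=> i; apply: fct_comp_continuous; last exact: Psic.
  by apply: hc => //; exact: fct_comp_continuous.
- move=> i y yb yi; have cli : cl y 0 i = a i.
    by rewrite mxE yi; have := ab i => abi; rewrite min_r ?max_l //; lra.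
  rewrite outer cli ?yi ?subr_lt0 //.
  by rewrite addrAC subrr add0r normrN1.
- move=> i y yb yi; have cli : cl y 0 i = b i.
    by rewrite mxE yi; have := ab i => abi; rewrite min_l ?max_r //; lra.
  by rewrite outer cli ?yi ?subr_gt0 // addrAC subrr add0r normr1.
have Phi_h : beta <= Phi (h (tau y) (iota (cl y))) by apply: Psi0.
(* At a zero the deformed point has [Phi] at least [beta], whereas points of the boundary start
   below [beta] and only descend. *)
have [bd|nbd] := pselect (exists i, cl y 0 i = a i \/ cl y 0 i = b i).
  have := bdry _ (clb y) bd; rewrite ltNge => /negP; apply.
  by apply: le_trans Phi_h _; exact: h_le.
have cly : e y = 0.
  rewrite /e big1 // => k _; apply/eqP; rewrite normr_eq0 subr_eq0; apply/eqP.
  apply: contra_notP nbd => yk; exists k; move: yk; rewrite !mxE.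
  case: (leP (b k) (y 0 k)) => [_ _|yb']; first by right; rewrite max_r ?ltW.
  by case: (leP (a k) (y 0 k)) => // _ _; left.
have tau1 : tau y = 1 by rewrite /tau cly subr0 max_r.
rewrite tau1 in Phi_h.
pose z i := iter i (st 1) (iota (cl y)).
have zb i : (i <= j)%N -> beta <= Phi (z i).
  move=> ij; apply: le_trans Phi_h _; rewrite /h -(subnK ij) iterD.
  by apply: h_le; rewrite ler01 lexx.
have dec i : (i <= j)%N -> Phi (z i) <= M - i%:R * (eps * delta / 2).
  elim: i => [|i IH] ij; first by rewrite mul0r subr0; exact: ubM.
  have ij' := ltnW ij.
  have h1 := descent (z i) eps (ltW eps0) (lexx _).
  have h2 : eps / 2 * delta <= eps / 2 * sq (F (z i)).
    by rewrite ler_wpM2l ?divr_ge0 ?ltW // big // zb.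
  rewrite -[z i.+1]/(st 1 (z i)) /st mul1r -natr1.
  by apply: le_trans h1 _; have := IH ij'; lra.
have := dec j (leqnn _); have := zb j (leqnn _); lra.
Qed.

End Linking.

(** * Cyclic sequences and the discrete isoperimetric inequality *)

Section CyclicSequences.
Variables (R : realType) (N : nat).
Implicit Types (f g : 'I_N -> R).

Lemma sum_ordS f : \sum_k f (ordS k) = \sum_k f k.
Proof. by rewrite [RHS](reindex_inj (can_inj (@ordSK N))). Qed.

Lemma sum_ord_pred f : \sum_k f (ord_pred k) = \sum_k f k.
Proof. by rewrite [RHS](reindex_inj (can_inj (@ord_predK N))). Qed.

Lemma sum_diff f : \sum_k (f (ordS k) - f k) = 0.
Proof. by rewrite sumrB sum_ordS subrr. Qed.

Lemma sum_shift f g : \sum_k f k * g (ordS k) = \sum_k f (ord_pred k) * g k.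
Proof.
by rewrite -[RHS](sum_ordS (fun k => f (ord_pred k) * g k)); apply: eq_bigr => k _; rewrite ordSK.
Qed.

(** Summation by parts against an eigenfunction of the cyclic second difference. *)
Lemma sum_diffM (a b : 'I_N -> R) (sg : R) : (forall k, 2 * a k - a (ordS k) - a (ord_pred k) = sg ^+ 2 * a k) ->
  \sum_k (a (ordS k) - a k) * (b (ordS k) - b k) = sg ^+ 2 * \sum_k a k * b k.
Proof.
move=> ha; rewrite mulr_sumr.
transitivity (\sum_k (a (ordS k) * b (ordS k) - a (ordS k) * b k - a k * b (ordS k) + a k * b k)).
  by apply: eq_bigr => k _; ring.
rewrite !big_split /= (sum_ordS (fun k => a k * b k)) !sumrN sum_shift -!sumrN -!big_split /=.
by apply: eq_bigr => k _; rewrite mulrA -ha; ring.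
Qed.

(** The first harmonic [s * a] alone attains equality; the part [b], whose momentum opposes its
    velocity, and the constant [p0] only add squares to the right-hand side, so the defect is an
    explicit sum of squares. *)
Lemma discrete_action_le (a b : 'I_N -> R) (sg s p0 : R) : 0 < sg ->
  (forall k, 2 * a k - a (ordS k) - a (ord_pred k) = sg ^+ 2 * a k) ->
  let x k := s * a k + b k in
  let p k := p0 + sg^-1 * (s * (a (ordS k) - a k) - (b (ordS k) - b k)) in
  \sum_k p k * (x (ordS k) - x k) <= sg / 2 * \sum_k (x k ^+ 2 + p k ^+ 2).
Proof.
move=> sg0 ha; cbv zeta; pose x k := s * a k + b k.
pose p k := p0 + sg^-1 * (s * (a (ordS k) - a k) - (b (ordS k) - b k)).
change (\sum_k p k * (x (ordS k) - x k) <= sg / 2 * \sum_k (x k ^+ 2 + p k ^+ 2)).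
have [Da hDa] : exists D : 'I_N -> R, forall k, D k = a (ordS k) - a k by eexists.
have [Db hDb] : exists D : 'I_N -> R, forall k, D k = b (ordS k) - b k by eexists.
have Da0 : \sum_k Da k = 0 by under eq_bigr do rewrite hDa; exact: sum_diff.
have Db0 : \sum_k Db k = 0 by under eq_bigr do rewrite hDb; exact: sum_diff.
have DaDa : \sum_k Da k * Da k = sg ^+ 2 * \sum_k a k * a k.
  by under eq_bigr do rewrite hDa; exact: sum_diffM.
have DaDb : \sum_k Da k * Db k = sg ^+ 2 * \sum_k a k * b k.
  by under eq_bigr do rewrite hDa hDb; exact: sum_diffM.
have -> : \sum_k p k * (x (ordS k) - x k) =
   p0 * s * \sum_k Da k + p0 * \sum_k Db k + sg^-1 * s ^+ 2 * \sum_k Da k * Da k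
   - sg^-1 * \sum_k Db k * Db k.
  by rewrite !mulr_sumr -sumrN -!big_split /=; apply: eq_bigr => k _; rewrite /p /x hDa hDb; ring.
have -> : \sum_k (x k ^+ 2 + p k ^+ 2) = s ^+ 2 * (\sum_k a k * a k) + (\sum_k b k ^+ 2) +
   2 * s * (\sum_k a k * b k) + \sum_(k < N) p0 ^+ 2 + 2 * p0 * sg^-1 * s * (\sum_k Da k) -
   2 * p0 * sg^-1 * (\sum_k Db k) + sg^-1 ^+ 2 * (s ^+ 2 * (\sum_k Da k * Da k) -
   2 * s * (\sum_k Da k * Db k) + \sum_k Db k * Db k).
  transitivity (\sum_k (s ^+ 2 * (a k * a k) + b k ^+ 2 + (2 * s) * (a k * b k) + p0 ^+ 2 +
     (2 * p0 * sg^-1 * s) * Da k + (- (2 * p0 * sg^-1)) * Db k +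
     (sg^-1 ^+ 2 * s ^+ 2) * (Da k * Da k) + (- (sg^-1 ^+ 2 * (2 * s))) * (Da k * Db k) +
     sg^-1 ^+ 2 * (Db k * Db k))).
    by apply: eq_bigr => k _; rewrite /p /x hDa hDb; ring.
  rewrite !big_split /= -!mulr_sumr.
  by ring.
rewrite Da0 Db0 DaDa DaDb.
have h1 : 0 <= \sum_k Db k * Db k by apply: sumr_ge0 => k _; rewrite -expr2 sqr_ge0.
have h2 : 0 <= \sum_k b k ^+ 2 by apply: sumr_ge0 => k _; rewrite sqr_ge0.
have h3 : 0 <= \sum_(k < N) p0 ^+ 2 by apply: sumr_ge0 => k _; rewrite sqr_ge0.
move: (\sum_k Db k * Db k) (\sum_k b k ^+ 2) (\sum_(k < N) p0 ^+ 2) h1 h2 h3 => B b2 P B0 b20 P0.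
move: (\sum_k a k * a k) (\sum_k a k * b k) => aa ab.
have sgn : sg != 0 by rewrite gt_eqF.
rewrite -subr_ge0.
have -> : sg / 2 * (s ^+ 2 * aa + b2 + 2 * s * ab + P + 2 * p0 * sg^-1 * s * 0 -
   2 * p0 * sg^-1 * 0 + sg^-1 ^+ 2 *
   (s ^+ 2 * (sg ^+ 2 * aa) - 2 * s * (sg ^+ 2 * ab) + B)) -
   (p0 * s * 0 + p0 * 0 + sg^-1 * s ^+ 2 * (sg ^+ 2 * aa) - sg^-1 * B) =
   sg / 2 * b2 + sg / 2 * P + (3 / 2) * (sg^-1 * B).
  by field.
have ? : 0 <= sg^-1 by rewrite invr_ge0 ltW.
by rewrite !addr_ge0 // !mulr_ge0 // ?divr_ge0 // ltW.
Qed.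

Lemma sin_le_id (x : R) : 0 <= x -> sin x <= x.
Proof.
rewrite le_eqVlt => /predU1P[<-|x0]; first by rewrite sin0.
have sc : {within `[0, x], continuous (@sin R)}.
  by apply: continuous_subspaceT; exact: continuous_sin.
have [c _] := @MVT R sin cos 0 x x0 (fun y _ => is_derive_sin y) sc.
by rewrite sin0 !subr0 => ->; rewrite ger_pMl // cos_le1.
Qed.

End CyclicSequences.

Section FirstHarmonic.
Variables (R : realType) (N' : nat).
Let N := N'.+3.
Let th : R := pi / N%:R.

(* The first eigenfunction of the cyclic second difference on [N] points, with
   eigenvalue [sgm ^+ 2] (see [harm_rec]). *)
Definition harm (k : 'I_N) : R := sin (th * 2 * k%:R).
Definition sgm : R := 2 * sin th.

Lemma th_gt0 : 0 < th. Proof. by rewrite divr_gt0 ?pi_gt0 ?ltr0n. Qed.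

Lemma sgm_gt0 : 0 < sgm.
Proof.
rewrite mulr_gt0 // sin_gt0_pi // th_gt0 /= ltr_pdivrMr ?ltr0n //.
by rewrite -[ltLHS]mulr1 ltr_pM2l ?pi_gt0 // ltr1n.
Qed.

(** Bounds the discrete isoperimetric constant [sgm / 2] by the continuous one, [pi] times the mesh,
    whatever the number of points. *)
Lemma sgm_le : sgm / 2 <= pi * N%:R^-1.
Proof. by rewrite /sgm mulrAC divff ?pnatr_eq0 // mul1r sin_le_id // ltW // th_gt0. Qed.

Lemma harm0 : harm ord0 = 0. Proof. by rewrite /harm mulr0 sin0. Qed.

Lemma sin_th2S (k : 'I_N) : harm (ordS k) = sin (th * 2 * k%:R + th * 2).
Proof.
have Nth : th * 2 * N%:R = pi *+ 2.
  by rewrite mulrAC /th divfK ?pnatr_eq0 //; ring.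
rewrite /harm /ordS /=; have [kN|kN] := ltnP k.+1 N.
  by rewrite modn_small //; congr sin; rewrite -(natr1 k); ring.
have kE : k.+1 = N by apply/eqP; rewrite eqn_leq kN ltn_ord.
rewrite kE modnn mulr0 sin0.
have -> : th * 2 * k%:R + th * 2 = pi *+ 2 by rewrite -Nth -[N in RHS]kE -(natr1 k); ring.
by rewrite sin2pi.
Qed.

Lemma sin_th2P (k : 'I_N) : harm (ord_pred k) = sin (th * 2 * k%:R - th * 2).
Proof.
have Nth : th * 2 * N%:R = pi *+ 2.
  by rewrite mulrAC /th divfK ?pnatr_eq0 //; ring.
rewrite -[k in RHS]ord_predK; set i := ord_pred k.
rewrite /ordS /=; have [kN|kN] := ltnP i.+1 N.
  by rewrite modn_small // /harm; congr sin; rewrite -(natr1 i); ring.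
have kE : i.+1 = N by apply/eqP; rewrite eqn_leq kN ltn_ord.
rewrite kE modnn mulr0 sub0r /harm.
have -> : th * 2 * i%:R = - (th * 2) + pi *+ 2.
  by rewrite -Nth -[N in RHS]kE -(natr1 i); ring.
by rewrite sinD cos2pi sin2pi mulr0 mulr1 addr0.
Qed.

Lemma harm_rec k : 2 * harm k - harm (ordS k) - harm (ord_pred k) = sgm ^+ 2 * harm k.
Proof.
rewrite sin_th2S sin_th2P sinB sinD /sgm /harm.
have -> : cos (th * 2) = 1 - 2 * sin th ^+ 2.
  by rewrite mulr_natr cos_mulr2n cos2sin2; ring.
ring.
Qed.

Lemma harm_diff_gt0 : 0 < \sum_k `|harm (ordS k) - harm k|.
Proof.
rewrite (bigD1 ord0) //= ltr_pwDl ?sumr_ge0 // harm0 subr0 normr_gt0.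
rewrite sin_th2S mulr0 add0r gt_eqF // sin_gt0_pi // mulr_gt0 ?th_gt0 //=.
rewrite /th mulrAC ltr_pdivrMr ?ltr0n // ltr_pM2l ?pi_gt0 //.
by rewrite ltr_nat.
Qed.

End FirstHarmonic.

(** * The action of a discrete loop and its gradient *)

Section DiscreteAction.
Variables (R : realType) (n N' : nat).
Let N := N'.+3.
Let h : R := N%:R^-1.
Variables (Hb : 'rV[R]_(n + n) -> R) (dH : 'rV[R]_(n + n) -> 'rV[R]_(n + n)).
Variable Lam : R.
Hypothesis Lam0 : 0 <= Lam.
Hypothesis Hquad : forall z v, `|Hb (z + v) - Hb z - dotv (dH z) v| <= Lam * dotv v v.
Hypothesis dHc : continuous dH.

Implicit Types z v : 'M[R]_(N, n + n).

(* A loop is an [N]-periodic sequence of points of phase space, the rows of [z]. *)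
Definition xc z (k : 'I_N) (i : 'I_n) : R := z k (lshift n i).
Definition pc z (k : 'I_N) (i : 'I_n) : R := z k (rshift n i).
Definition loop_area z : R := \sum_k \sum_i pc z k i * (xc z (ordS k) i - xc z k i).
Definition loop_action z : R := loop_area z - h * \sum_k Hb (row k z).
(** Summation by parts turns the forward difference in [x] into a backward one in [p]: the zeros are
    the closed orbits of a symplectic Euler scheme with step [h]. *)
Definition loop_grad z : 'M[R]_(N, n + n) :=
  \matrix_k row_mx (\row_i (pc z (ord_pred k) i - pc z k i))
                   (\row_i (xc z (ordS k) i - xc z k i))
  - \matrix_k (h *: dH (row k z)).
Definition sqsum z : R := \sum_k dotv (row k z) (row k z).

Lemma loop_gradEx z k i : loop_grad z k (lshift n i) =
  pc z (ord_pred k) i - pc z k i - h * dH (row k z) 0 (lshift n i).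
Proof. by rewrite 2!mxE row_mxEl !mxE. Qed.

Lemma loop_gradEp z k i : loop_grad z k (rshift n i) =
  xc z (ordS k) i - xc z k i - h * dH (row k z) 0 (rshift n i).
Proof. by rewrite 2!mxE row_mxEr !mxE. Qed.

Lemma dotv_split (x y : 'rV[R]_(n + n)) :
  dotv x y = \sum_i x 0 (lshift n i) * y 0 (lshift n i) +
             \sum_i x 0 (rshift n i) * y 0 (rshift n i).
Proof. by rewrite /dotv big_split_ord. Qed.

Lemma dotv_ge0 m (x : 'rV[R]_m) : 0 <= dotv x x.
Proof. by apply: sumr_ge0 => i _; rewrite -expr2 sqr_ge0. Qed.

Lemma sqsum_ge0 z : 0 <= sqsum z.
Proof. by apply: sumr_ge0 => k _; apply: dotv_ge0. Qed.

Lemma sqsumE z : sqsum z = \sum_k \sum_i (xc z k i ^+ 2 + pc z k i ^+ 2).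
Proof.
apply: eq_bigr => k _; rewrite dotv_split -big_split /=.
by apply: eq_bigr => i _; rewrite !mxE !expr2.
Qed.

Lemma loop_areaD z v : loop_area (z + v) = loop_area z + loop_area v +
  \sum_k \sum_i ((pc z (ord_pred k) i - pc z k i) * xc v k i +
                 (xc z (ordS k) i - xc z k i) * pc v k i).
Proof.
have -> : \sum_k \sum_i ((pc z (ord_pred k) i - pc z k i) * xc v k i +
                 (xc z (ordS k) i - xc z k i) * pc v k i) =
  \sum_i \sum_k (pc z k i * (xc v (ordS k) i - xc v k i) + (xc z (ordS k) i - xc z k i) * pc v k i).
  rewrite exchange_big; apply: eq_bigr => i _ /=.
  rewrite !big_split /=; congr (_ + _).
  under eq_bigr do rewrite mulrBl.
  under [RHS]eq_bigr do rewrite mulrBr.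
  by rewrite !sumrB (sum_shift (fun k => pc z k i) (fun k => xc v k i)).
rewrite exchange_big /= -!big_split /=; apply: eq_bigr => k _.
rewrite -!big_split /=; apply: eq_bigr => i _.
by rewrite /xc /pc !mxE; ring.
Qed.

Lemma loop_area_le v : loop_area v <= 2 * sqsum v.
Proof.
rewrite sqsumE (exchange_big_dep predT) //= /loop_area (exchange_big_dep predT) //= mulr_sumr.
apply: ler_sum => i _.
apply: (@le_trans _ _ (\sum_k (pc v k i ^+ 2 + 2^-1 * (xc v (ordS k) i ^+ 2 + xc v k i ^+ 2)))).
  apply: ler_sum => k _.
  have aux (p x y : R) : p * (x - y) <= p ^+ 2 + 2^-1 * (x ^+ 2 + y ^+ 2).
    have := sqr_ge0 (p - x); have := sqr_ge0 (p + y); rewrite !expr2; nra.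
  exact: aux.
rewrite !big_split /= -mulr_sumr big_split /= (sum_ordS (fun k => xc v k i ^+ 2)).
have h1 : 0 <= \sum_k pc v k i ^+ 2 by apply: sumr_ge0 => k _; apply: sqr_ge0.
have h2 : 0 <= \sum_k xc v k i ^+ 2 by apply: sumr_ge0 => k _; apply: sqr_ge0.
lra.
Qed.

Lemma h_itv : 0 < h <= 1.
Proof. by rewrite invr_gt0 ltr0n /= invf_le1 ?ltr0n // ler1n. Qed.

Lemma loop_grad_dot z v : \sum_k dotv (row k (loop_grad z)) (row k v) =
  \sum_k \sum_i ((pc z (ord_pred k) i - pc z k i) * xc v k i +
                 (xc z (ordS k) i - xc z k i) * pc v k i)
  - h * \sum_k dotv (dH (row k z)) (row k v).
Proof.
rewrite mulr_sumr -sumrB; apply: eq_bigr => k _.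
rewrite !dotv_split mulrDr !mulr_sumr -!big_split /= -sumrB.
apply: eq_bigr => i _; rewrite ![row k _ 0 _]mxE loop_gradEx loop_gradEp /xc /pc; ring.
Qed.

Lemma loop_action_quad z v : loop_action (z + v) <= loop_action z +
  \sum_k dotv (row k (loop_grad z)) (row k v) + (2 + Lam) * sqsum v.
Proof.
have /andP[h0 h1] := h_itv.
rewrite /loop_action loop_areaD loop_grad_dot.
have e1 := loop_area_le v.
have e2 : h * \sum_k Hb (row k z) + h * \sum_k dotv (dH (row k z)) (row k v) - Lam * sqsum v
   <= h * \sum_k Hb (row k (z + v)).
  apply: (@le_trans _ _ (h * \sum_k Hb (row k z) + h * \sum_k dotv (dH (row k z)) (row k v)
     - h * (Lam * sqsum v))).
    rewrite lerD2l lerN2.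
    have := mulr_ge0 Lam0 (sqsum_ge0 v).
    by move: (Lam * _) => t t0; rewrite ler_piMl // ltW.
  rewrite -!mulrDr -mulrBr ler_pM2l // /sqsum mulr_sumr -big_split /= -sumrB.
  apply: ler_sum => k _; rewrite linearD /=.
  have := Hquad (row k z) (row k v); rewrite ler_norml => /andP[]; lra.
move: e1 e2; lra.
Qed.

Lemma loop_action_descent z s : 0 <= s -> s <= (2 * (2 + Lam))^-1 ->
  loop_action (z - s *: loop_grad z) <= loop_action z - s / 2 * sqsum (loop_grad z).
Proof.
move=> s0 s1; apply: le_trans (loop_action_quad _ _) _.
have -> : \sum_k dotv (row k (loop_grad z)) (row k (- (s *: loop_grad z))) =
    - s * sqsum (loop_grad z).
  rewrite mulr_sumr; apply: eq_bigr => k _; rewrite /dotv mulr_sumr.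
  by apply: eq_bigr => i _; rewrite !mxE; ring.
have -> : sqsum (- (s *: loop_grad z)) = s ^+ 2 * sqsum (loop_grad z).
  rewrite mulr_sumr; apply: eq_bigr => k _; rewrite /dotv mulr_sumr.
  by apply: eq_bigr => i _; rewrite !mxE; ring.
have := sqsum_ge0 (loop_grad z); move: (sqsum _) (loop_action _) => q A q0.
have L2 : 0 < 2 + Lam by rewrite ltr_pwDl.
have : s * (2 + Lam) <= 2^-1.
  by rewrite -ler_pdivlMr // -invfM.
move=> h1; have := mulr_ge0 (mulr_ge0 s0 q0) (_ : 0 <= 2^-1 - s * (2 + Lam)).
rewrite subr_ge0 => /(_ h1) h2; rewrite -subr_ge0.
suff -> : A - s / 2 * q - (A + - s * q + (2 + Lam) * (s ^+ 2 * q)) = s * q * (2^-1 - s * (2 + Lam)) by [].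
by field.
Qed.

Lemma loop_grad_continuous : continuous loop_grad.
Proof.
have dHrow k j : continuous (fun z : 'M[R]_(N, n + n) => h * dH (row k z) 0 j).
  apply: fctM_continuous; first exact: fct_cst_continuous.
  apply: (@fct_comp_continuous _ _ _ (fun z => dH (row k z)) (fun w => w 0 j)); last exact: coord_continuous.
  apply: fct_comp_continuous dHc; apply: mx_continuous => i' j'.
  by under eq_fun do rewrite mxE; exact: coord_continuous.
apply: mx_continuous => k j.
have [i|i] := split_ordP j => ->; under eq_fun do rewrite ?loop_gradEx ?loop_gradEp;
   apply: fctB_continuous => //; apply: fctB_continuous; exact: coord_continuous.
Qed.

End DiscreteAction.

(** * Almost critical discrete loops of positive action *)

Section MorseSequence.
Variables (R : realType).

(** The vanishing total accounts for the wrap-around from the last index to 0. *)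
Lemma cumsum_ordS (N : nat) (c : 'I_N.+1 -> R) k : \sum_k c k = 0 ->
  \sum_(l < N.+1 | (l < ordS k)%N) c l - \sum_(l < N.+1 | (l < k)%N) c l = c k.
Proof.
move=> c0; apply/eqP; rewrite subr_eq addrC eq_sym; apply/eqP.
have -> : \sum_(l < N.+1 | (l < k)%N) c l + c k = \sum_(l < N.+1 | (l < k.+1)%N) c l.
  rewrite [RHS](bigD1 k) //= addrC; congr (_ + _); apply: eq_bigl => l.
  by rewrite ltnS ltn_neqAle andbC.
rewrite /ordS /=; have [kN|kN] := ltnP k.+1 N.+1; first by rewrite modn_small.
have -> : k.+1 = N.+1 by apply/eqP; rewrite eqn_leq kN ltn_ord.
rewrite modnn [RHS]big1 // -[RHS]c0; apply: eq_bigl => l; by rewrite ltn_ord.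
Qed.

Lemma dist_le_sum_diff (N : nat) (f : 'I_N.+1 -> R) k :
  `|f k - f ord0| <= \sum_k `|f (ordS k) - f k|.
Proof.
have H m (hm : (m < N.+1)%N) : `|f (Ordinal hm) - f ord0| <=
    \sum_(k < N.+1 | (k < m)%N) `|f (ordS k) - f k|.
  elim: m hm => [|m IH] hm.
    by rewrite big1 // [Ordinal hm](_ : _ = ord0) ?subrr ?normr0 //; exact: val_inj.
  have hm' := ltnW hm; pose k0 := Ordinal hm'.
  have k0S : ordS k0 = Ordinal hm by apply: val_inj; rewrite /= modn_small.
  rewrite (bigD1 k0) /=; last exact: leqnn.
  rewrite (eq_bigl (fun k : 'I_N.+1 => (k < m)%N)); last first.
    by move=> l; rewrite ltnS ltn_neqAle andbC.
  apply: le_trans (_ : `|f (ordS k0) - f k0| + `|f k0 - f ord0| <= _).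
    by rewrite k0S -{1}[f (Ordinal hm)](subrK (f k0)) -addrA ler_normD.
  by rewrite lerD2l; exact: IH.
case: k => m hm; apply: le_trans (H m hm) _.
rewrite [leRHS](bigID (fun k : 'I_N.+1 => (k < m)%N)) /= lerDl; exact: sumr_ge0.
Qed.

Lemma discrete_area_le0 (N : nat) (b : 'I_N -> R) (c p0 : R) : 0 <= c ->
  \sum_k (p0 - c * (b (ordS k) - b k)) * (b (ordS k) - b k) <= 0.
Proof.
move=> c0; under eq_bigr do rewrite mulrBl.
rewrite sumrB -mulr_sumr sum_diff mulr0 sub0r oppr_le0; apply: sumr_ge0 => k _.
by rewrite -mulrA mulr_ge0 // -expr2 sqr_ge0.
Qed.

Lemma le_sub_chain (A B C D E F G : R) :
  A <= D -> E - C <= B -> D <= F -> 0 <= G -> A - B <= C - (E - F - G).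
Proof. lra. Qed.

Variables (n N' : nat).
Let N := N'.+3.
Let h : R := N%:R^-1.
Variables (Hb : 'rV[R]_(n + n) -> R) (dH : 'rV[R]_(n + n) -> 'rV[R]_(n + n)).
Variables (Lam r mu w C rho : R) (j : 'I_n) (v0 : 'rV[R]_(n + n)).
Hypothesis Lam0 : 0 <= Lam.
Hypothesis Hquad : forall z v, `|Hb (z + v) - Hb z - dotv (dH z) v| <= Lam * dotv v v.
Hypothesis dHc : continuous dH.
Hypothesis r0 : 0 < r.
Hypothesis w0 : 0 < w.
Hypothesis rho0 : 0 < rho.
Hypothesis mur : pi * r ^+ 2 < mu.
Hypothesis H0 : forall z, 0 <= Hb z.
Hypothesis Hgrowth : forall z : 'rV[R]_(n + n), mu * ((z 0 (lshift n j) ^+ 2 + z 0 (rshift n j) ^+ 2) / r ^+ 2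
   + w * dotv z z) - C <= Hb z.
Hypothesis Hzero : forall z : 'rV[R]_(n + n), (forall l, `|z 0 l - v0 0 l| < rho) -> Hb z = 0.

Let sg : R := sgm R N'.
Let kap : R := sg^-1.
Let a (k : 'I_N) : R := harm R k.
Let S : R := \sum_k `|a (ordS k) - a k|.
(** Indices of the coordinates of the box: [(k, i)] for the values [yu] that determine the momenta,
    [i] for the starting position, [tt] for the amplitude of the first harmonic. *)
Let I : finType := ('I_N * 'I_n + 'I_n + unit)%type.
Let d := #|I|.
(** Chosen so that [alpha * S * (1 + kap) = rho / 2]: loops on which all [PsiI] vanish then stay
    within [rho] of [v0], where [Hb] is zero. *)
Let alpha : R := rho / (2 * (S * (1 + kap))).

Let cu (u : 'rV[R]_d) (x : I) : R := u 0 (enum_rank x).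
Let yu u k i : R := cu u (inl (inl (k, i))).
Let ybar u i : R := (\sum_k yu u k i) * h.
(** Partial sums, so that the differences of [bu] are [sg / 2 * (ybar - yu)]. The momentum is then
    [ybar] minus [kap] times the difference of [bu]: it opposes the velocity, which makes the area
    nonpositive. *)
Let bu u k i : R := cu u (inl (inr i)) +
  \sum_(l < N | (l < k)%N) (sg / 2 * (ybar u i - yu u l i)).
Let su u : R := cu u (inr tt).

(* [iota] spans the affine space of loops with nonpositive area, enlarged by the
   direction of the first harmonic in the [j]-th plane (coordinate [su]); [PsiI]
   vanishes on a small sphere of loops of positive area around the constant loop
   [v0], where [Hb] is zero. *)
Let iota (u : 'rV[R]_d) : 'M[R]_(N, n + n) := \matrix_k (v0 +
  row_mx (\row_i (bu u k i + (i == j)%:R * su u * a k))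
   (\row_i ((ybar u i + yu u k i) / 2 + (i == j)%:R * su u * kap * (a (ordS k) - a k)))).

(** Projects to the part of positive area: it kills what [iota] builds from [bu] and [yu], and
    returns the difference of [x] on loops whose centred momentum is [kap] times that difference. *)
Let wv (z : 'M[R]_(N, n + n)) k i : R := 2^-1 * ((xc z (ordS k) i - xc z k i) +
  sg * (pc z k i - h * \sum_k pc z k i)).

Let PsiI (x : I) (z : 'M[R]_(N, n + n)) : R := match x with
 | inl (inl ki) => (pc z ki.1 ki.2 - v0 0 (rshift n ki.2))
      - kap * (xc z (ordS ki.1) ki.2 - xc z ki.1 ki.2)
 | inl (inr i) => xc z ord0 i - v0 0 (lshift n i)
 | inr _ => (\sum_k \sum_i `|wv z k i|) / S - alpha
 end.

Let sg0 : 0 < sg. Proof. exact: sgm_gt0. Qed.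
Let kap0 : 0 < kap. Proof. by rewrite invr_gt0. Qed.
Let S0 : 0 < S. Proof. exact: harm_diff_gt0. Qed.
Let alpha0 : 0 < alpha.
Proof. by rewrite divr_gt0 // !mulr_gt0 // ltr_pwDl // ltW. Qed.
Let h0 : 0 < h. Proof. by rewrite invr_gt0 ltr0n. Qed.
Let hN : h * N%:R = 1. Proof. by rewrite mulVf // pnatr_eq0. Qed.
Let sgkap : sg * kap = 1. Proof. by rewrite divff // gt_eqF. Qed.
Let n0 : (0 < n)%N. Proof. by apply: leq_ltn_trans (ltn_ord j). Qed.

Let iota_x u k i : xc (iota u) k i =
  v0 0 (lshift n i) + (bu u k i + (i == j)%:R * su u * a k).
Proof. by rewrite /xc !mxE (unsplitK (inl i)) !mxE. Qed.

Let iota_p u k i : pc (iota u) k i =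
  v0 0 (rshift n i) + ((ybar u i + yu u k i) / 2 + (i == j)%:R * su u * kap * (a (ordS k) - a k)).
Proof. by rewrite /pc !mxE (unsplitK (inr i)) !mxE. Qed.

Let sum_cst (c : R) : \sum_(k < N) c = c * N%:R.
Proof. by rewrite sumr_const card_ord mulr_natr. Qed.

Let sum_ybar u i : \sum_k (ybar u i - yu u k i) = 0.
Proof. by rewrite sumrB sum_cst /ybar -mulrA hN mulr1 subrr. Qed.

Let bu_diff u k i : bu u (ordS k) i - bu u k i = sg / 2 * (ybar u i - yu u k i).
Proof.
rewrite /bu opprD addrACA subrr add0r (cumsum_ordS k) // -mulr_sumr sum_ybar mulr0 //.
Qed.

Let iota_dx u k i : xc (iota u) (ordS k) i - xc (iota u) k i =
  sg / 2 * (ybar u i - yu u k i) + (i == j)%:R * su u * (a (ordS k) - a k).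
Proof. by rewrite !iota_x -bu_diff; ring. Qed.

Let iota_pbar u i : h * \sum_k pc (iota u) k i = v0 0 (rshift n i) + ybar u i.
Proof.
under eq_bigr do rewrite iota_p.
rewrite big_split sum_cst big_split /= -mulr_sumr sum_diff mulr0 addr0.
rewrite -mulr_suml big_split /= sum_cst.
have -> : \sum_k yu u k i = ybar u i * N%:R by rewrite /ybar -mulrA hN mulr1.
rewrite mulrDr mulrCA hN mulr1; congr (_ + _).
have -> : h * ((ybar u i * N%:R + ybar u i * N%:R) / 2) = ybar u i * (h * N%:R) by field.
by rewrite hN mulr1.
Qed.

Let iota_wv u k i : wv (iota u) k i = (i == j)%:R * su u * (a (ordS k) - a k).
Proof.
rewrite /wv iota_dx iota_pbar iota_p.
have -> : 2^-1 * (sg / 2 * (ybar u i - yu u k i) + (i == j)%:R * su u * (a (ordS k) - a k) +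
   sg * (v0 0 (rshift n i) + ((ybar u i + yu u k i) / 2 + (i == j)%:R * su u * kap * (a (ordS k) - a k)) -
    (v0 0 (rshift n i) + ybar u i))) =
  2^-1 * ((i == j)%:R * su u * (a (ordS k) - a k)) * (1 + sg * kap) by field.
by rewrite sgkap; field.
Qed.

Let PsiI_iota u x : 0 <= su u -> PsiI x (iota u) = cu u x - (if x is inr _ then alpha else 0).
Proof.
move=> s0; case: x => [[[k i]|i]|[]] /=.
- rewrite iota_dx iota_p -/(yu u k i) subr0.
  have -> : v0 0 (rshift n i) + ((ybar u i + yu u k i) / 2 + (i == j)%:R * su u * kap * (a (ordS k) - a k))
     - v0 0 (rshift n i) - kap * (sg / 2 * (ybar u i - yu u k i) + (i == j)%:R * su u * (a (ordS k) - a k)) =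
     (ybar u i + yu u k i) / 2 - (sg * kap) / 2 * (ybar u i - yu u k i) by field.
  by rewrite sgkap; field.
- rewrite iota_x /bu big1 // /a harm0; ring.
- congr (_ - _); rewrite -/(su u).
  under eq_bigr do (rewrite (bigD1 j) //= iota_wv eqxx mul1r big1 ?addr0;
     last by move=> i /negbTE ij; rewrite iota_wv ij !mul0r normr0).
  under eq_bigr do rewrite normrM (ger0_norm s0).
  by rewrite -mulr_sumr mulfK // gt_eqF.
Qed.


Let Phi := loop_action (N' := N') Hb.
Let Phi_grad := loop_grad (N' := N') dH.

Let cu_continuous x : continuous (fun u => cu u x).
Proof. exact: coord_continuous. Qed.

Let iota_continuous : continuous iota.
Proof.
have cst (c : R) : continuous (fun _ : 'rV[R]_d => c) by exact: fct_cst_continuous.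
have yc k i : continuous (fun u => yu u k i) by exact: cu_continuous.
have ybc i : continuous (fun u => ybar u i).
  by apply: fctM_continuous => //; apply: fct_sum_continuous.
apply: mx_continuous => k l.
have [i|i] := split_ordP l => ->.
- under eq_fun do rewrite -[iota _ _ _]/(xc (iota _) _ _) iota_x.
  apply: fctD_continuous => //; apply: fctD_continuous.
    apply: fctD_continuous => //; apply: fct_sum_continuous => k'.
    by apply: fctM_continuous => //; apply: fctB_continuous.
  apply: fctM_continuous => //; apply: fctM_continuous => //; exact: cu_continuous.
- under eq_fun do rewrite -[iota _ _ _]/(pc (iota _) _ _) iota_p.
  apply: fctD_continuous => //; apply: fctD_continuous.
    by apply: fctM_continuous => //; apply: fctD_continuous.
  apply: fctM_continuous => //; apply: fctM_continuous => //.
  by apply: fctM_continuous => //; exact: cu_continuous.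
Qed.

Let PsiI_continuous x : continuous (PsiI x).
Proof.
have cst (c : R) : continuous (fun _ : 'M[R]_(N, n + n) => c) by exact: fct_cst_continuous.
have xcc k i : continuous (fun z : 'M[R]_(N, n + n) => xc z k i) by exact: coord_continuous.
have pcc k i : continuous (fun z : 'M[R]_(N, n + n) => pc z k i) by exact: coord_continuous.
case: x => [[[k i]|i]|x] /=.
- apply: fctB_continuous; first by apply: fctB_continuous.
  by apply: fctM_continuous => //; apply: fctB_continuous.
- by apply: fctB_continuous.
- apply: fctB_continuous => //; apply: fctM_continuous => //.
  apply: fct_sum_continuous => k; apply: fct_sum_continuous => i.
  apply: fct_norm_continuous; apply: fctM_continuous => //.
  apply: fctD_continuous; first by apply: fctB_continuous.
  apply: fctM_continuous => //; apply: fctB_continuous => //.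
  by apply: fctM_continuous => //; apply: fct_sum_continuous.
Qed.

(** The least value of [kap] times the sum of squares of [N * n] numbers whose absolute values add
    up to [alpha * S]. It depends on [N]. *)
Let beta : R := kap * (alpha * S) ^+ 2 / (N * n)%:R.

Let Nn0 : 0 < (N * n)%:R :> R. Proof. by rewrite ltr0n muln_gt0 n0. Qed.

Let beta0 : 0 < beta.
Proof. by rewrite divr_gt0 // mulr_gt0 // exprn_gt0 // mulr_gt0. Qed.

(** On these loops [p] differs from that of [v0] by [kap] times the difference of [x], so the area
    is [kap] times a sum of squares; their small extent makes the [Hb] term vanish. *)
Let Phi_Gamma z : (forall x, PsiI x z = 0) -> beta <= Phi z.
Proof.
move=> hz.
pose D k i := xc z (ordS k) i - xc z k i.
have hp k i : pc z k i = v0 0 (rshift n i) + kap * D k i.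
  by have /= := hz (inl (inl (k, i))); rewrite /D; lra.
have hx i : xc z ord0 i = v0 0 (lshift n i) by have /= := hz (inl (inr i)); lra.
have sD i : \sum_k D k i = 0 by exact: (sum_diff (fun k => xc z k i)).
have hw k i : wv z k i = D k i.
  rewrite /wv -/(D k i) hp.
  under eq_bigr do rewrite hp.
  rewrite big_split /= sum_cst -mulr_sumr sD mulr0 addr0 mulrCA hN mulr1.
  have -> : 2^-1 * (D k i + sg * (v0 0 (rshift n i) + kap * D k i - v0 0 (rshift n i))) =
     2^-1 * D k i * (1 + sg * kap) by ring.
  by rewrite sgkap; field.
have sumD : \sum_k \sum_i `|D k i| = alpha * S.
  have /= := hz (inr tt); under eq_bigr do under eq_bigr do rewrite hw.
  by move=> /eqP; rewrite subr_eq0 => /eqP <-; rewrite divfK // gt_eqF.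
have Dle k i : `|D k i| <= alpha * S.
  rewrite -sumD (bigD1 k) //= (bigD1 i) //= -addrA lerDl.
  by rewrite addr_ge0 ?sumr_ge0 // => k' _; apply: sumr_ge0.
have aS : alpha * S * (1 + kap) = rho / 2.
  rewrite /alpha; have := S0; have := kap0; move: kap S => kk ss k0 s0.
  by field; rewrite !gt_eqF //=; lra.
have aSlt : alpha * S < rho.
  apply: (@lt_le_trans _ _ (2 * (alpha * S * (1 + kap)))); last by rewrite aS; lra.
  have := mulr_gt0 alpha0 S0; have := kap0; move: (alpha * S) kap => t kk; nra.
have kaSlt : kap * (alpha * S) < rho.
  apply: (@lt_le_trans _ _ (2 * (alpha * S * (1 + kap)))); last by rewrite aS; lra.
  have := mulr_gt0 alpha0 S0; have := kap0; move: (alpha * S) kap => t kk; nra.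
have Hz k : Hb (row k z) = 0.
  apply: Hzero => l; rewrite mxE.
  have [i|i] := split_ordP l => ->.
  - rewrite -hx; apply: le_lt_trans aSlt; rewrite -sumD.
    apply: le_trans (dist_le_sum_diff (fun k => xc z k i) k) _.
    apply: ler_sum => k' _; rewrite (bigD1 i) //= lerDl; exact: sumr_ge0.
  - rewrite -/(pc z k i) hp addrAC subrr add0r normrM (gtr0_norm kap0).
    by apply: le_lt_trans kaSlt; rewrite ler_pM2l.
rewrite /Phi /loop_action; under [X in _ - h * X]eq_bigr do rewrite Hz.
rewrite big1 // mulr0 subr0.
have -> : loop_area z = kap * \sum_k \sum_i D k i ^+ 2.
  rewrite /loop_area exchange_big [in RHS]exchange_big mulr_sumr; apply: eq_bigr => i _ /=.
  transitivity (\sum_k (v0 0 (rshift n i) * D k i + kap * D k i ^+ 2)).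
    by apply: eq_bigr => k _; rewrite hp -/(D k i); ring.
  by rewrite big_split /= -mulr_sumr sD mulr0 add0r -mulr_sumr.
rewrite /beta -mulrA ler_pM2l //.
(* Cauchy-Schwarz in the form [D^2 >= 2 c |D| - c^2], at the mean value [c]. *)
pose c := alpha * S / (N * n)%:R.
apply: (@le_trans _ _ (\sum_k \sum_i (2 * c * `|D k i| - c ^+ 2))); last first.
  apply: ler_sum => k _; apply: ler_sum => i _.
  rewrite -[D k i ^+ 2]real_normK ?num_real // -subr_ge0.
  rewrite (_ : _ - _ = (`|D k i| - c) ^+ 2) ?sqr_ge0 //; ring.
under eq_bigr do rewrite sumrB sumr_const card_ord -mulr_sumr.
rewrite sumrB sumr_const card_ord -mulr_sumr sumD -mulrnA (mulnC n) -(mulr_natr (c ^+ 2)).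
rewrite -[_.+3]/N le_eqVlt; apply/orP; left; apply/eqP; rewrite /c.
have := Nn0; move: (_%:R) => t t0; field.
by rewrite gt_eqF.
Qed.

(** As [PsiI] recovers the coordinates of [iota], a bound on a loop becomes a bound on its
    coordinates; this sizes the box. *)
Let PsiI_bound (z : 'M[R]_(N, n + n)) (m : R) : 0 <= m -> (forall k l, `|z k l| <= m) -> forall x,
  `|PsiI x z| <= m + `|v0| + 2 * kap * m + (N * n)%:R * (m + sg * m) / S + alpha.
Proof.
move=> m0 hm x.
have hv l : `|v0 0 l| <= `|v0|.
  by rewrite [leRHS]mx_normrE; exact: (le_bigmax _ (fun ij => `|v0 ij.1 ij.2|) (0, l)).
have t1 : 0 <= 2 * kap * m by rewrite !mulr_ge0 // ltW.
have t2 : 0 <= (N * n)%:R * (m + sg * m) / S.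
  apply: divr_ge0; last exact: ltW.
  apply: mulr_ge0; first exact: ler0n.
  by apply: addr_ge0 => //; apply: mulr_ge0 => //; exact: ltW.
have t3 := ltW alpha0; have t4 := normr_ge0 v0.
case: x => [[[k i]|i]|x] /=.
- apply: le_trans (ler_normB _ _) _; apply: (@le_trans _ _ (m + `|v0| + 2 * kap * m)); last by lra.
  apply: lerD; first by apply: le_trans (ler_normB _ _) _; apply: lerD; [exact: hm|exact: hv].
  rewrite normrM (gtr0_norm kap0) -mulrA mulrCA ler_pM2l //.
  by apply: le_trans (ler_normB _ _) _; have := hm (ordS k) (lshift n i); have := hm k (lshift n i); rewrite /xc; lra.
- apply: le_trans (ler_normB _ _) _; apply: (@le_trans _ _ (m + `|v0|)); last by lra.
  by apply: lerD; [exact: hm|exact: hv].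
- apply: le_trans (ler_normB _ _) _; rewrite (gtr0_norm alpha0) lerD2r.
  apply: (@le_trans _ _ ((N * n)%:R * (m + sg * m) / S)); last by lra.
  rewrite normrM (gtr0_norm (_ : 0 < S^-1)) ?invr_gt0 // ler_pM2r ?invr_gt0 //.
  rewrite ger0_norm; last by apply: sumr_ge0 => k _; apply: sumr_ge0.
  apply: (@le_trans _ _ (\sum_(k < N) \sum_(i < n) (m + sg * m))); last first.
    by rewrite !sumr_const !card_ord -mulrnA mulr_natl mulnC.
  apply: ler_sum => k _; apply: ler_sum => i _.
  rewrite /wv normrM gtr0_norm ?invr_gt0 // mulrC ler_pdivrMr //.
  apply: le_trans (ler_normD _ _) _; rewrite mulrDl lerD //.
    by apply: le_trans (ler_normB _ _) _; have := hm (ordS k) (lshift n i); have := hm k (lshift n i); rewrite /xc; lra.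
  rewrite normrM (gtr0_norm sg0) -[sg * m * 2]mulrA ler_pM2l //.
  apply: le_trans (ler_normB _ _) _; rewrite mulr_natr mulr2n lerD //; first exact: hm.
  rewrite normrM (gtr0_norm h0) mulrC ler_pdivrMr ?ltr0n //.
  apply: le_trans (ler_norm_sum _ _ _) _.
  by rewrite -sum_cst; apply: ler_sum => k' _; exact: hm.
Qed.

Let iota_pE u k i : pc (iota u) k i = v0 0 (rshift n i) + ybar u i +
  kap * ((i == j)%:R * su u * (a (ordS k) - a k) - (bu u (ordS k) i - bu u k i)).
Proof.
rewrite iota_p bu_diff.
have -> : v0 0 (rshift n i) + ybar u i + kap * ((i == j)%:R * su u * (a (ordS k) - a k) -
   sg / 2 * (ybar u i - yu u k i)) = v0 0 (rshift n i) + ybar u i + kap * (i == j)%:R * su u * (a (ordS k) - a k)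
   - (sg * kap) / 2 * (ybar u i - yu u k i) by field.
by rewrite sgkap; field.
Qed.

Let area_neq u i : (i != j) || (su u == 0) ->
  \sum_k pc (iota u) k i * (xc (iota u) (ordS k) i - xc (iota u) k i) <= 0.
Proof.
move=> hi; have e : (i == j)%:R * su u = 0.
  by case/orP: hi => [/negbTE ->|/eqP ->]; rewrite ?mul0r ?mulr0.
have := discrete_area_le0 (fun k : 'I_N => bu u k i) (v0 0 (rshift n i) + ybar u i) (ltW kap0).
move=> hle; apply: le_trans hle; apply: ler_sum => k _.
rewrite iota_pE !iota_x e !mul0r sub0r mulrN.
by rewrite le_eqVlt; apply/orP; left; apply/eqP; ring.
Qed.

Let area_eq u : \sum_k pc (iota u) k j * (xc (iota u) (ordS k) j - xc (iota u) k j) <=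
  sg / 2 * \sum_k (xc (iota u) k j ^+ 2 + pc (iota u) k j ^+ 2).
Proof.
have := discrete_action_le (fun k : 'I_N => v0 0 (lshift n j) + bu u k j) (su u) (v0 0 (rshift n j) + ybar u j)
  sg0 (@harm_rec R N').
have ex k : su u * harm R k + (v0 0 (lshift n j) + bu u k j) = xc (iota u) k j.
  by rewrite iota_x eqxx mul1r /a; ring.
have ep k : v0 0 (rshift n j) + ybar u j + sg^-1 * (su u * (harm R (ordS k) - harm R k) -
   (v0 0 (lshift n j) + bu u (ordS k) j - (v0 0 (lshift n j) + bu u k j))) = pc (iota u) k j.
  by rewrite iota_pE eqxx mul1r /a -/kap; ring.
rewrite /=; under eq_bigr do rewrite ex ex ep.
by under [X in _ <= _ * X -> _]eq_bigr do rewrite ex ep.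
Qed.

Let loop_area_iota_s0 u : su u = 0 -> loop_area (iota u) <= 0.
Proof.
move=> s0; rewrite /loop_area exchange_big; apply: sumr_le0 => i _.
by apply: area_neq; rewrite s0 eqxx orbT.
Qed.

Let loop_area_iota u : loop_area (iota u) <=
  pi * h * \sum_k (xc (iota u) k j ^+ 2 + pc (iota u) k j ^+ 2).
Proof.
rewrite /loop_area exchange_big (bigD1 j) //= -[leRHS]addr0 lerD //; last first.
  by apply: sumr_le0 => i ij; apply: area_neq; rewrite ij.
apply: le_trans (area_eq u) _; apply: ler_wpM2r; last exact: sgm_le.
by apply: sumr_ge0 => k _; rewrite addr_ge0 ?sqr_ge0.
Qed.

(** The isoperimetric bound [pi * h * T] is absorbed by the growth of [Hb] in the [j]-th plane,
    where [mu / r ^ 2 > pi]; the [w] term is left over and gives coercivity in all coordinates. *)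
Let Phi_iota u : Phi (iota u) <= C - (mu - pi * r ^+ 2) * h * w * sqsum (iota u).
Proof.
rewrite /Phi /loop_action; set z := iota u.
pose T := \sum_k (xc z k j ^+ 2 + pc z k j ^+ 2).
have T0 : 0 <= T by apply: sumr_ge0 => k _; rewrite addr_ge0 ?sqr_ge0.
have hA : loop_area z <= pi * h * T by exact: loop_area_iota.
have hS : \sum_k Hb (row k z) >= mu * (T / r ^+ 2 + w * sqsum z) - C * N%:R.
  rewrite /T mulr_suml /sqsum mulr_sumr -big_split /= mulr_sumr -sum_cst -sumrB.
  apply: ler_sum => k _; apply: le_trans (Hgrowth (row k z)).
  by rewrite [row k z 0 (lshift n j)]mxE [row k z 0 (rshift n j)]mxE.
have hS' : mu * (T / r ^+ 2 + w * sqsum z) * h - C <= h * \sum_k Hb (row k z).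
  have -> : mu * (T / r ^+ 2 + w * sqsum z) * h - C =
     h * (mu * (T / r ^+ 2 + w * sqsum z) - C * N%:R).
    by rewrite mulrBr [h * (C * _)]mulrCA hN; ring.
  by rewrite ler_pM2l.
have rr : 0 < r ^+ 2 by rewrite exprn_gt0.
have hT : pi * h * T <= mu * (T / r ^+ 2) * h.
  have -> : pi * h * T = pi * r ^+ 2 * (T / r ^+ 2) * h by field; rewrite gt_eqF.
  apply: ler_wpM2r; first exact: ltW.
  by apply: ler_wpM2r; [rewrite divr_ge0 // ltW | exact: ltW].
have hs := sqsum_ge0 z.
have hp : 0 <= pi * r ^+ 2 * (h * w * sqsum z).
  apply: mulr_ge0; first by rewrite mulr_ge0 ?pi_ge0 // ltW.
  by apply: mulr_ge0 => //; apply: mulr_ge0; exact: ltW.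
have -> : (mu - pi * r ^+ 2) * h * w * sqsum z = mu * (T / r ^+ 2 + w * sqsum z) * h -
   mu * (T / r ^+ 2) * h - pi * r ^+ 2 * (h * w * sqsum z) by ring.
exact: le_sub_chain hA hS' hT hp.
Qed.

Lemma loop_action_almost_critical : exists2 beta : R, 0 < beta & forall delta, 0 < delta ->
  exists z : 'M[R]_(N, n + n), beta <= loop_action Hb z /\ sqsum (loop_grad dH z) <= delta.
Proof.
exists beta => // delta delta0.
have muh : 0 < (mu - pi * r ^+ 2) * h * w.
  by apply: mulr_gt0 => //; apply: mulr_gt0 => //; rewrite subr_gt0.
pose m := `|C| / ((mu - pi * r ^+ 2) * h * w) + 1.
have m1 : 1 <= m by rewrite lerDr divr_ge0 // ltW.
pose B := m + `|v0| + 2 * kap * m + (N * n)%:R * (m + sg * m) / S + alpha.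
have B0 : 0 <= B.
  have /(_ (lt_le_trans ltr01 m1)) := @ltW _ _ 0 m => m0.
  by apply: le_trans (normr_ge0 _) (@PsiI_bound 0 m m0 _ (inr tt)) => k l; rewrite mxE normr0.
pose tau := B + alpha + 1.
have tau_alpha : alpha < tau by rewrite /tau; lra.
(* Where [Phi >= beta], [Phi_iota] bounds the loop and [PsiI_bound] its coordinates; [tau] is chosen
   beyond that bound. *)
have small u x : 0 <= su u -> beta <= Phi (iota u) -> `|cu u x| < tau.
  move=> s0 hb.
  have hz k l : `|iota u k l| <= m.
    have hs : sqsum (iota u) <= `|C| / ((mu - pi * r ^+ 2) * h * w).
      rewrite ler_pdivlMr // mulrC; have := Phi_iota u; have := ler_norm C; have := beta0.
      by move: hb; lra.
    have ht : `|iota u k l| ^+ 2 <= sqsum (iota u).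
      rewrite real_normK ?num_real // /sqsum (bigD1 k) //= /dotv (bigD1 l) //= !mxE -expr2 -addrA lerDl.
      by rewrite addr_ge0 // ?sumr_ge0 // => i _; [rewrite -expr2 sqr_ge0|exact: dotv_ge0].
    have := le_trans ht hs; rewrite /m; move: (_ / _) => q; move: `|_| => t; nra.
  have /= hP := PsiI_bound (le_trans ler01 m1) hz x.
  have eP := PsiI_iota x s0.
  have : `|cu u x| <= `|PsiI x (iota u)| + alpha.
    rewrite eP; have -> : cu u x = (cu u x - (if x is inr _ then alpha else 0)) + (if x is inr _ then alpha else 0) by rewrite subrK.
    apply: le_trans (ler_normD _ _) _; rewrite subrK lerD2l.
    by case: x {hP eP} => _; rewrite ?normr0 ?gtr0_norm // ltW.
  by move=> hc; apply: le_lt_trans hc _; rewrite /tau; move: hP; rewrite -/B; lra.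
pose lo (i : 'I_d) : R := if enum_val i is inr _ then 0 else - tau.
pose ce (i : 'I_d) : R := if enum_val i is inr _ then alpha else 0.
have tau0 : 0 < tau by exact: lt_trans tau_alpha.
have su_ge0 (u : 'rV[R]_d) : (forall k, lo k <= u 0 k <= tau) -> 0 <= su u.
  by move=> /(_ (enum_rank (inr tt))); rewrite /lo enum_rankK => /andP[].
have := @linking R _ Phi Phi_grad (@sqsum R n N') (2 * (2 + Lam))^-1 beta C d lo (fun _ => tau) ce iota
  (fun i => PsiI (enum_val i)).
apply.
- exact: loop_grad_continuous.
- by rewrite invr_gt0 mulr_gt0 // ltr_pwDl.
- by move=> z s; exact: loop_action_descent.
- exact: sqsum_ge0.
- exact: iota_continuous.
- by move=> i; exact: PsiI_continuous.
- by move=> i; rewrite /lo /ce; case: (enum_val i) => // _; rewrite oppr_lt0.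
- by move=> i; rewrite /ce; case: (enum_val i).
- move=> u /su_ge0 s0 i; rewrite PsiI_iota // /cu enum_valK; congr (_ - _).
- by move=> z hz; apply: Phi_Gamma => x; have := hz (enum_rank x); rewrite enum_rankK.
(* The faces at [tau] and [- tau] are excluded by [small]; on the remaining face, [su = 0], the area
   is nonpositive. *)
- move=> u hu [i hi]; have s0 := su_ge0 u hu.
  rewrite ltNge; apply/negP => hb.
  have := small u (enum_val i) s0 hb; rewrite /cu enum_valK.
  case: hi => hi; last by rewrite hi gtr0_norm // ltxx.
  rewrite hi /lo; case ei : (enum_val i) => [x|[]]; first by rewrite normrN gtr0_norm // ltxx.
  move=> _; have su0 : su u = 0 by rewrite /su /cu -ei enum_valK hi /lo ei.
  have hS : 0 <= h * \sum_k Hb (row k (iota u)).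
    by apply: mulr_ge0; [exact: ltW|apply: sumr_ge0].
  have := lt_le_trans beta0 hb; rewrite /Phi /loop_action subr_gt0 ltNge => /negP; apply.
  exact: le_trans (loop_area_iota_s0 su0) hS.
- move=> u _; apply: le_trans (Phi_iota u) _; rewrite gerBl.
  by apply: mulr_ge0; [exact: ltW|exact: sqsum_ge0].
- exact: delta0.
Qed.

End MorseSequence.

Section MatrixNorm.
Variables (R : realType) (m : nat).
Implicit Types v : 'rV[R]_m.

Lemma rV_coord_le v k : `|v 0 k| <= `|v|.
Proof.
by rewrite [leRHS]mx_normrE; exact: (le_bigmax _ (fun ij => `|v ij.1 ij.2|) (0, k)).
Qed.

Lemma rV_norm_le v (B : R) : 0 <= B -> (forall k, `|v 0 k| <= B) -> `|v| <= B.
Proof.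
move=> B0 h; rewrite [leLHS]mx_normrE; apply/bigmax_leP; split=> // -[i k] _ /=.
by rewrite ord1.
Qed.

Lemma rV_ball_compact (B : R) : 0 <= B -> compact [set v : 'rV[R]_m | `|v| <= B].
Proof.
move=> B0; have := @box_compact R m (fun _ => - B) (fun _ => B).
congr compact; apply/seteqP; split=> v /= h.
  by apply: rV_norm_le => // k; rewrite ler_norml.
by move=> k; rewrite -ler_norml; exact: le_trans (rV_coord_le _ _) h.
Qed.

(** Orbits are carried as estimates with a quadratic remainder, which pass to limits; this recovers
    the derivative. *)
Lemma is_derive_quadratic_near (W : normedModType R) (f : R -> W) (s K : R) (v : W) :
  (forall t, `|t - s| <= 1 -> `|f t - f s - (t - s) *: v| <= K * (t - s) ^+ 2) ->
  is_derive s (1 : R) f v.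
Proof.
move=> hf.
have K0 : 0 <= K.
  have := hf (s + 1); rewrite addrAC subrr add0r normr1 expr1n mulr1 => /(_ (lexx _)).
  exact: le_trans.
have cv : h^-1 *: ((f \o shift s) (h *: (1 : R)) - f s) @[h --> 0^'] --> v.
  apply/cvgrPdist_le => e e0; near=> h.
  have h0 : h != 0 by near: h; exact: nbhs_dnbhs_neq.
  have h1 : `|h| <= 1 by apply: ltW; near: h; exact: dnbhs0_lt.
  have := hf (h + s); rewrite addrK => /(_ h1) hh.
  rewrite /= [h *: 1]mulr1 -normrN opprB.
  have -> : h^-1 *: (f (h + s) - f s) - v = h^-1 *: (f (h + s) - f s - h *: v).
    by rewrite [in RHS]scalerBr scalerA mulVf // scale1r.
  rewrite normrZ normfV mulrC ler_pdivrMr ?normr_gt0 //; apply: le_trans hh _.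
  rewrite -[h ^+ 2]real_normK ?num_real // expr2 mulrA ler_wpM2r //.
  have : `|h| < e / (K + 1).
    near: h; apply: dnbhs0_lt; rewrite divr_gt0 // ltr_wpDl //.
  rewrite ltr_pdivlMr ?ltr_wpDl // => /ltW; apply: le_trans.
  by rewrite mulrC ler_wpM2l // lerDl.
by apply: DeriveDef; [apply/cvg_ex; exists v | exact: cvg_lim cv].
Unshelve. all: by end_near. Qed.

Lemma is_derive_quadratic (W : normedModType R) (f : R -> W) (s K : R) (v : W) :
  (forall t, `|f t - f s - (t - s) *: v| <= K * (t - s) ^+ 2) -> is_derive s (1 : R) f v.
Proof. by move=> h; apply: (@is_derive_quadratic_near _ _ _ K) => t _; exact: h. Qed.

End MatrixNorm.

Lemma lip_continuous (R : realType) (V W : normedModType R) (f : V -> W) (L : R) :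
  0 <= L -> (forall v w, `|f v - f w| <= L * `|v - w|) -> continuous f.
Proof.
move=> L0 fL v; apply/cvgrPdist_le => e e0; near=> w.
apply: le_trans (fL _ _) _.
have : `|v - w| <= e / (L + 1).
  near: w; apply: cvgr_dist_le; first exact: cvg_id.
  by rewrite divr_gt0 // ltr_wpDl.
rewrite ler_pdivlMr ?ltr_wpDl //; apply: le_trans.
by rewrite mulrC ler_wpM2l // lerDl.
Unshelve. all: by end_near. Qed.

Lemma ultra_compact_cvg (T : Type) (S : topologicalType) (U : set_system T) (f : T -> S) (A : set S) :
  UltraFilter U -> compact A -> U (f @^-1` A) -> exists x, A x /\ f @ U --> x.
Proof.
move=> UU cA UA; have UP : ProperFilter U := ultra_proper.
have [x [Ax cx]] := cA (f @ U) _ UA; exists x; split=> // B Bx.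
have [//|nB] := in_ultra_setVsetC (f @^-1` B) UU.
by have [y []] := cx (~` B) B nB Bx.
Qed.

(** * Ultrafilter limits of approximate Euler orbits *)

Section EulerLimit.
Variables (R : realType) (m : nat).
Local Notation V := 'rV[R]_m.
Variables (U : set_system nat) (UU : UltraFilter U).
Hypothesis Uoo : forall A, (\oo : set_system nat) A -> U A.
Variables (zz : forall i : nat, 'I_i.+3 -> V) (Y : V -> V) (B C Lam E : R) (eps : nat -> R).
Let N (i : nat) : R := i.+3%:R.
Let h i : R := (N i)^-1.
Hypothesis zzB : forall (i : nat) (k : 'I_i.+3), `|zz k| <= B.
Hypothesis YC : forall v, `|v| <= B -> `|Y v| <= C.
Hypothesis Lam0 : 0 <= Lam.
Hypothesis YL : forall v w, `|Y v - Y w| <= Lam * `|v - w|.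
Hypothesis epsE : forall i, 0 <= eps i <= E.
Hypothesis U_eps : eps @ U --> 0.
Hypothesis step : forall (i : nat) (k : 'I_i.+3), `|zz (ordS k) - zz k - h i *: Y (zz k)| <= h i * eps i.

Let UP : ProperFilter U := ultra_proper.
Let B0 : 0 <= B. Proof. exact: le_trans (normr_ge0 _) (zzB (ord0 : 'I_3)). Qed.
Let E0 : 0 <= E. Proof. by have /andP[h1 h2] := epsE 0; exact: le_trans h1 h2. Qed.
Let N0 i : 0 < N i. Proof. by rewrite ltr0n. Qed.
Let h0 i : 0 < h i. Proof. by rewrite invr_gt0. Qed.
Let hN i : h i * N i = 1. Proof. by rewrite mulVf // gt_eqF. Qed.
Let C0 : 0 <= C. Proof. exact: le_trans (normr_ge0 _) (YC (zzB (ord0 : 'I_3))). Qed.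
Let D := C + E.
Let D0 : 0 <= D. Proof. exact: addr_ge0. Qed.

Let idx i (k : int) : 'I_i.+3 := inord `|(k %% i.+3%:Z)%Z|%N.

Let idxS i k : idx i (k + 1) = ordS (idx i k).
Proof.
have [q kq] : exists q : nat, (k %% i.+3%:Z)%Z = q%:Z.
  by exists `|(k %% i.+3%:Z)%Z|%N; rewrite gez0_abs // modz_ge0.
have qN : (q < i.+3)%N.
  by rewrite -ltz_nat -kq ltz_pmod.
apply: val_inj; rewrite /idx /= -modzDml kq -[(q%:Z + 1)%R]/((q + 1)%N%:Z).
by rewrite modz_nat /= addn1 (inordK qN) inordK ?ltn_pmod.
Qed.

Let ex i k := zz (idx i k).
(** A step function, so that every value is a point of the loop and inherits its bounds; the jumps
    are of order [h i] and disappear in the limit. *)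
Let g i (t : R) := ex i (Num.floor (t * N i)).

Let ex_lip i k (q : nat) : `|ex i (k + q%:Z) - ex i k| <= q%:R * h i * D.
Proof.
elim: q => [|q IH]; first by rewrite addr0 subrr normr0 !mul0r.
have -> : ex i (k + q.+1%:Z) - ex i k = (ex i (k + q%:Z + 1) - ex i (k + q%:Z)) + (ex i (k + q%:Z) - ex i k).
  by rewrite [RHS]addrA subrK -(addn1 q) PoszD addrA.
rewrite -natr1 !mulrDl mul1r [leRHS]addrC.
apply: le_trans (ler_normD _ _) (lerD _ IH).
rewrite /ex idxS; set z := idx i (k + q).
have hs := step z; have hY := YC (zzB z); have /andP[_ he] := epsE i.
rewrite -[zz (ordS z) - zz z](subrK (h i *: Y (zz z))).
apply: le_trans (ler_normD _ _) _; rewrite [leLHS]addrC /D mulrDr; apply: lerD.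
  by rewrite normrZ gtr0_norm // ler_pM2l.
by apply: le_trans hs _; rewrite ler_pM2l.
Qed.

Let ex_euler i k (q : nat) : `|ex i (k + q%:Z) - ex i k - (q%:R * h i) *: Y (ex i k)| <=
  q%:R * h i * (eps i + Lam * D * (q%:R * h i)).
Proof.
elim: q => [|q IH]; first by rewrite addr0 subrr !mul0r scale0r subr0 normr0.
rewrite -(addn1 q) PoszD addrA natrD mulrDl mul1r scalerDl.
set a := ex i (k + q + 1); set b := ex i (k + q); set c := ex i k.
have -> : a - c - ((q%:R * h i) *: Y c + h i *: Y c) =
   (a - b - h i *: Y b) + h i *: (Y b - Y c) + (b - c - (q%:R * h i) *: Y c).
  rewrite scalerBr; move: (_ *: Y c) (_ *: Y b) (_ *: Y c) => x y z.
  by apply/rowP => l; rewrite !mxE; ring.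
apply: le_trans (ler_normD _ _) _.
have h1 : `|a - b - h i *: Y b| <= h i * eps i by rewrite /a /b /ex idxS; exact: step.
have h2 : `|h i *: (Y b - Y c)| <= h i * (Lam * D * (q%:R * h i)).
  rewrite normrZ gtr0_norm // ler_pM2l //; apply: le_trans (YL _ _) _.
  by rewrite -mulrA ler_wpM2l // mulrC; exact: ex_lip.
have h3 : 0 <= Lam * D * h i * ((q%:R + 1) * h i).
  by rewrite !mulr_ge0 // ?addr_ge0 // ltW.
have := le_trans (ler_normD _ _) (lerD h1 h2).
move: IH h3; rewrite /=; move: `|_ - _ - _| `|_ + _| => x y.
move: (h i) (eps i) (Lam * D) (q%:R : R) => hh e L Q; nra.
Qed.

Let floor_split i s t : s <= t -> exists q : nat,
  Num.floor (t * N i) = Num.floor (s * N i) + q%:Z /\ `|q%:R * h i - (t - s)| <= h i.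
Proof.
move=> st; have hle : (Num.floor (s * N i) <= Num.floor (t * N i)).
  by apply: le_floor; rewrite ler_pM2r.
have [q hq] : exists q : nat, Num.floor (t * N i) - Num.floor (s * N i) = q%:Z.
  by exists `|Num.floor (t * N i) - Num.floor (s * N i)|%N; rewrite gez0_abs ?subr_ge0.
exists q; split; first by rewrite -hq addrC subrK.
have qE : q%:R = (Num.floor (t * N i))%:~R - (Num.floor (s * N i))%:~R :> R.
  by rewrite -intrB hq pmulrn.
have -> : q%:R * h i - (t - s) = h i * (q%:R - (t - s) * N i).
  by rewrite mulrBr [h i * (_ * N i)]mulrCA hN; ring.
rewrite normrM gtr0_norm // ger_pMr // qE ler_norml.
have := floor_itv (t * N i); have := floor_itv (s * N i).
rewrite !intrD.
move: (Num.floor _)%:~R (Num.floor _)%:~R => a b /andP[? ?] /andP[? ?].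
by apply/andP; split; lra.
Qed.

Let g_lip i s t : `|g i t - g i s| <= (`|t - s| + h i) * D.
Proof.
wlog st : s t / s <= t.
  move=> H; have [st|/ltW st] := leP s t; first exact: H.
  by rewrite distrC (distrC t); exact: H.
have [q [fq hq]] := floor_split i st.
rewrite /g fq; apply: le_trans (ex_lip _ _ _) _; apply: ler_wpM2r => //.
rewrite ger0_norm ?subr_ge0 //.
by move: hq; rewrite ler_norml => /andP[_]; rewrite lerBlDl.
Qed.

Let g_euler i s t : s <= t -> `|g i t - g i s - (t - s) *: Y (g i s)| <=
  (t - s + h i) * (eps i + Lam * D * (t - s + h i)) + h i * C.
Proof.
move=> st; have [q [fq hq]] := floor_split i st.
have hle : q%:R * h i <= t - s + h i.
  by move: hq; rewrite ler_norml => /andP[_]; rewrite lerBlDl.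
have q0 : 0 <= q%:R * h i by rewrite mulr_ge0 // ltW.
have -> : g i t - g i s - (t - s) *: Y (g i s) =
   (g i t - g i s - (q%:R * h i) *: Y (g i s)) + (q%:R * h i - (t - s)) *: Y (g i s).
  by rewrite [(q%:R * h i - _) *: _]scalerBl [RHS]addrA subrK.
apply: le_trans (ler_normD _ _) (lerD _ _).
  have /andP[e0 _] := epsE i.
  rewrite {1}/g fq; apply: le_trans (ex_euler _ _ _) _.
  apply: ler_pM => //; first by apply: addr_ge0 => //; apply: mulr_ge0 => //; apply: mulr_ge0.
  by rewrite lerD2l; apply: ler_wpM2l => //; apply: mulr_ge0.
rewrite normrZ; apply: ler_pM => //.
by apply: YC; exact: zzB.
Qed.

Let U_h : h @ U --> 0.
Proof.
have hoo : h @ \oo --> 0.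
  apply/cvgrPdist_le => e e0; exists (Num.truncn e^-1) => // i /= hi.
  rewrite sub0r normrN gtr0_norm // invf_ple ?posrE //; apply/ltW/(lt_le_trans (truncnS_gt _)).
  by rewrite ler_nat ltnS; exact: (leq_trans hi (leq_addl 2 i)).
by move=> A hA; exact: Uoo (hoo A hA).
Qed.

Let g_cvg t : exists x : V, (fun i => g i t) @ U --> x.
Proof.
have [|x [_ hx]] := @ultra_compact_cvg _ _ U (fun i => g i t) _ UU (@rV_ball_compact R m B B0).
  by apply: filterS (filterT : U setT) => i _; exact: zzB.
by exists x.
Qed.

Let gam t : V := projT1 (cid (g_cvg t)).
Let gamP t : (fun i => g i t) @ U --> gam t. Proof. exact: (projT2 (cid (g_cvg t))). Qed.

Let U_norm_le (f : nat -> V) (x : V) (a : nat -> R) (c : R) :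
  f @ U --> x -> a @ U --> c -> (forall i, `|f i| <= a i) -> `|x| <= c.
Proof.
move=> fx ac fa; have nf : (fun i => `|f i|) @ U --> `|x| by exact: cvg_norm.
apply: (ler_cvg_to nf ac).
exact: nearW.
Qed.

Let gam_lip s t : `|gam t - gam s| <= `|t - s| * D.
Proof.
apply: (U_norm_le (f := fun i => g i t - g i s) (a := fun i => (`|t - s| + h i) * D)).
- by apply: cvgB; exact: gamP.
- have -> : `|t - s| * D = (`|t - s| + 0) * D by rewrite addr0.
  apply: cvgM; last exact: cvg_cst.
  by apply: cvgD; [exact: cvg_cst|exact: U_h].
- by move=> i; exact: g_lip.
Qed.

Let Y_continuous : continuous Y. Proof. exact: lip_continuous Lam0 YL. Qed.

Let gam_euler_pos s t : s <= t ->
  `|gam t - gam s - (t - s) *: Y (gam s)| <= Lam * D * (t - s) ^+ 2.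
Proof.
move=> st.
apply: (U_norm_le (f := fun i => g i t - g i s - (t - s) *: Y (g i s))
  (a := fun i => (t - s + h i) * (eps i + Lam * D * (t - s + h i)) + h i * C)).
- apply: cvgB; first by apply: cvgB; exact: gamP.
  apply: cvgZ; first exact: cvg_cst.
  by apply: continuous_cvg; [exact: Y_continuous|exact: gamP].
- have -> : Lam * D * (t - s) ^+ 2 = (t - s + 0) * (0 + Lam * D * (t - s + 0)) + 0 * C by ring.
  have c1 : (fun i => t - s + h i) @ U --> t - s + 0.
    by apply: cvgD; [exact: cvg_cst|exact: U_h].
  apply: cvgD; last by apply: cvgM; [exact: U_h|exact: cvg_cst].
  apply: cvgM => //; apply: cvgD; first exact: U_eps.
  by apply: cvgM => //; exact: cvg_cst.
- by move=> i; exact: g_euler.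
Qed.

Let gam_euler s t : `|gam t - gam s - (t - s) *: Y (gam s)| <= 2 * Lam * D * (t - s) ^+ 2.
Proof.
have LD : 0 <= Lam * D * (t - s) ^+ 2 by rewrite mulr_ge0 ?sqr_ge0 // mulr_ge0.
have [st|/ltW ts] := leP s t.
  by apply: le_trans (gam_euler_pos st) _; lra.
(* Backwards in time: expand at [t] and replace [Y (gam t)] by [Y (gam s)] at the cost of its
   Lipschitz constant, whence the factor 2. *)
have -> : gam t - gam s - (t - s) *: Y (gam s) =
  - ((gam s - gam t - (s - t) *: Y (gam t)) + (s - t) *: (Y (gam t) - Y (gam s))).
  by apply/rowP => l; rewrite !mxE; ring.
rewrite normrN; apply: le_trans (ler_normD _ _) _.
have h1 := gam_euler_pos ts.
have h2 : `|(s - t) *: (Y (gam t) - Y (gam s))| <= Lam * D * (t - s) ^+ 2.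
  rewrite normrZ -[(t - s) ^+ 2]real_normK ?num_real // expr2 (distrC s t) mulrA mulrC.
  apply: ler_wpM2r => //; apply: le_trans (YL _ _) _.
  by rewrite -mulrA (mulrC D); apply: ler_wpM2l => //; exact: gam_lip.
have : (s - t) ^+ 2 = (t - s) ^+ 2 by ring.
by move=> e; rewrite e in h1; have := lerD h1 h2; lra.
Qed.

Let gam_periodic t : gam (t + 1) = gam t.
Proof.
have := @cvg_unique _ (@norm_hausdorff R V) ((fun i => g i t) @ U) _ (gam (t + 1)) (gam t).
apply; last exact: gamP.
have -> : (fun i => g i t) = (fun i => g i (t + 1)); last exact: gamP.
apply/funext => i; rewrite /g mulrDl mul1r /N -[_.+3%:R in RHS]/(i.+3%:Z%:~R) floorDrz ?intr_int //.
by rewrite intrKfloor /ex /idx modzDr.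
Qed.

Let gam_index (k : forall i, 'I_i.+3) : exists t, (fun i => zz (k i)) @ U --> gam t.
Proof.
pose s i : R := (k i)%:R * h i.
have [t [_ ht]] : exists t, [set` `[0 : R, 1]] t /\ s @ U --> t.
  apply: ultra_compact_cvg (@segment_compact R 0 1) _ => //.
  apply: filterE => i /=; rewrite in_itv /= /s; apply/andP; split.
    by rewrite mulr_ge0 // ltW.
  by rewrite /h ler_pdivrMr // mul1r /N ler_nat ltnW.
exists t.
have e i : zz (k i) = g i (s i).
  rewrite /g /s -mulrA hN mulr1 -[_%:R]/((k i)%:Z%:~R) intrKfloor /ex /idx.
  by rewrite modz_small ?ltz_nat ?ltn_ord //= inord_val.
have h1 : (fun i => g i (s i) - g i t) @ U --> (0 : V).
  apply/cvgr0Pnorm_le => e0 e00.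
  have hb : (fun i => (`|s i - t| + h i) * D) @ U --> (`|t - t| + 0) * D.
    apply: cvgM; last exact: cvg_cst.
    apply: cvgD; last exact: U_h.
    by apply: cvg_norm; apply: cvgB; [exact: ht|exact: cvg_cst].
  rewrite subrr normr0 addr0 mul0r in hb.
  have /cvgr0Pnorm_le/(_ e0 e00) := hb.
  apply: filterS => i; apply: le_trans; apply: le_trans (g_lip _ _ _) _.
  exact: ler_norm.
have -> : (fun i => zz (k i)) = (fun i => g i t + (g i (s i) - g i t)).
  by apply/funext => i; rewrite e addrC subrK.
by rewrite -[gam t]addr0; apply: cvgD; first exact: gamP.
Qed.

(* The loops converge along an ultrafilter, which spares the Arzela-Ascoli
   theorem and keeps every chosen sequence of indices convergent. *)
Lemma euler_limit : exists gam : R -> V,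
  [/\ exists K, forall s t, `|gam t - gam s - (t - s) *: Y (gam s)| <= K * (t - s) ^+ 2,
      forall t, gam (t + 1) = gam t &
      forall k : forall i, 'I_i.+3, exists t, (fun i => zz (k i)) @ U --> gam t].
Proof.
exists gam; split=> [|t|k]; [exists (2 * Lam * D) => s t; exact: gam_euler | exact: gam_periodic | exact: gam_index].
Qed.

End EulerLimit.

Section HamiltonianField.
Variables (R : realType) (n : nat).

Definition hamJ (v : 'rV[R]_(n + n)) : 'rV[R]_(n + n) := v *m (Jmx R n)^T.

Lemma hamJ_row_mx (v1 v2 : 'rV[R]_n) : hamJ (row_mx v1 v2) = row_mx v2 (- v1).
Proof.
rewrite /hamJ /Jmx tr_block_mx !trmx0 linearN /= trmx1 mul_row_block.
by rewrite !mulmx0 mulmx1 add0r addr0 mulmxN mulmx1.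
Qed.

Lemma hamJE v : hamJ v = row_mx (rsubmx v) (- lsubmx v).
Proof. by rewrite -[in LHS](hsubmxK v) hamJ_row_mx. Qed.

Lemma hamJ_l v i : hamJ v 0 (lshift n i) = v 0 (rshift n i).
Proof. by rewrite hamJE row_mxEl mxE. Qed.

Lemma hamJ_r v i : hamJ v 0 (rshift n i) = - v 0 (lshift n i).
Proof. by rewrite hamJE row_mxEr !mxE. Qed.

Lemma hamJB v w : hamJ (v - w) = hamJ v - hamJ w. Proof. exact: mulmxBl. Qed.
Lemma hamJZ a v : hamJ (a *: v) = a *: hamJ v. Proof. by rewrite /hamJ -scalemxAl. Qed.

Lemma dotv_hamJ v : dotv v (hamJ v) = 0.
Proof.
rewrite dotv_split -big_split /= big1 // => i _; rewrite hamJ_l hamJ_r; ring.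
Qed.

Lemma mx_coord_le (p q : nat) (A : 'M[R]_(p, q)) i j : `|A i j| <= `|A|.
Proof.
by rewrite [leRHS]mx_normrE; exact: (le_bigmax _ (fun ij => `|A ij.1 ij.2|) (i, j)).
Qed.

Lemma mx_norm_le (p q : nat) (A : 'M[R]_(p, q)) (B : R) :
  0 <= B -> (forall i j, `|A i j| <= B) -> `|A| <= B.
Proof.
by move=> B0 h; rewrite [leLHS]mx_normrE; apply/bigmax_leP; split=> // -[i j] _ /=.
Qed.

Lemma row_norm_le (p q : nat) (A : 'M[R]_(p, q)) k : `|row k A| <= `|A|.
Proof. by apply: mx_norm_le => // i j; rewrite mxE mx_coord_le. Qed.

Lemma hamJ_norm v : `|hamJ v| <= `|v|.
Proof.
apply: mx_norm_le => // a l; rewrite ord1.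
by have [i|i] := split_ordP l => ->; rewrite ?hamJ_l ?hamJ_r ?normrN; exact: mx_coord_le.
Qed.

Lemma dotv_le m (v w : 'rV[R]_m) : `|dotv v w| <= m%:R * (`|v| * `|w|).
Proof.
apply: le_trans (ler_norm_sum _ _ _) _.
rewrite mulr_natl -[X in _ *+ X]card_ord -sumr_const; apply: ler_sum => i _.
by rewrite normrM ler_pM // mx_coord_le.
Qed.

End HamiltonianField.

Lemma exists_row_norm (R : realType) (p q : nat) (A : 'M[R]_(p.+1, q)) :
  exists k, `|A| <= `|row k A|.
Proof.
have [->|A0] := eqVneq A 0; first by exists ord0; rewrite normr0.
have [|[k l] /= hk] := @mx_norm_neq0 R _ _ A; first by rewrite -[mx_norm A]/`|A| normr_eq0.
exists k; rewrite [leLHS]hk; have := mx_coord_le (row k A) ord0 l; by rewrite mxE.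
Qed.

Lemma sumr_cst_ord (R : realType) (N : nat) (c : R) : \sum_(k < N) c = c * N%:R.
Proof. by rewrite sumr_const card_ord mulr_natr. Qed.

Lemma cvg_inv_nat3 (R : realType) : (fun i : nat => (i.+3%:R)^-1 : R) @ \oo --> 0.
Proof.
apply/cvgrPdist_le => e e0; exists (Num.truncn e^-1) => // i /= hi.
rewrite sub0r normrN gtr0_norm ?invr_gt0 ?ltr0n // invf_ple ?posrE ?ltr0n //.
apply/ltW/(lt_le_trans (truncnS_gt _)).
by rewrite ler_nat ltnS; exact: (leq_trans hi (leq_addl 2 i)).
Qed.

(** * Boundedness and nontriviality of the limit orbit *)

Section PeriodicOrbit.
Variables (R : realType) (n : nat).
Local Notation V := 'rV[R]_(n + n).
Variables (Hb : V -> R) (dH Ai : V -> V).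
Variables (Lam L LA C1 r mu w C rho : R) (j : 'I_n) (v0 : V).
Hypothesis Lam0 : 0 <= Lam.
Hypothesis Hquad : forall z v, `|Hb (z + v) - Hb z - dotv (dH z) v| <= Lam * dotv v v.
Hypothesis L0 : 0 <= L.
Hypothesis HL : forall v v', `|dH v - dH v'| <= L * `|v - v'|.
Hypothesis LA0 : 0 <= LA.
Hypothesis AL : forall v v', `|Ai v - Ai v'| <= LA * `|v - v'|.
Hypothesis AZ : forall a v, Ai (a *: v) = a *: Ai v.
Hypothesis Hinf : forall z, `|dH z - Ai z| <= C1.
(* Nonresonance of the asymptotically linear field [hamJ \o Ai]: it makes the
   almost critical loops bounded. *)
Hypothesis nonres : forall (gam : R -> V) K,
  (forall s t, `|gam t - gam s - (t - s) *: hamJ (Ai (gam s))| <= K * (t - s) ^+ 2) ->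
  (forall t, gam (t + 1) = gam t) -> forall t, gam t = 0.
Hypothesis Hc : continuous Hb.
Hypothesis r0 : 0 < r.
Hypothesis w0 : 0 < w.
Hypothesis rho0 : 0 < rho.
Hypothesis mur : pi * r ^+ 2 < mu.
Hypothesis H0 : forall z, 0 <= Hb z.
Hypothesis Hgrowth : forall z : V, mu * ((z 0 (lshift n j) ^+ 2 + z 0 (rshift n j) ^+ 2) / r ^+ 2
   + w * dotv z z) - C <= Hb z.
Hypothesis Hzero : forall z : V, (forall l, `|z 0 l - v0 0 l| < rho) -> Hb z = 0.

Let h (i : nat) : R := (i.+3%:R)^-1.
Let h0 i : 0 < h i. Proof. by rewrite invr_gt0 ltr0n. Qed.
Let h1 i : h i <= 1. Proof. by rewrite invf_le1 ?ltr0n // ler1n. Qed.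
Let hN i : h i * i.+3%:R = 1. Proof. by rewrite mulVf // pnatr_eq0. Qed.

(** Since [beta] depends on [i] and tends to zero, the gradient tolerance is chosen after it: at
    most [h i ^ 2], negligible against one Euler step, and so small that [not_near_flat], where the
    constant [16 n] arises, applies. *)
Let ex_seq i : exists ze : 'M[R]_(i.+3, n + n) * R,
  [/\ 0 < ze.2, ze.2 <= h i ^+ 2, 16 * n%:R * i.+3%:R ^+ 2 * ze.2 ^+ 2 < loop_action Hb ze.1 &
   forall k l, `|loop_grad dH ze.1 k l| <= ze.2].
Proof.
have [beta b0 hb] := loop_action_almost_critical i Lam0 Hquad (lip_continuous L0 HL) r0 w0 rho0 mur H0 Hgrowth Hzero.
pose e := h i ^+ 2 * Num.min 1 (beta / (16 * n%:R + 1)).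
have n1 : 0 < 16 * n%:R + 1 :> R by rewrite ltr_wpDl // mulr_ge0.
have m0 : 0 < Num.min 1 (beta / (16 * n%:R + 1)) by rewrite lt_min ltr01 divr_gt0.
have e0 : 0 < e by rewrite mulr_gt0 // exprn_gt0.
have [z [hz hF]] := hb (e ^+ 2) (exprn_gt0 _ e0).
exists (z, e); split=> //=.
- by rewrite /e ger_pMr ?exprn_gt0 // ge_min lexx.
- apply: lt_le_trans hz.
  have -> : 16 * n%:R * i.+3%:R ^+ 2 * e ^+ 2 = 16 * n%:R * (h i * i.+3%:R) ^+ 2 *
    (h i ^+ 2 * Num.min 1 (beta / (16 * n%:R + 1)) ^+ 2) by rewrite /e; ring.
  rewrite hN expr1n mulr1.
  apply: (@le_lt_trans _ _ (16 * n%:R * (beta / (16 * n%:R + 1)))); last first.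
    by rewrite mulrCA gtr_pMr // ltr_pdivrMr // mul1r ltrDl.
  apply: ler_wpM2l; first by rewrite mulr_ge0.
  apply: (@le_trans _ _ (Num.min 1 (beta / (16 * n%:R + 1)))); last by rewrite ge_min lexx orbT.
  rewrite [X in _ * X]expr2 mulrA; apply: ler_piMl; first exact: ltW.
  apply: mulr_ile1; [exact: sqr_ge0 | exact: ltW | | by rewrite ge_min lexx].
  by rewrite expr_le1 ?h1 // ltW.
- move=> k l; rewrite -(@ler_pXn2r _ 2) ?nnegrE ?(ltW e0) //; apply: le_trans hF.
  rewrite real_normK ?num_real // /sqsum (bigD1 k) //= /dotv (bigD1 l) //= !mxE -expr2 -addrA lerDl.
  by rewrite addr_ge0 // ?sumr_ge0 // => i' _; [rewrite -expr2 sqr_ge0|exact: dotv_ge0].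
Qed.

Let zz i : 'M[R]_(i.+3, n + n) := (projT1 (cid (ex_seq i))).1.
Let ee i : R := (projT1 (cid (ex_seq i))).2.
Let ee0 i : 0 < ee i. Proof. by rewrite /ee; case: cid => x []. Qed.
Let eeh i : ee i <= h i ^+ 2. Proof. by rewrite /ee; case: cid => x []. Qed.
Let action_gt i : 16 * n%:R * i.+3%:R ^+ 2 * ee i ^+ 2 < loop_action Hb (zz i).
Proof. by rewrite /ee /zz; case: cid => x []. Qed.
Let grad_le i k l : `|loop_grad dH (zz i) k l| <= ee i.
Proof. by rewrite /ee /zz; case: cid => x []. Qed.

(** The scheme takes the gradient at [ordS k] in the momentum equation; replacing it by the gradient
    at [k] costs [L] times one step of length [h i * (G + 1)]. *)
Let zstep i (G : R) k : (forall k, `|dH (row k (zz i))| <= G) ->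
  `|row (ordS k) (zz i) - row k (zz i) - h i *: hamJ (dH (row k (zz i)))| <=
  h i * (h i * (1 + L * (G + 1))).
Proof.
move=> HG; have G0 : 0 <= G := le_trans (normr_ge0 _) (HG k).
have hh : h i ^+ 2 <= h i by rewrite expr2 ger_pMl.
have e1 := eeh i; have e2 := ltW (ee0 i).
have dx k' i' : zz i (ordS k') (lshift n i') - zz i k' (lshift n i') =
   h i * dH (row k' (zz i)) 0 (rshift n i') + loop_grad dH (zz i) k' (rshift n i').
  by rewrite loop_gradEp /xc /h; ring.
have dp k' i' : zz i (ordS k') (rshift n i') - zz i k' (rshift n i') =
   - (h i * dH (row (ordS k') (zz i)) 0 (lshift n i')) - loop_grad dH (zz i) (ordS k') (lshift n i').
  by rewrite loop_gradEx /pc /h ordSK; ring.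
have zdiff : `|row (ordS k) (zz i) - row k (zz i)| <= h i * (G + 1).
  apply: mx_norm_le; first by rewrite mulr_ge0 // ?addr_ge0 // ltW.
  move=> a l; rewrite mulrDr mulr1.
  have -> : (row (ordS k) (zz i) - row k (zz i)) a l = zz i (ordS k) l - zz i k l by rewrite !mxE.
  have [i'|i'] := split_ordP l => ->; rewrite ?dx ?dp.
  - apply: le_trans (ler_normD _ _) (lerD _ _); last exact: le_trans (grad_le _ _) (le_trans e1 hh).
    by rewrite normrM gtr0_norm // ler_pM2l //; apply: le_trans (mx_coord_le _ _ _) (HG _).
  - apply: le_trans (ler_normB _ _) (lerD _ _); last exact: le_trans (grad_le _ _) (le_trans e1 hh).
    by rewrite normrN normrM gtr0_norm // ler_pM2l //; apply: le_trans (mx_coord_le _ _ _) (HG _).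
have hL : 0 <= L * (G + 1) by rewrite mulr_ge0 // addr_ge0.
apply: mx_norm_le; first by rewrite mulr_ge0 ?mulr_ge0 ?addr_ge0 // ltW.
have eq : h i * (h i * (1 + L * (G + 1))) = h i * (L * (h i * (G + 1))) + h i ^+ 2 by ring.
move=> a l; rewrite ord1 eq.
have -> : (row (ordS k) (zz i) - row k (zz i) - h i *: hamJ (dH (row k (zz i)))) 0 l =
  zz i (ordS k) l - zz i k l - h i * hamJ (dH (row k (zz i))) 0 l by rewrite !mxE.
have [i'|i'] := split_ordP l => ->.
- rewrite hamJ_l dx addrC addrA addNr add0r; apply: le_trans (grad_le _ _) _.
  apply: le_trans e1 _; rewrite lerDr; apply: mulr_ge0; first exact: ltW.
  by apply: mulr_ge0 => //; apply: mulr_ge0; [exact: ltW | exact: addr_ge0].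
- rewrite hamJ_r dp.
  have -> : - (h i * dH (row (ordS k) (zz i)) 0 (lshift n i')) -
    loop_grad dH (zz i) (ordS k) (lshift n i') - h i * - dH (row k (zz i)) 0 (lshift n i') =
    - (h i * (dH (row (ordS k) (zz i)) - dH (row k (zz i))) 0 (lshift n i')) -
    loop_grad dH (zz i) (ordS k) (lshift n i') by rewrite !mxE; ring.
  apply: le_trans (ler_normB _ _) (lerD _ _); last exact: le_trans (grad_le _ _) e1.
  rewrite normrN normrM gtr0_norm // ler_pM2l //.
  apply: le_trans (mx_coord_le _ _ _) _; apply: le_trans (HL _ _) _.
  exact: ler_wpM2l.
Qed.


Let C10 : 0 <= C1. Proof. exact: le_trans (normr_ge0 _) (Hinf 0). Qed.
Let Ai0 : Ai 0 = 0. Proof. by have := AZ 0 0; rewrite !scale0r. Qed.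
Let G0 : R := L + `|dH 0|.
Let G00 : 0 <= G0. Proof. exact: addr_ge0. Qed.
Let dH_le v (M : R) : 1 <= M -> `|v| <= M -> `|dH v| <= G0 * M.
Proof.
move=> M1 vM; rewrite -(subrK (dH 0) (dH v)); apply: le_trans (ler_normD _ _) _.
rewrite mulrDl; apply: lerD; last by rewrite ler_peMr.
by apply: le_trans (HL _ _) _; rewrite subr0 ler_wpM2l.
Qed.

Let Uharm U : UltraFilter U -> (forall A, (\oo : set_system nat) A -> U A) -> h @ U --> 0.
Proof. by move=> UU Uoo A hA; apply: Uoo; exact: (cvg_inv_nat3 hA). Qed.

(** Otherwise the loops divided by their norms converge to a periodic orbit of the linear field
    [hamJ (Ai v)], which [nonres] makes zero, although their points of largest norm stay on the unit
    sphere. *)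
Let zz_bounded : exists B, 1 <= B /\ forall i, `|zz i| <= B.
Proof.
apply: contrapT => nB.
have unb (B : R) : exists i, B < `|zz i|.
  apply: contrapT => /forallNP hB; apply: nB; exists (Num.max 1 B); split.
    by rewrite le_max lexx.
  by move=> i; rewrite le_max leNgt; apply/orP; right; rewrite leNgt; apply/negP/hB.
have unb' (b : nat) : exists i, (b <= i)%N /\ b%:R < `|zz i|.
  have [i hi] := unb (b%:R + \sum_(i < b) `|zz i|); exists i; split.
    rewrite leqNgt; apply/negP => ib; move: hi; rewrite (bigD1 (Ordinal ib)) //=.
    rewrite addrCA gtrDl ltNge addr_ge0 // sumr_ge0 //.
  by apply: le_lt_trans hi; rewrite lerDl sumr_ge0.
(* The ultrafilter has to refine both [i] tending to infinity and the divergence of the norms. *)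
pose F : set_system nat := filter_from setT (fun b : nat => [set i | (b <= i)%N /\ b%:R < `|zz i|]).
have FF : ProperFilter F.
  apply: filter_from_proper; last by move=> b _; have [i hi] := unb' b; exists i.
  apply: filter_from_filter; first by exists 0%N.
  move=> b c _ _; exists (maxn b c) => // i /= [hbc hi]; split; split.
  - by apply: leq_trans hbc; exact: leq_maxl.
  - by apply: le_lt_trans hi; rewrite ler_nat leq_maxl.
  - by apply: leq_trans hbc; exact: leq_maxr.
  - by apply: le_lt_trans hi; rewrite ler_nat leq_maxr.
have [U [UU FU]] := ultraFilterLemma FF.
have UP : ProperFilter U := ultra_proper.
have Uoo A : (\oo : set_system nat) A -> U A.
  by move=> [b _ hb]; apply: FU; exists b => // i [hi _]; exact: hb.
have Ubig (b : R) : \forall i \near U, b < `|zz i|.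
  apply: FU; exists (Num.truncn b).+1 => // i [_]; apply: lt_trans.
  exact: truncnS_gt.
pose Ri i := Num.max 1 `|zz i|.
have R1 i : 1 <= Ri i by rewrite /Ri le_max lexx.
have R0 i : 0 < Ri i by exact: lt_le_trans ltr01 (R1 i).
have zR i k : `|row k (zz i)| <= Ri i.
  by apply: le_trans (row_norm_le _ _) _; rewrite /Ri le_max lexx orbT.
pose ww i (k : 'I_i.+3) := (Ri i)^-1 *: row k (zz i).
pose K := 1 + L * (G0 + 1).
have K0 : 0 <= K by rewrite addr_ge0 // mulr_ge0 // addr_ge0.
have URinv : (fun i => C1 / Ri i) @ U --> 0.
  apply/cvgr0Pnorm_le => e e0; apply: filterS (Ubig (C1 / e)) => i hi.
  rewrite ger0_norm ?divr_ge0 ?(ltW (R0 i)) // ler_pdivrMr // mulrC -ler_pdivrMr //.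
  by apply/ltW; apply: lt_le_trans hi _; rewrite /Ri le_max lexx orbT.
have [|||||||gam [[K' hK'] per idx]] := @euler_limit R (n + n) U UU Uoo ww (fun v => hamJ (Ai v)) 1 LA LA
    (C1 + K) (fun i => C1 / Ri i + h i * K).
- by move=> i k; rewrite /ww normrZ normfV (gtr0_norm (R0 i)) mulrC ler_pdivrMr // mul1r.
- move=> v v1; apply: le_trans (hamJ_norm _) _; rewrite -[Ai v]subr0 -Ai0.
  by apply: le_trans (AL _ _) _; rewrite subr0 ler_piMr.
- exact: LA0.
- by move=> v v'; rewrite -hamJB; apply: le_trans (hamJ_norm _) (AL _ _).
- move=> i; rewrite addr_ge0 ?divr_ge0 ?mulr_ge0 ?(ltW (R0 i)) ?(ltW (h0 i)) //=.
  apply: lerD; last by rewrite ler_piMl.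
  by rewrite ler_pdivrMr // ler_peMr.
- rewrite -[X in _ --> X]addr0; apply: cvgD; first exact: URinv.
  by rewrite -[X in _ --> X](mul0r K); apply: cvgM; [exact: Uharm|exact: cvg_cst].
- move=> i k; rewrite /ww AZ hamJZ scalerA [_ * _^-1]mulrC -scalerA -!scalerBr normrZ normfV (gtr0_norm (R0 i)).
  rewrite mulrC ler_pdivrMr //.
  have -> : row (ordS k) (zz i) - row k (zz i) - (i.+3%:R)^-1 *: hamJ (Ai (row k (zz i))) =
     (row (ordS k) (zz i) - row k (zz i) - h i *: hamJ (dH (row k (zz i)))) +
     h i *: hamJ (dH (row k (zz i)) - Ai (row k (zz i))).
    by rewrite hamJB scalerBr addrA subrK.
  apply: le_trans (ler_normD _ _) _.
  have s1 := @zstep i (G0 * Ri i) k (fun k' => dH_le (R1 i) (zR i k')).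
  have s2 : `|h i *: hamJ (dH (row k (zz i)) - Ai (row k (zz i)))| <= h i * C1.
    rewrite normrZ gtr0_norm // ler_pM2l //; exact: le_trans (hamJ_norm _) (Hinf _).
  apply: le_trans (lerD s1 s2) _.
  have -> : (i.+3%:R)^-1 * (C1 / Ri i + h i * K) * Ri i = h i * (h i * (K * Ri i)) + h i * C1.
    by have := R0 i; move: (Ri i) => x x0; rewrite -/(h i); field; rewrite gt_eqF.
  rewrite lerD2r; apply: ler_wpM2l; first exact: ltW.
  apply: ler_wpM2l; first exact: ltW.
  have -> : K * Ri i = Ri i + L * (G0 * Ri i + Ri i) by rewrite /K; ring.
  by apply: lerD => //; apply: ler_wpM2l => //; rewrite lerD2l.
have gam0 := nonres hK' per.
pose k i := projT1 (cid (exists_row_norm (zz i))).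
have [t] := idx k; rewrite gam0 => /cvgr0Pnorm_le/(_ 2^-1) hh.
have {}hh : \forall i \near U, `|ww i (k i)| <= 2^-1 by apply: hh; rewrite invr_gt0.
have [i [h2 h3]] := filter_ex (filterI hh (Ubig 1)).
move: h2; rewrite /= /ww normrZ normfV (gtr0_norm (R0 i)) mulrC ler_pdivrMr //.
have := projT2 (cid (exists_row_norm (zz i))); rewrite -/(k i).
have -> : Ri i = `|zz i| by rewrite /Ri max_r // ltW.
by move: h3 => /=; move: `|zz i| `|row _ _| => x y ? ?; lra.
Qed.


(** The area is a quadratic form and the differences in [loop_grad] are its derivative, so pairing
    them with the loop itself gives twice the area. *)
Let action_grad i : loop_action Hb (zz i) =
  h i * (\sum_k (2^-1 * dotv (dH (row k (zz i))) (row k (zz i)) - Hb (row k (zz i)))) +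
  2^-1 * \sum_k dotv (row k (loop_grad dH (zz i))) (row k (zz i)).
Proof.
rewrite loop_grad_dot sumrB -mulr_sumr -/(h i) /loop_action.
have -> : \sum_k \sum_i0 ((pc (zz i) (ord_pred k) i0 - pc (zz i) k i0) * xc (zz i) k i0 +
     (xc (zz i) (ordS k) i0 - xc (zz i) k i0) * pc (zz i) k i0) = 2 * loop_area (zz i).
  rewrite mulr_natl mulr2n /loop_area exchange_big [X in _ = X + X]exchange_big -big_split /=.
  apply: eq_bigr => l _; rewrite big_split /= addrC; congr (_ + _).
    by apply: eq_bigr => k _; rewrite mulrC.
  under eq_bigr do rewrite mulrBl.
  under [RHS]eq_bigr do rewrite mulrBr.
  by rewrite !sumrB (sum_shift (fun k => pc (zz i) k l) (fun k => xc (zz i) k l)).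
rewrite -?/(h i); move: (h i) (loop_area _) => hh A; by field.
Qed.

(** By [action_grad] the positive action is a mean of these integrands plus a gradient term of size
    at most [n * B * h i], so they cannot all lie below minus that. *)
Let action_max i B : 1 <= B -> `|zz i| <= B -> exists k,
  - (n%:R * B * h i) <= 2^-1 * dotv (dH (row k (zz i))) (row k (zz i)) - Hb (row k (zz i)).
Proof.
move=> B1 zB; apply: contrapT => /forallNP hk.
have B0 : 0 <= B by exact: le_trans B1.
have F_le : 2^-1 * \sum_k dotv (row k (loop_grad dH (zz i))) (row k (zz i)) <= n%:R * B * h i.
  rewrite ler_pdivrMl //.
  apply: (@le_trans _ _ (\sum_(k < i.+3) (n + n)%:R * (h i ^+ 2 * B))).
    apply: ler_sum => k _; apply: le_trans (ler_norm _) _; apply: le_trans (dotv_le _ _) _.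
    apply: ler_wpM2l => //; apply: ler_pM => //.
      apply: mx_norm_le => [|a l]; first exact: sqr_ge0.
      by rewrite mxE; apply: le_trans (grad_le _ _) (eeh _).
    exact: le_trans (row_norm_le _ _) zB.
  rewrite sumr_cst_ord.
  have -> : (n + n)%:R * (h i ^+ 2 * B) * i.+3%:R = 2 * (n%:R * B * h i) * (h i * i.+3%:R).
    by rewrite natrD; ring.
  by rewrite hN mulr1.
have := action_gt i; apply/negP; rewrite -leNgt action_grad.
apply: le_trans (_ : 0 <= _); last by rewrite mulr_ge0 ?sqr_ge0 // mulr_ge0 ?sqr_ge0 // mulr_ge0.
have : h i * (\sum_k (2^-1 * dotv (dH (row k (zz i))) (row k (zz i)) - Hb (row k (zz i)))) <=
   - (n%:R * B * h i).
  apply: (@le_trans _ _ (h i * \sum_(k < i.+3) - (n%:R * B * h i))).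
    rewrite ler_pM2l //; apply: ler_sum => k _.
    by apply/ltW; rewrite ltNge; apply/negP/hk.
  by rewrite sumr_cst_ord mulrCA hN mulr1.
by move: F_le; move: (2^-1 * _) (h i * _) (n%:R * B * h i) => x y z; lra.
Qed.

(** Strict differentiability of [dH] at [c] with derivative zero. *)
Definition flat_at (c : V) := forall e : R, 0 < e -> exists2 d : R, 0 < d &
  forall v v' : V, `|v - c| < d -> `|v' - c| < d -> `|dH v - dH v'| <= e * `|v - v'|.

(** A discrete form of the bound of periods from below by the Lipschitz constant of the field. With
    constant 1/4 the extent [D] of the loop obeys [D <= D / 2 + 2 N e], where [N] is the number of
    points and [e] bounds the gradient. So [D <= 4 N e], consecutive points are at most [4 e] apart,
    and the area is at most [16 n N^2 e^2], against [action_gt]. *)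
Let not_near_flat c i d : 0 < d ->
  (forall v v' : V, `|v - c| < d -> `|v' - c| < d -> `|dH v - dH v'| <= 4^-1 * `|v - v'|) ->
  (forall k, `|row k (zz i) - c| < d) -> False.
Proof.
move=> d0 hd near; set z := zz i; pose e := ee i.
have e0 : 0 <= e := ltW (ee0 i).
pose D := `|z - \matrix_(k < i.+3) row ord0 z|.
have D0 : 0 <= D by exact: normr_ge0.
have zD k l : `|z k l - z ord0 l| <= D.
  by have := mx_coord_le (z - \matrix_(k < i.+3) row ord0 z) k l; rewrite !mxE.
have rowD k k' : `|row k z - row k' z| <= 2 * D.
  apply: mx_norm_le => [|a l]; first exact: mulr_ge0.
  rewrite !mxE; have := zD k l; have := zD k' l; rewrite (distrC (z k' l)).
  move=> h2 h3; rewrite -(subrK (z ord0 l) (z k l)) -addrA; apply: le_trans (ler_normD _ _) _; lra.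
have N1 : 0 <= i.+3%:R :> R by exact: ler0n.
(* The differences along a closed loop sum to zero, so the mean of [dH] is controlled by the
   gradient of the action alone. *)
have mean l : `|h i * \sum_k dH (row k z) 0 l| <= i.+3%:R * e.
  have -> : h i * \sum_k dH (row k z) 0 l = \sum_k (h i * dH (row k z) 0 l) by rewrite mulr_sumr.
  have sumF : \sum_k (h i * dH (row k z) 0 l) = - \sum_k loop_grad dH z k l.
    rewrite -sumrN; apply/eqP; rewrite -subr_eq0 -sumrB; apply/eqP.
    have [l'|l'] := split_ordP l => ->.
      transitivity (\sum_k (pc z (ord_pred k) l' - pc z k l')).
        by apply: eq_bigr => k _; rewrite loop_gradEx -/(h i); ring.
      by rewrite sumrB (sum_ord_pred (fun k => pc z k l')) subrr.
    transitivity (\sum_k (xc z (ordS k) l' - xc z k l')).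
      by apply: eq_bigr => k _; rewrite loop_gradEp -/(h i); ring.
    exact: (sum_diff (fun k => xc z k l')).
  rewrite sumF normrN; apply: le_trans (ler_norm_sum _ _ _) _.
  apply: le_trans (ler_sum _ (fun k _ => grad_le k l)) _.
  by rewrite sumr_const card_ord mulr_natl.
have dHl k l : `|h i * dH (row k z) 0 l| <= h i * (2^-1 * D + i.+3%:R * e).
  rewrite normrM gtr0_norm // ler_pM2l //.
  rewrite -(subrK (h i * \sum_k dH (row k z) 0 l) (dH (row k z) 0 l)).
  apply: le_trans (ler_normD _ _) (lerD _ (mean l)).
  have -> : dH (row k z) 0 l - h i * \sum_k0 dH (row k0 z) 0 l =
     h i * \sum_k0 (dH (row k z) 0 l - dH (row k0 z) 0 l).
    by rewrite sumrB sumr_cst_ord mulrBr mulrCA hN mulr1.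
  rewrite normrM gtr0_norm //; apply: (@le_trans _ _ (h i * \sum_(k0 < i.+3) 2^-1 * D)).
    rewrite ler_pM2l //; apply: le_trans (ler_norm_sum _ _ _) _; apply: ler_sum => k0 _.
    have := mx_coord_le (dH (row k z) - dH (row k0 z)) 0 l; rewrite !mxE => hc.
    apply: le_trans hc _; apply: le_trans (hd _ _ (near k) (near k0)) _.
    have := rowD k k0; move: `|_ - _| => x; lra.
  by rewrite sumr_cst_ord mulrCA hN mulr1.
have diff k l : `|z (ordS k) l - z k l| <= h i * (2^-1 * D) + 2 * e.
  have hle : h i * (2^-1 * D + i.+3%:R * e) + e = h i * (2^-1 * D) + 2 * e.
    by rewrite mulrDr [h i * (_ * e)]mulrA hN; ring.
  rewrite -hle; have [l'|l'] := split_ordP l => ->.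
    have -> : z (ordS k) (lshift n l') - z k (lshift n l') = h i * dH (row k z) 0 (rshift n l') +
        loop_grad dH z k (rshift n l') by rewrite loop_gradEp /xc -/(h i); ring.
    by apply: le_trans (ler_normD _ _) (lerD _ _); [exact: dHl|exact: grad_le].
  have -> : z (ordS k) (rshift n l') - z k (rshift n l') = - (h i * dH (row (ordS k) z) 0 (lshift n l')) -
      loop_grad dH z (ordS k) (lshift n l') by rewrite loop_gradEx /pc -/(h i) ordSK; ring.
  by apply: le_trans (ler_normB _ _) (lerD _ _); [rewrite normrN; exact: dHl|exact: grad_le].
have Dle : D <= 4 * (i.+3%:R * e).
  have : D <= 2^-1 * D + 2 * (i.+3%:R * e).
    apply: mx_norm_le => [|k l].
      by rewrite addr_ge0 // mulr_ge0 // ?invr_ge0 // mulr_ge0.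
    rewrite !mxE; apply: le_trans (dist_le_sum_diff (fun k => z k l) k) _.
    apply: le_trans (ler_sum _ (fun k _ => diff k l)) _.
    rewrite sumr_cst_ord.
    have -> : (h i * (2^-1 * D) + 2 * e) * i.+3%:R = (h i * i.+3%:R) * (2^-1 * D) + 2 * (i.+3%:R * e) by ring.
    by rewrite hN mul1r.
  by move: (i.+3%:R * e) => x; lra.
have diff' k l : `|z (ordS k) l - z k l| <= 4 * e.
  apply: le_trans (diff k l) _.
  have : h i * (2^-1 * D) <= h i * (2^-1 * (4 * (i.+3%:R * e))).
    by rewrite ler_pM2l // ler_pM2l ?invr_gt0.
  have -> : h i * (2^-1 * (4 * (i.+3%:R * e))) = (h i * i.+3%:R) * (2 * e) by field.
  by rewrite hN; lra.
have := action_gt i; apply/negP; rewrite -leNgt -/z.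
apply: (@le_trans _ _ (loop_area z)).
  by rewrite /loop_action gerBl mulr_ge0 ?invr_ge0 // sumr_ge0.
have -> : loop_area z = \sum_k \sum_l (pc z k l - pc z ord0 l) * (xc z (ordS k) l - xc z k l).
  apply/eqP; rewrite -subr_eq0 -sumrB; apply/eqP.
  transitivity (\sum_k \sum_l pc z ord0 l * (xc z (ordS k) l - xc z k l)).
    by apply: eq_bigr => k _; rewrite -sumrB; apply: eq_bigr => l _; ring.
  rewrite exchange_big big1 // => l _.
  by rewrite -mulr_sumr (sum_diff (fun k => xc z k l)) mulr0.
apply: (@le_trans _ _ (\sum_(k < i.+3) \sum_(l < n) 4 * (i.+3%:R * e) * (4 * e))).
  apply: ler_sum => k _; apply: ler_sum => l _; apply: le_trans (ler_norm _) _.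
  by rewrite normrM; apply: ler_pM => //; [exact: le_trans (zD _ _) Dle|exact: diff'].
rewrite !sumr_cst_ord le_eqVlt; apply/orP; left.
by apply/eqP; rewrite /e; ring.
Qed.

(** The last two clauses stand in for positive action, which need not survive the limit. [idx] makes
    the point with the good integrand, respectively the one farthest from [c], converge to a point
    of the orbit. *)
Lemma periodic_orbit_exists : exists gam : R -> V,
  [/\ exists K, forall s t, `|gam t - gam s - (t - s) *: hamJ (dH (gam s))| <= K * (t - s) ^+ 2,
      forall t, gam (t + 1) = gam t,
      exists t, 0 <= 2^-1 * dotv (dH (gam t)) (gam t) - Hb (gam t) &
      forall c, flat_at c -> ~ (forall t, gam t = c)].
Proof.
have [B [B1 zB]] := zz_bounded.
have B0 : 0 <= B := le_trans ler01 B1.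
have [U [UU Uoo]] := ultraFilterLemma (eventually_filter).
have UP : ProperFilter U := ultra_proper.
pose G := G0 * B.
have G_0 : 0 <= G by exact: mulr_ge0.
pose K := 1 + L * (G + 1).
have K0 : 0 <= K by rewrite addr_ge0 // mulr_ge0 // addr_ge0.
have rB i k : `|row k (zz i)| <= B by exact: le_trans (row_norm_le _ _) (zB i).
have [|||||||gam [hK per idx]] := @euler_limit R (n + n) U UU Uoo (fun i k => row k (zz i))
  (fun v => hamJ (dH v)) B G L K (fun i => h i * K).
- exact: rB.
- by move=> v vB; apply: le_trans (hamJ_norm _) (dH_le _ _).
- exact: L0.
- by move=> v v'; rewrite -hamJB; apply: le_trans (hamJ_norm _) (HL _ _).
- by move=> i; rewrite mulr_ge0 ?(ltW (h0 i)) //= ler_piMl.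
- by rewrite -[X in _ --> X](mul0r K); apply: cvgM; [exact: Uharm|exact: cvg_cst].
- move=> i k; apply: zstep => k'; exact: dH_le.
exists gam; split=> //.
- pose k i := projT1 (cid (action_max B1 (zB i))).
  have kP i : - (n%:R * B * h i) <= 2^-1 * dotv (dH (row (k i) (zz i))) (row (k i) (zz i)) - Hb (row (k i) (zz i)).
    exact: projT2 (cid (action_max B1 (zB i))).
  have [t ht] := idx k; exists t.
  pose ell (v : V) := 2^-1 * dotv (dH v) v - Hb v.
  have dHc : continuous dH by exact: lip_continuous L0 HL.
  have ellc : continuous ell.
    apply: fctB_continuous => //; apply: fctM_continuous; first exact: fct_cst_continuous.
    apply: fct_sum_continuous => l; apply: fctM_continuous; last exact: coord_continuous.
    exact: (fct_comp_continuous dHc (@coord_continuous _ _ _ 0 l)).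
  have c1 : (fun i => ell (row (k i) (zz i))) @ U --> ell (gam t).
    by apply: continuous_cvg; [exact: ellc|exact: ht].
  have c2 : (fun i => - (n%:R * B * h i)) @ U --> (0 : R).
    rewrite -[X in _ --> X]oppr0 -[X in _ --> - X](mulr0 (n%:R * B)).
    by apply: cvgN; apply: cvgM; [exact: cvg_cst|exact: Uharm].
  by apply: (ler_cvg_to c2 c1); exact: nearW.
- move=> c fc gc; have [|d d0 hd] := fc 4^-1; first by rewrite invr_gt0.
  pose k i := projT1 (cid (exists_row_norm (zz i - \matrix_(k < i.+3) c))).
  have kP i k' : `|row k' (zz i) - c| <= `|row (k i) (zz i) - c|.
    have e k0 : row k0 (zz i) - c = row k0 (zz i - \matrix_(k < i.+3) c).
      by apply/rowP => l; rewrite !mxE.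
    rewrite !e; apply: le_trans (row_norm_le _ _) _.
    exact: projT2 (cid (exists_row_norm (zz i - \matrix_(k < i.+3) c))).
  have [t] := idx k; rewrite gc => /cvgr_dist_lt/(_ d d0)/filter_ex [i hi].
  apply: (not_near_flat d0 hd (i := i)) => k'; apply: le_lt_trans (kP i k') _.
  by rewrite distrC.
Qed.

End PeriodicOrbit.

(** * Periodic orbits of Hamiltonians supported in a cylinder *)

Section HuberFunction.
Variables (R : realType) (eta : R).
Hypothesis eta0 : 0 < eta.

Let cl (s : R) := Num.max 0 (Num.min eta s).
(* A C^1 convex function vanishing for [s <= 0], with slope 1 for [s >= eta]. *)
Definition huber (s : R) := (s * cl s - cl s ^+ 2 / 2) / eta.
Definition dhuber (s : R) := cl s / eta.

Let cl_itv s : 0 <= cl s <= eta.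
Proof. by rewrite /cl le_max lexx /= ge_max ge_min lexx /= andbT ltW. Qed.

Let cl_cases s : (s <= 0 /\ cl s = 0) \/ (0 <= s <= eta /\ cl s = s) \/ (eta <= s /\ cl s = eta).
Proof.
rewrite /cl; case: (leP s 0) => s0; first by left; rewrite min_r ?(le_trans s0 (ltW eta0)) // max_l.
right; case: (leP s eta) => se; first by left; rewrite (ltW s0) max_r // ltW.
by right; rewrite max_r // ltW.
Qed.

Lemma dhuber_itv s : 0 <= dhuber s <= 1.
Proof.
have /andP[h1 h2] := cl_itv s.
by rewrite /dhuber divr_ge0 ?(ltW eta0) //= ler_pdivrMr // mul1r.
Qed.

Let cl_lip s t : `|cl s - cl t| <= `|s - t|.
Proof.
have h1 := ler_norm (s - t); have h2 := ler_norm (t - s); rewrite (distrC t) in h2.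
rewrite ler_norml; move: `|s - t| h1 h2 => d h1 h2.
by have e0 := eta0; case: (cl_cases s) => [[? ->]|[[/andP[? ?] ->]|[? ->]]];
  case: (cl_cases t) => [[? ->]|[[/andP[? ?] ->]|[? ->]]]; apply/andP; split; lra.
Qed.

Lemma dhuber_lip s t : `|dhuber s - dhuber t| <= `|s - t| / eta.
Proof.
by rewrite /dhuber -mulrBl normrM (gtr0_norm (_ : 0 < eta^-1)) ?invr_gt0 // ler_pM2r ?invr_gt0.
Qed.

(** A Legendre transform: [huber] is the supremum of these affine functions of [s], attained at
    [c = cl s]. The estimates that follow compare two values of [c]. *)
Let huber_max s c : 0 <= c <= eta -> (s * c - c ^+ 2 / 2) / eta <= huber s.
Proof.
move=> /andP[c0 c1]; rewrite /huber ler_pM2r ?invr_gt0 //.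
rewrite -subr_ge0; case: (cl_cases s) => [[s0 ->]|[[_ ->]|[s1 ->]]].
- rewrite (_ : _ - _ = (- s) * c + c ^+ 2 / 2); last by field.
  by rewrite addr_ge0 ?mulr_ge0 ?oppr_ge0 ?sqr_ge0.
- rewrite (_ : _ - _ = (s - c) ^+ 2 / 2); last by field.
  by rewrite divr_ge0 ?sqr_ge0.
- rewrite (_ : _ - _ = (s - eta) * (eta - c) + (eta - c) ^+ 2 / 2); last by field.
  by rewrite addr_ge0 ?mulr_ge0 ?subr_ge0 ?sqr_ge0.
Qed.

Lemma huber_quad s t : `|huber t - huber s - (t - s) * dhuber s| <= eta^-1 * (t - s) ^+ 2.
Proof.
have h1 := huber_max t (cl_itv s); have h2 := huber_max s (cl_itv t).
have e : (cl t - cl s) * (t - s) <= (t - s) ^+ 2.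
  apply: le_trans (ler_norm _) _; rewrite normrM -[leRHS]real_normK ?num_real // expr2.
  by apply: ler_pM => //; exact: cl_lip.
rewrite ler_norml; apply/andP; split.
  apply: (@le_trans _ _ 0); first by rewrite oppr_le0 mulr_ge0 ?sqr_ge0 // invr_ge0 ltW.
  rewrite -addrA -opprD subr_ge0; apply: le_trans h1; rewrite /huber /dhuber.
  by rewrite le_eqVlt; apply/orP; left; apply/eqP; field; rewrite gt_eqF.
have : huber t - huber s - (t - s) * dhuber s <= eta^-1 * ((cl t - cl s) * (t - s)).
  rewrite -addrA -opprD lerBlDr; apply: le_trans (_ : _ <= eta^-1 * ((cl t - cl s) * (t - s)) +
    ((s * cl t - cl t ^+ 2 / 2) / eta + (t - s) * dhuber s)) _; last by rewrite lerD2l lerD2r.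
  by rewrite /huber /dhuber le_eqVlt; apply/orP; left; apply/eqP; field; rewrite gt_eqF.
by move/le_trans; apply; rewrite ler_pM2l ?invr_gt0.
Qed.

Lemma is_derive_huber s : is_derive s (1 : R) huber (dhuber s).
Proof. by apply: (@is_derive_quadratic R R _ s eta^-1) => t; exact: huber_quad. Qed.

Lemma huber_ge0 s : 0 <= huber s.
Proof.
apply: le_trans (huber_max s (_ : 0 <= 0 <= eta)); first by rewrite mulr0 expr0n /= mul0r subr0 mul0r.
by rewrite lexx ltW.
Qed.

Lemma huber_eq0 s : s <= 0 -> huber s = 0.
Proof.
move=> s0; rewrite /huber; have -> : cl s = 0.
  by have e0 := eta0; case: (cl_cases s) => [[? ->]|[[/andP[? ?] ->]|[? ?]]]; lra.
by rewrite mulr0 expr0n /= mul0r subr0 mul0r.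
Qed.

Lemma dhuber_eq0 s : s <= 0 -> dhuber s = 0.
Proof.
move=> s0; rewrite /dhuber; have -> : cl s = 0.
  by have e0 := eta0; case: (cl_cases s) => [[? ->]|[[/andP[? ?] ->]|[? ?]]]; lra.
by rewrite mul0r.
Qed.

Lemma dhuber_eq1 s : eta <= s -> dhuber s = 1.
Proof.
move=> s0; rewrite /dhuber; have -> : cl s = eta.
  by have e0 := eta0; case: (cl_cases s) => [[? ?]|[[/andP[? ?] ->]|[? ->]]]; lra.
by rewrite divff // gt_eqF.
Qed.

Lemma dhuber_gt0 s : 0 < s -> 0 < dhuber s.
Proof.
move=> s0; rewrite /dhuber divr_gt0 //.
by have e0 := eta0; case: (cl_cases s) => [[? ?]|[[/andP[? ?] ->]|[? ->]]]; lra.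
Qed.

Lemma dhuber_le s : 0 <= s -> dhuber s <= s / eta.
Proof.
move=> s0; rewrite /dhuber ler_pM2r ?invr_gt0 //.
by have e0 := eta0; case: (cl_cases s) => [[? ->]|[[/andP[? ?] ->]|[? ->]]]; lra.
Qed.

Lemma huber_ge s : s - eta / 2 <= huber s.
Proof.
apply: le_trans (huber_max s (_ : 0 <= eta <= eta)).
  by rewrite le_eqVlt; apply/orP; left; apply/eqP; field; rewrite gt_eqF.
by rewrite lexx ltW.
Qed.

Lemma huber_big s : eta <= s -> huber s = s - eta / 2.
Proof.
move=> s0; rewrite /huber; have -> : cl s = eta.
  by have e0 := eta0; case: (cl_cases s) => [[? ?]|[[/andP[? ?] ->]|[? ->]]]; lra.
by field; rewrite gt_eqF.
Qed.

Lemma huber_le s t : s <= t -> huber s <= huber t.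
Proof.
move=> st; apply: le_trans (huber_max t (cl_itv s)).
rewrite /huber ler_pM2r ?invr_gt0 // lerD2r ler_wpM2r //.
by have /andP[] := cl_itv s.
Qed.

Lemma huber_lt s t : 0 < s -> s < t -> huber s < huber t.
Proof.
move=> s0 st; apply: lt_le_trans (huber_max t (cl_itv s)).
rewrite /huber ltr_pM2r ?invr_gt0 // ltrD2r ltr_pM2r //.
by have e0 := eta0; case: (cl_cases s) => [[? ?]|[[/andP[? ?] ->]|[? ->]]]; lra.
Qed.

Lemma huber_gt0 t : 0 < t -> 0 < huber t.
Proof.
move=> t0; have := @huber_lt (t / 2) t; have := huber_ge0 (t / 2).
move=> h1 h2; apply: le_lt_trans h1 (h2 _ _); lra.
Qed.

(** The left side is the Legendre dual [cl s ^ 2 / (2 eta)]; it is the part of the action integrand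
    that comes from the growth outside the ellipsoid. *)
Lemma dhuber_huber s : s * dhuber s - huber s <= eta / 2.
Proof.
have /andP[c0 c1] := cl_itv s; rewrite /huber /dhuber.
have -> : s * (cl s / eta) - (s * cl s - cl s ^+ 2 / 2) / eta = cl s ^+ 2 / eta / 2.
  by field; rewrite gt_eqF.
by rewrite ler_pM2r // ler_pdivrMr // expr2 ler_pM.
Qed.

End HuberFunction.

Section GradientLines.
Variables (R : realType) (m : nat).
Local Notation V := 'rV[R]_m.
Implicit Types (f : V -> R) (df : V -> V).

Lemma dotvDr (u v w : V) : dotv u (v + w) = dotv u v + dotv u w.
Proof. by rewrite /dotv -big_split; apply: eq_bigr => i _; rewrite !mxE mulrDr. Qed.
Lemma dotvZr a (u v : V) : dotv u (a *: v) = a * dotv u v.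
Proof. by rewrite /dotv mulr_sumr; apply: eq_bigr => i _; rewrite !mxE mulrCA. Qed.
Lemma dotvC (u v : V) : dotv u v = dotv v u.
Proof. by apply: eq_bigr => i _; rewrite mulrC. Qed.
Lemma dotvDl (u v w : V) : dotv (v + w) u = dotv v u + dotv w u.
Proof. by rewrite dotvC dotvDr !(dotvC u). Qed.
Lemma dotvZl a (u v : V) : dotv (a *: v) u = a * dotv v u.
Proof. by rewrite dotvC dotvZr (dotvC u). Qed.
Lemma dotvNl (u v : V) : dotv (- v) u = - dotv v u.
Proof. by rewrite -scaleN1r dotvZl mulN1r. Qed.
Lemma dotvNr (u v : V) : dotv u (- v) = - dotv u v.
Proof. by rewrite dotvC dotvNl dotvC. Qed.
Lemma dotvBl (u v w : V) : dotv (v - w) u = dotv v u - dotv w u.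
Proof. by rewrite dotvDl dotvNl. Qed.

Lemma norm_sq_le_dotv (v : V) : `|v| ^+ 2 <= dotv v v.
Proof.
have [->|v0] := eqVneq v 0; first by rewrite normr0 expr0n /= dotv_ge0.
have [|[k l] /= hk] := @mx_norm_neq0 R _ _ v; first by rewrite -[mx_norm v]/`|v| normr_eq0.
rewrite [`|v|]hk ord1 real_normK ?num_real // /dotv (bigD1 l) //= -expr2 lerDl.
by apply: sumr_ge0 => i _; rewrite -expr2 sqr_ge0.
Qed.

Lemma dotv_eq0 (v : V) : dotv v v <= 0 -> v = 0.
Proof.
move=> h; apply/eqP; rewrite -normr_eq0 -sqrf_eq0 eq_le sqr_ge0 andbT.
exact: le_trans (norm_sq_le_dotv v) h.
Qed.

(** Differentiability along lines only: enough for the mean value theorem and the quadratic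
    remainder, and accessible to calculus in one variable. *)
Definition has_grad f df := forall z v t,
  is_derive t (1 : R) (fun s : R => f (z + s *: v)) (dotv (df (z + t *: v)) v).

Lemma has_grad_mvt f df z v : has_grad f df ->
  exists2 t, 0 <= t <= 1 & f (z + v) - f z = dotv (df (z + t *: v)) v.
Proof.
move=> hf; pose F s := f (z + s *: v).
have Fc : {within `[0, 1], continuous F}.
  apply: derivable_within_continuous => t _.
  by have [] := hf z v t.
have [t t01 e] := MVT ltr01 (fun t _ => hf z v t) Fc.
exists t; first by move: t01; rewrite in_itv /= => /andP[/ltW -> /ltW ->].
by move: e; rewrite /F scale1r scale0r addr0 subr0 mulr1.
Qed.

Lemma has_grad_quad f df L : has_grad f df -> 0 <= L ->
  (forall v w, `|df v - df w| <= L * `|v - w|) ->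
  forall z v, `|f (z + v) - f z - dotv (df z) v| <= (m%:R * L) * dotv v v.
Proof.
move=> hf L0 dfL z v; have [t /andP[t0 t1] ->] := has_grad_mvt z v hf.
rewrite -dotvBl; apply: le_trans (dotv_le _ _) _.
rewrite -mulrA; apply: ler_wpM2l => //.
apply: (@le_trans _ _ (L * `|v| * `|v|)).
  apply: ler_wpM2r => //; apply: le_trans (dfL _ _) _.
  rewrite addrAC subrr add0r normrZ ger0_norm //; apply: ler_wpM2l => //.
  by rewrite ler_piMl.
by rewrite -mulrA -expr2; apply: ler_wpM2l => //; exact: norm_sq_le_dotv.
Qed.

Lemma has_grad_lip f df C : has_grad f df -> (forall v, `|df v| <= C) ->
  forall v w, `|f v - f w| <= m%:R * C * `|v - w|.
Proof.
move=> hf dfC v w; have [t _] := has_grad_mvt w (v - w) hf.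
have -> : w + (v - w) = v by rewrite addrC subrK.
move=> ->; apply: le_trans (dotv_le _ _) _.
by rewrite -mulrA; apply: ler_wpM2l => //; apply: ler_wpM2r.
Qed.

Lemma grad_max f df Lam z : 0 <= Lam ->
  (forall z v, `|f (z + v) - f z - dotv (df z) v| <= Lam * dotv v v) ->
  (forall v, f v <= f z) -> df z = 0.
Proof.
move=> L0 fq fz; apply: dotv_eq0; set D := dotv _ _.
have D0 : 0 <= D by exact: dotv_ge0.
pose s := (2 * Lam + 1)^-1.
have L1 : 0 < 2 * Lam + 1 by rewrite ltr_wpDl // mulr_ge0.
have s0 : 0 < s by rewrite invr_gt0.
have sL : Lam * s <= 2^-1 by rewrite ler_pdivrMr //; lra.
have := fq z (s *: df z); rewrite !dotvZr dotvZl -/D ler_norml => /andP[h _].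
have h2 := fz (z + s *: df z).
have h3 : s * D <= Lam * s * (s * D) by move: h h2; rewrite -!mulrA; lra.
have sD : 0 <= s * D by rewrite mulr_ge0 // ltW.
have h4 : Lam * s * (s * D) <= 2^-1 * (s * D) by exact: ler_wpM2r.
have : s * D <= 0 by lra.
by rewrite pmulr_rle0.
Qed.

Lemma grad_min f df Lam z : 0 <= Lam ->
  (forall z v, `|f (z + v) - f z - dotv (df z) v| <= Lam * dotv v v) ->
  (forall v, f z <= f v) -> df z = 0.
Proof.
move=> L0 fq fz; apply: oppr_inj; rewrite oppr0.
apply: (@grad_max (fun v => - f v) (fun v => - df v) Lam z L0) => [u v|v]; last by rewrite lerN2.
by rewrite dotvNl -!opprD normrN; exact: fq.
Qed.

Lemma has_gradD f df g dg : has_grad f df -> has_grad g dg ->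
  has_grad (fun z => f z + g z) (fun z => df z + dg z).
Proof.
move=> hf hg z v t; rewrite dotvDl.
by apply: is_deriveD; [exact: hf|exact: hg].
Qed.

Lemma has_gradZ a f df : has_grad f df -> has_grad (fun z => a * f z) (fun z => a *: df z).
Proof.
move=> hf z v t; rewrite dotvZl; have := is_deriveZ a (hf z v t); exact.
Qed.

Lemma has_grad_comp (c dc : R -> R) f df : (forall s, is_derive s (1 : R) c (dc s)) ->
  has_grad f df -> has_grad (fun z => c (f z)) (fun z => dc (f z) *: df z).
Proof.
move=> hc hf z v t; rewrite dotvZl.
have h1 := hf z v t; have h2 := hc (f (z + t *: v)).
exact: (@is_derive1_comp R c (fun s => f (z + s *: v)) t).
Qed.

End GradientLines.

Section HarmonicOscillator.
Variable R : realType.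

Lemma cos_neq1 (w : R) : 0 < w < 4 * pi -> w != 2 * pi -> cos w != 1.
Proof.
move=> /andP[w0 w4] w2; have hw : w = (w / 2) *+ 2 by rewrite mulr2n; field.
rewrite hw cos_mulr2n cos2sin2; apply/eqP => h.
have : sin (w / 2) ^+ 2 = 0 by move: h; rewrite mulr2n; lra.
move=> /eqP; rewrite sqrf_eq0; apply/negP.
have [wp|pw] := ltP (w / 2) pi.
  by rewrite gt_eqF // sin_gt0_pi // divr_gt0.
have {}pw : pi < w / 2.
  by rewrite lt_neqAle pw andbT; apply: contra_neq w2 => ->; field.
have -> : w / 2 = (w / 2 - pi) + pi by rewrite subrK.
rewrite sinDpi oppr_eq0 gt_eqF // sin_gt0_pi // subr_gt0 pw /= ltrBlDr.
lra.
Qed.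

(** In the frame rotating with the field the solution is constant. Returning at time 1 makes it a
    fixed vector of the rotation by [w], and [2 * (1 - cos w)] is the determinant of that rotation
    minus the identity. *)
Lemma oscillator_periodic (x p : R -> R) (w : R) : cos w != 1 ->
  (forall t, is_derive t (1 : R) x (w * p t)) ->
  (forall t, is_derive t (1 : R) p (- (w * x t))) ->
  x 1 = x 0 -> p 1 = p 0 -> forall t, x t = 0 /\ p t = 0.
Proof.
move=> cw dx dp x1 p1.
have dwt t : is_derive t (1 : R) (fun s => w * s) w.
  have := is_deriveZ w (is_derive_id t (1 : R)).
  by rewrite /GRing.scale /= mulr1.
have dc t : is_derive t (1 : R) (fun s => cos (w * s)) (w * - sin (w * t)).
  have h1 := dwt t; have h2 := is_derive_cos (w * t).
  by apply: (is_derive_eq (@is_derive1_comp _ _ _ _ _ _ h2 h1)); rewrite mulrC.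
have ds t : is_derive t (1 : R) (fun s => sin (w * s)) (w * cos (w * t)).
  have h1 := dwt t; have h2 := is_derive_sin (w * t).
  by apply: (is_derive_eq (@is_derive1_comp _ _ _ _ _ _ h2 h1)); rewrite mulrC.
pose u t := x t * cos (w * t) - p t * sin (w * t).
pose v t := x t * sin (w * t) + p t * cos (w * t).
have du s t : u s = u t.
  apply: is_derive_0_is_cst => y.
  have h := is_deriveB (is_deriveM (dx y) (dc y)) (is_deriveM (dp y) (ds y)).
  by apply: (is_derive_eq h); rewrite /GRing.scale /=; ring.
have dv s t : v s = v t.
  apply: is_derive_0_is_cst => y.
  have h := is_deriveD (is_deriveM (dx y) (ds y)) (is_deriveM (dp y) (dc y)).
  by apply: (is_derive_eq h); rewrite /GRing.scale /=; ring.
have u0 : u 0 = x 0 by rewrite /u mulr0 cos0 sin0; ring.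
have v0 : v 0 = p 0 by rewrite /v mulr0 cos0 sin0; ring.
have := du 1 0; have := dv 1 0; rewrite u0 v0 /u /v mulr1 x1 p1 => e1 e2.
have cs : cos w ^+ 2 + sin w ^+ 2 = 1 by exact: cos2Dsin2.
have key (a : R) : 2 * (1 - cos w) * a = 0 -> a = 0.
  by move/eqP; rewrite mulf_eq0 mulf_eq0 subr_eq0 [1 == _]eq_sym (negbTE cw) pnatr_eq0 /= => /eqP.
have x0 : x 0 = 0.
  apply: key.
  have -> : 2 * (1 - cos w) * x 0 = (cos w ^+ 2 + sin w ^+ 2 + 1 - 2 * cos w) * x 0 by rewrite cs; ring.
  have -> : (cos w ^+ 2 + sin w ^+ 2 + 1 - 2 * cos w) * x 0 =
    (cos w - 1) * (x 0 * cos w - p 0 * sin w - x 0) + sin w * (x 0 * sin w + p 0 * cos w - p 0) by ring.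
  by rewrite e1 e2 !subrr !mulr0 addr0.
have p0 : p 0 = 0.
  apply: key.
  have -> : 2 * (1 - cos w) * p 0 = (cos w ^+ 2 + sin w ^+ 2 + 1 - 2 * cos w) * p 0 by rewrite cs; ring.
  have -> : (cos w ^+ 2 + sin w ^+ 2 + 1 - 2 * cos w) * p 0 =
    - sin w * (x 0 * cos w - p 0 * sin w - x 0) + (cos w - 1) * (x 0 * sin w + p 0 * cos w - p 0) by ring.
  by rewrite e1 e2 !subrr !mulr0 addr0.
move=> t; have ut : u t = 0 by rewrite (du t 0) u0.
have vt : v t = 0 by rewrite (dv t 0) v0.
have ct : cos (w * t) ^+ 2 + sin (w * t) ^+ 2 = 1 by exact: cos2Dsin2.
split.
- rewrite -[x t]mulr1 -ct.
  have -> : x t * (cos (w * t) ^+ 2 + sin (w * t) ^+ 2) = u t * cos (w * t) + v t * sin (w * t).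
    by rewrite /u /v; ring.
  by rewrite ut vt !mul0r addr0.
- rewrite -[p t]mulr1 -ct.
  have -> : p t * (cos (w * t) ^+ 2 + sin (w * t) ^+ 2) = v t * cos (w * t) - u t * sin (w * t).
    by rewrite /u /v; ring.
  by rewrite ut vt !mul0r subr0.
Qed.

End HarmonicOscillator.

Section Ellipsoid.
Variables (R : realType) (m : nat) (om : 'I_m -> R) (w Om : R).
Hypothesis w0 : 0 < w.
Hypothesis om_itv : forall l, w <= om l <= Om.
Local Notation V := 'rV[R]_m.

Definition ellq (z : V) : R := \sum_l om l * z 0 l ^+ 2.
Definition dellq (z : V) : V := \row_l (2 * om l * z 0 l).

Let om0 l : 0 <= om l.
Proof. by have /andP[h _] := om_itv l; apply: le_trans h; exact: ltW. Qed.

Lemma has_grad_ellq : has_grad ellq dellq.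
Proof.
move=> z v t; apply: (@is_derive_quadratic _ _ _ t (\sum_l om l * v 0 l ^+ 2)) => s.
rewrite /ellq /dotv -sumrB [(s - t) *: _]mulr_sumr -sumrB mulr_suml.
rewrite le_eqVlt; apply/orP; left; apply/eqP.
rewrite (eq_bigr (fun l => om l * v 0 l ^+ 2 * (s - t) ^+ 2)); last first.
  by move=> l _; rewrite !mxE; ring.
by rewrite ger0_norm // sumr_ge0 // => l _; rewrite mulr_ge0 ?sqr_ge0 // mulr_ge0 ?sqr_ge0.
Qed.

Lemma dellqB v z : dellq (v - z) = dellq v - dellq z.
Proof. by apply/rowP => l; rewrite !mxE mulrBr. Qed.

Lemma dellqZ a z : dellq (a *: z) = a *: dellq z.
Proof. by apply/rowP => l; rewrite !mxE; ring. Qed.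

Lemma dotv_dellq z : dotv (dellq z) z = 2 * ellq z.
Proof. by rewrite /ellq mulr_sumr; apply: eq_bigr => l _; rewrite mxE; ring. Qed.

Lemma dellq_norm (l0 : 'I_m) z : `|dellq z| <= 2 * Om * `|z|.
Proof.
have Om0 : 0 <= Om by have /andP[_] := om_itv l0; apply: le_trans.
apply: mx_norm_le => [|a l]; first by rewrite !mulr_ge0.
rewrite mxE normrM ger0_norm ?mulr_ge0 //; apply: ler_pM; rewrite ?mulr_ge0 //.
  by have /andP[_ h] := om_itv l; rewrite ler_pM2l.
exact: mx_coord_le.
Qed.

Lemma ellq_ge z : w * dotv z z <= ellq z.
Proof.
rewrite /dotv mulr_sumr; apply: ler_sum => l _; rewrite -expr2 ler_wpM2r ?sqr_ge0 //.
by have /andP[] := om_itv l.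
Qed.

Lemma ellq_norm z : w * `|z| ^+ 2 <= ellq z.
Proof.
by apply: le_trans (ellq_ge z); apply: ler_wpM2l; [exact: ltW|exact: norm_sq_le_dotv].
Qed.

Variable eta : R.
Hypothesis eta0 : 0 < eta.
Let rad : R := 1 + (1 + eta) / w.

Lemma ellq_bounded z : ellq z <= 1 + eta -> `|z| <= rad.
Proof.
move=> qz; have : `|z| ^+ 2 <= (1 + eta) / w.
  by rewrite ler_pdivlMr // mulrC; exact: le_trans (ellq_norm z) qz.
by rewrite /rad; move: (_ / w) `|z| => x t; nra.
Qed.

Variable l0 : 'I_m.
Let Om0 : 0 <= Om. Proof. by have /andP[_] := om_itv l0; apply: le_trans. Qed.
Let rad0 : 0 <= rad. Proof. by rewrite addr_ge0 // divr_ge0 ?addr_ge0 // ltW. Qed.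

(** [dellq] is unbounded, but its multiplier is 1 once [ellq >= 1 + eta]; a variation of the
    multiplier can thus always be charged to [dellq] at a point of the bounded region. *)
Lemma dhuber_ellq_lip : exists2 K : R, 0 <= K & forall v z,
  `|dhuber eta (ellq v - 1) *: dellq v - dhuber eta (ellq z - 1) *: dellq z| <= K * `|v - z|.
Proof.
pose Z := 1 + m%:R * (2 * Om * (rad + 1)) / eta.
have Z1 : 0 <= m%:R * (2 * Om * (rad + 1)) / eta.
  apply: divr_ge0; last exact: ltW.
  by apply: mulr_ge0 => //; apply: mulr_ge0; [exact: mulr_ge0|exact: addr_ge0].
have Z0 : 0 <= Z by exact: addr_ge0.
have rO : 0 <= 2 * Om * rad by apply: mulr_ge0 => //; exact: mulr_ge0.
pose KK : R := 2 * Om + Z * (2 * Om * rad).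
exists KK; first by rewrite addr_ge0 ?mulr_ge0.
have main v z : ellq z <= 1 + eta ->
  `|dhuber eta (ellq v - 1) *: dellq v - dhuber eta (ellq z - 1) *: dellq z| <=
   (2 * Om + Z * (2 * Om * rad)) * `|v - z|.
  move=> qz; have zr := ellq_bounded qz.
  have /andP[d0 d1] := dhuber_itv eta0 (ellq v - 1).
  have /andP[d2 d3] := dhuber_itv eta0 (ellq z - 1).
  have -> : dhuber eta (ellq v - 1) *: dellq v - dhuber eta (ellq z - 1) *: dellq z =
     dhuber eta (ellq v - 1) *: dellq (v - z) + (dhuber eta (ellq v - 1) - dhuber eta (ellq z - 1)) *: dellq z.
    by rewrite dellqB scalerBr scalerBl addrA subrK.
  apply: le_trans (ler_normD _ _) _; rewrite mulrDl; apply: lerD.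
    rewrite normrZ ger0_norm //; apply: le_trans (_ : `|dellq (v - z)| <= _).
      by rewrite ler_piMl.
    exact: dellq_norm.
  rewrite normrZ mulrAC; apply: ler_pM => //; last first.
    by apply: le_trans (dellq_norm l0 z) _; rewrite ler_wpM2l // mulr_ge0.
  (* Far apart, the multiplier varies by at most 1; close together, the segment stays within
     [rad + 1] of the origin and the mean value theorem applies. *)
  have [big|small] := leP 1 `|v - z|.
    apply: (@le_trans _ _ 1); first by rewrite ler_norml; apply/andP; split; lra.
    by apply: le_trans big _; rewrite ler_peMl // lerDl.
  apply: le_trans (dhuber_lip eta0 _ _) _.
  rewrite /Z mulrDl mul1r; apply: (@le_trans _ _ (m%:R * (2 * Om * (rad + 1)) / eta * `|v - z|)); last by rewrite lerDr.
  rewrite mulrAC ler_pM2r ?invr_gt0 //.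
  have -> : ellq v - 1 - (ellq z - 1) = ellq v - ellq z by ring.
  have [t /andP[t0 t1]] := has_grad_mvt z (v - z) has_grad_ellq.
  have -> : z + (v - z) = v by rewrite addrC subrK.
  move=> ->; apply: le_trans (dotv_le _ _) _; rewrite mulrA; apply: ler_wpM2r => //.
  apply: ler_wpM2l => //; apply: le_trans (dellq_norm l0 _) _.
  apply: ler_wpM2l; first exact: mulr_ge0.
  apply: le_trans (ler_normD _ _) _; apply: lerD => //.
  by rewrite normrZ ger0_norm // mulr_ile1 // ltW.
move=> v z; have [qz|qz] := leP (ellq z) (1 + eta); first exact: main.
have [qv|qv] := leP (ellq v) (1 + eta); first by rewrite distrC (distrC v); exact: main.
rewrite !dhuber_eq1 ?scale1r //; [|lra|lra].
rewrite -dellqB; apply: le_trans (dellq_norm l0 _) _; apply: ler_wpM2r => //.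
by rewrite lerDl mulr_ge0.
Qed.

(** The multiplier differs from 1 on a bounded set only, so the field is linear up to a bounded
    error. *)
Lemma dhuber_ellq_asymp z : `|dhuber eta (ellq z - 1) *: dellq z - dellq z| <= 2 * Om * rad.
Proof.
have [qz|qz] := leP (ellq z) (1 + eta); last first.
  by rewrite dhuber_eq1 ?scale1r ?subrr ?normr0 ?mulr_ge0 //; lra.
have /andP[d0 d1] := dhuber_itv eta0 (ellq z - 1).
rewrite -[X in _ - X]scale1r -scalerBl normrZ.
apply: (@le_trans _ _ `|dellq z|).
  by rewrite ler_piMl // ler_norml; apply/andP; split; lra.
apply: le_trans (dellq_norm l0 _) _; apply: ler_wpM2l; first by rewrite mulr_ge0.
exact: ellq_bounded.
Qed.

End Ellipsoid.

Lemma is_derive_along (R : realType) (m : nat) (f : 'rV[R]_m -> R) (df : 'rV[R]_m -> 'rV[R]_m)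
    (Lam K s : R) (gam : R -> 'rV[R]_m) (v : 'rV[R]_m) :
  0 <= Lam -> (forall z u, `|f (z + u) - f z - dotv (df z) u| <= Lam * dotv u u) ->
  (forall t, `|gam t - gam s - (t - s) *: v| <= K * (t - s) ^+ 2) ->
  is_derive s (1 : R) (fun t => f (gam t)) (dotv (df (gam s)) v).
Proof.
move=> Lam0 fq gq.
have K0 : 0 <= K.
  have := gq (s + 1); rewrite (addrAC s) subrr add0r expr1n mulr1; exact: le_trans.
apply: (@is_derive_quadratic_near _ _ _ _
  (m%:R * `|df (gam s)| * K + Lam * (m%:R * (`|v| + K) ^+ 2))) => t ts.
pose D := gam t - gam s.
have DE : gam t = gam s + D by rewrite addrC subrK.
have D1 : `|D| <= `|t - s| * (`|v| + K).
  rewrite -(subrK ((t - s) *: v) D); apply: le_trans (ler_normD _ _) _.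
  rewrite addrC mulrDr normrZ lerD2l; apply: le_trans (gq t) _.
  rewrite mulrC ler_wpM2r // -[(t - s) ^+ 2]real_normK ?num_real // expr2.
  by rewrite ler_piMl.
have -> : f (gam t) - f (gam s) - (t - s) *: dotv (df (gam s)) v =
  (f (gam s + D) - f (gam s) - dotv (df (gam s)) D) + dotv (df (gam s)) (D - (t - s) *: v).
  by rewrite -DE dotvDr dotvNr dotvZr /GRing.scale /=; ring.
apply: le_trans (ler_normD _ _) _; rewrite [leRHS]mulrDl addrC; apply: lerD.
  apply: le_trans (dotv_le _ _) _; rewrite -!mulrA; apply: ler_wpM2l => //.
  by apply: ler_wpM2l => //; exact: gq.
apply: le_trans (fq _ _) _; rewrite -mulrA; apply: ler_wpM2l => //.
apply: le_trans (ler_norm _) _; apply: le_trans (dotv_le _ _) _.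
rewrite -mulrA; apply: ler_wpM2l => //.
rewrite -[(t - s) ^+ 2]real_normK ?num_real // [leRHS]mulrC -exprMn expr2.
by apply: ler_pM.
Qed.

(** * A periodic orbit of period at most 1 *)

Section CapacityOfCylinder.
Variables (R : realType) (n : nat).
Local Notation V := 'rV[R]_(n + n).
Variables (G : V -> R) (dG : V -> V) (m theta B CG L r rho : R) (j : 'I_n) (v0 : V).
Hypothesis HG : has_grad G dG.
Hypothesis L0 : 0 <= L.
Hypothesis GL : forall v v', `|dG v - dG v'| <= L * `|v - v'|.
Hypothesis GC : forall v, `|dG v| <= CG.
Hypothesis G0m : forall v, 0 <= G v <= m.
Hypothesis theta1 : theta < 1.
Hypothesis Gsupp : forall z : V, G z != m ->
  (z 0 (lshift n j) ^+ 2 + z 0 (rshift n j) ^+ 2) / r ^+ 2 <= theta /\ `|z| <= B.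
Hypothesis rho0 : 0 < rho.
Hypothesis Gzero : forall z : V, (forall l, `|z 0 l - v0 0 l| < rho) -> G z = 0.
Hypothesis r0 : 0 < r.
Hypothesis mr : pi * r ^+ 2 < m.

Let c : R := pi * r ^+ 2.
Let c0 : 0 < c. Proof. by rewrite mulr_gt0 ?pi_gt0 // exprn_gt0. Qed.
Let mu : R := Num.min ((m + c) / 2) (3 / 2 * c).
Let mu_c : c < mu. Proof. by rewrite lt_min; have := c0; have := mr; rewrite -/c => ? ?; apply/andP; split; lra. Qed.
Let mu_m : mu < m.
Proof. by have := mr; rewrite -/c gt_min => ?; apply/orP; left; lra. Qed.
Let mu0 : 0 < mu. Proof. exact: lt_trans c0 mu_c. Qed.
Let mu_c2 : mu <= 3 / 2 * c. Proof. by rewrite ge_min lexx orbT. Qed.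
Let eta1 : R := m - mu.
Let eta10 : 0 < eta1. Proof. by rewrite subr_gt0. Qed.
(** Makes [mu * eta = eta1 / 2], so that [mu * (1 + eta / 2)] stays below [m - eta1 / 2], the value
    of [Hb] on the rim of the ellipsoid. *)
Let eta : R := eta1 / (2 * mu).
Let eta0 : 0 < eta. Proof. by rewrite divr_gt0 // mulr_gt0. Qed.
Let mu_eta : mu * eta = eta1 / 2.
Proof. by rewrite /eta; have := mu0; move: mu eta1 => a b a0; field; rewrite gt_eqF. Qed.
(** The first bound keeps [q < 1] wherever [G] differs from [m]. The second makes the frequency
    [2 * mu * w] of the planes other than the [j]-th at most [pi / 2], and leaves that of the [j]-th
    strictly between [2 * pi] and [4 * pi]. *)
Let w : R := Num.min ((1 - theta) / (2 * ((n + n)%:R * B ^+ 2 + 1))) (pi / (4 * mu)).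
Let nB : 0 < 2 * ((n + n)%:R * B ^+ 2 + 1).
Proof. by rewrite mulr_gt0 // ltr_wpDl // mulr_ge0 // sqr_ge0. Qed.
Let w0 : 0 < w.
Proof. by rewrite lt_min divr_gt0 ?subr_gt0 //= divr_gt0 ?pi_gt0 // mulr_gt0. Qed.
Let wB : w * ((n + n)%:R * B ^+ 2) <= (1 - theta) / 2.
Proof.
apply: (@le_trans _ _ (w * ((n + n)%:R * B ^+ 2 + 1))); first by rewrite ler_pM2l // lerDl.
have : w <= (1 - theta) / (2 * ((n + n)%:R * B ^+ 2 + 1)) by rewrite ge_min lexx.
rewrite ler_pdivlMr // [2 * _]mulrC mulrA => h; rewrite ler_pdivlMr //.
Qed.
Let wmu : mu * w <= pi / 4.
Proof.
have : w <= pi / (4 * mu) by rewrite ge_min lexx orbT.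
rewrite ler_pdivlMr ?mulr_gt0 // => h; rewrite ler_pdivlMr //; lra.
Qed.

Let isj (l : 'I_(n + n)) : bool := (l == lshift n j) || (l == rshift n j).
Let om (l : 'I_(n + n)) : R := w + (isj l)%:R / r ^+ 2.
Let Om : R := w + 1 / r ^+ 2.
Let om_itv l : w <= om l <= Om.
Proof.
have rr : 0 < (r ^+ 2)^-1 by rewrite invr_gt0 exprn_gt0.
rewrite /om /Om; case: (isj l); first by rewrite lexx mul1r andbT lerDl ltW.
by rewrite mul0r addr0 lexx mul1r lerDl ltW.
Qed.
Let q := ellq om.
Let dq := dellq om.
Let l0 : 'I_(n + n) := lshift n j.

Let qE (z : V) : q z = (z 0 (lshift n j) ^+ 2 + z 0 (rshift n j) ^+ 2) / r ^+ 2 + w * dotv z z.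
Proof.
have e l : om l * z 0 l ^+ 2 = (isj l)%:R / r ^+ 2 * z 0 l ^+ 2 + w * (z 0 l * z 0 l).
  by rewrite /om; ring.
rewrite /q /ellq (eq_bigr _ (fun l _ => e l)) big_split /= -mulr_sumr; congr (_ + _).
rewrite (bigD1 (lshift n j)) //= (bigD1 (rshift n j)) /=; last by rewrite eq_rlshift.
rewrite big1 ?addr0; last first.
  by move=> l /andP[/negbTE h1 /negbTE h2]; rewrite /isj h1 h2 !mul0r.
by rewrite /isj !eqxx orbT /=; ring.
Qed.

Let q_lt1 z : G z != m -> q z < 1.
Proof.
move=> /Gsupp [h1 h2]; rewrite qE.
have h3 : w * dotv z z <= (1 - theta) / 2.
  apply: le_trans wB; rewrite ler_pM2l //.
  apply: le_trans (ler_norm _) _; apply: le_trans (dotv_le _ _) _.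
  by rewrite ler_wpM2l // expr2 ler_pM.
by have := theta1; move: (_ / r ^+ 2) (w * _) h1 h3 => a b; lra.
Qed.

Let GQ := has_grad_quad HG L0 GL.
Let NL0 : 0 <= (n + n)%:R * L. Proof. exact: mulr_ge0. Qed.
Let dG_m z : G z = m -> dG z = 0.
Proof. by move=> Gz; apply: (grad_max NL0 GQ) => v; rewrite Gz; have /andP[] := G0m v. Qed.
Let dG_0 z : G z = 0 -> dG z = 0.
Proof. by move=> Gz; apply: (grad_min NL0 GQ) => v; rewrite Gz; have /andP[] := G0m v. Qed.
Let CG0 : 0 <= CG. Proof. exact: le_trans (normr_ge0 _) (GC 0). Qed.

(* The quadratic growth beyond the ellipsoid [q <= 1] has slope [mu > pi r^2],
   as linking requires, but [mu < 2 pi r^2], so that no 1-periodic orbit of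
   positive action lives there. *)
Let Hb (z : V) : R := huber eta1 (G z) + mu * huber eta (q z - 1).
Let dH (z : V) : V := dhuber eta1 (G z) *: dG z + mu *: (dhuber eta (q z - 1) *: dq z).

Let has_grad_Hb : has_grad Hb dH.
Proof.
apply: has_gradD; first exact: has_grad_comp (is_derive_huber eta10) HG.
apply: has_gradZ; apply: (@has_grad_comp _ _ (fun s => huber eta (s - 1)) (fun s => dhuber eta (s - 1))).
  move=> s; have h1 : is_derive s (1 : R) (fun s => s - 1) 1.
    have := is_deriveB (is_derive_id s (1 : R)) (is_derive_cst (1 : R) s 1).
    by rewrite subr0.
  have h2 := is_derive_huber eta0 (s - 1).
  exact: (is_derive_eq (@is_derive1_comp R (huber eta) (fun s => s - 1) _ _ _ h2 h1) (mulr1 _)).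
exact: has_grad_ellq w0 om_itv.
Qed.

Let dhuberG_lip : exists2 K : R, 0 <= K & forall v z,
  `|dhuber eta1 (G v) *: dG v - dhuber eta1 (G z) *: dG z| <= K * `|v - z|.
Proof.
pose K : R := L + (n + n)%:R * CG / eta1 * CG.
have N0 : 0 <= (n + n)%:R * CG by exact: mulr_ge0.
have K1 : 0 <= (n + n)%:R * CG / eta1 * CG.
  by apply: mulr_ge0 => //; apply: divr_ge0 => //; exact: ltW.
exists K; first exact: addr_ge0.
move=> v z; have /andP[d0 d1] := dhuber_itv eta10 (G v).
have -> : dhuber eta1 (G v) *: dG v - dhuber eta1 (G z) *: dG z =
   dhuber eta1 (G v) *: (dG v - dG z) + (dhuber eta1 (G v) - dhuber eta1 (G z)) *: dG z.
  by rewrite scalerBr scalerBl addrA subrK.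
apply: le_trans (ler_normD _ _) _; rewrite /K mulrDl; apply: lerD.
  rewrite normrZ ger0_norm //; apply: le_trans (GL _ _); rewrite ler_piMl //.
rewrite normrZ mulrAC; apply: ler_pM => //.
apply: le_trans (dhuber_lip eta10 _ _) _; rewrite mulrAC ler_pM2r ?invr_gt0 //.
exact: has_grad_lip HG GC _ _.
Qed.

Let dH_lip : exists2 K : R, 0 <= K & forall v z, `|dH v - dH z| <= K * `|v - z|.
Proof.
have [K1 K10 h1] := dhuberG_lip.
have [K2 K20 h2] := dhuber_ellq_lip w0 om_itv eta0 l0.
pose K : R := K1 + mu * K2.
exists K; first by rewrite addr_ge0 // mulr_ge0 // ltW.
move=> v z; rewrite /dH opprD addrACA -scalerBr.
apply: le_trans (ler_normD _ _) _; rewrite /K mulrDl; apply: lerD; first exact: h1.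
by rewrite normrZ gtr0_norm // -mulrA ler_pM2l //; exact: h2.
Qed.


Let isj_r i : isj (rshift n i) = (i == j).
Proof. by rewrite /isj eq_rlshift (inj_eq (@rshift_inj n n)). Qed.
Let isj_l i : isj (lshift n i) = (i == j).
Proof. by rewrite /isj eq_lrshift (inj_eq (@lshift_inj n n)) orbF. Qed.

Let nonres (gam : R -> V) K :
  (forall s t, `|gam t - gam s - (t - s) *: hamJ (mu *: dq (gam s))| <= K * (t - s) ^+ 2) ->
  (forall t, gam (t + 1) = gam t) -> forall t, gam t = 0.
Proof.
move=> hK per t.
have coord s l : is_derive s (1 : R) (fun t => gam t 0 l) (hamJ (mu *: dq (gam s)) 0 l).
  apply: (@is_derive_quadratic R _ _ s K) => t'; apply: le_trans (hK s t').
  by have := mx_coord_le (gam t' - gam s - (t' - s) *: hamJ (mu *: dq (gam s))) 0 l; rewrite !mxE.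
have osc i : gam t 0 (lshift n i) = 0 /\ gam t 0 (rshift n i) = 0.
  pose W := mu * (2 * om (rshift n i)).
  have h10 : gam 1 = gam 0 by rewrite -(per 0) add0r.
  have cW : cos W != 1.
    have r2 : 0 < r ^+ 2 by rewrite exprn_gt0.
    have pip := pi_gt0 R.
    have muw : 0 < mu * w by exact: mulr_gt0.
    apply: cos_neq1; rewrite /W /om isj_r; case: (i == j); rewrite ?mul0r ?addr0 ?mul1r.
    - have e : mu * (2 * (w + (r ^+ 2)^-1)) = 2 * (mu * w) + 2 * (mu / r ^+ 2) by ring.
      have h1 : pi < mu / r ^+ 2 by rewrite ltr_pdivlMr.
      have h2 : mu / r ^+ 2 <= 3 / 2 * pi.
        by rewrite ler_pdivrMr // -(mulrA (3 / 2)); exact: mu_c2.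
      by rewrite e; move: muw wmu h1 h2 pip; move: (mu * w) (mu / _) => a b; rewrite -/(_ <= _) => *; apply/andP; split; lra.
    - by move: muw wmu pip; rewrite mulrCA; move: (mu * w) => a; rewrite -/(_ <= _) => *; apply/andP; split; lra.
    - have h1 : pi < mu / r ^+ 2 by rewrite ltr_pdivlMr.
      have e : mu * (2 * (w + (r ^+ 2)^-1)) = 2 * (mu * w) + 2 * (mu / r ^+ 2) by ring.
      by rewrite gt_eqF // e; move: muw h1; move: (mu * w) (mu / _) => a b; lra.
    - by rewrite lt_eqF //; move: muw wmu pip; rewrite mulrCA; move: (mu * w) => a *; lra.
  apply: (oscillator_periodic cW (x := fun t => gam t 0 (lshift n i)) (p := fun t => gam t 0 (rshift n i))) => [s|s||].
  - by apply: (is_derive_eq (coord s (lshift n i))); rewrite hamJ_l !mxE /W; ring.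
  - apply: (is_derive_eq (coord s (rshift n i))); rewrite hamJ_r !mxE /W /om isj_l isj_r; ring.
  - by rewrite h10.
  - by rewrite h10.
by apply/rowP => l; rewrite mxE; have [i|i] := split_ordP l => ->; have [] := osc i.
Qed.

Let huber_continuous (e : R) : 0 < e -> continuous (huber e).
Proof.
move=> e0 s; apply: differentiable_continuous; apply/derivable1_diffP.
by have [] := is_derive_huber e0 s.
Qed.

Let Hb_continuous : continuous Hb.
Proof.
have Gc : continuous G.
  by apply: (@lip_continuous R V R G ((n + n)%:R * CG)) => [|v z]; [exact: mulr_ge0|exact: has_grad_lip HG GC _ _].
have qc : continuous q.
  apply: fct_sum_continuous => l; apply: fctM_continuous; first exact: fct_cst_continuous.
  by apply: fctM_continuous; exact: coord_continuous.
apply: fctD_continuous; first exact: fct_comp_continuous Gc (huber_continuous eta10).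
apply: fctM_continuous; first exact: fct_cst_continuous.
apply: fct_comp_continuous (huber_continuous eta0).
by apply: fctB_continuous => //; exact: fct_cst_continuous.
Qed.

Let Hb_inside z : q z <= 1 -> Hb z = huber eta1 (G z).
Proof. by move=> qz; rewrite /Hb (@huber_eq0 _ eta) ?mulr0 ?addr0 // subr_le0. Qed.

Let dH_inside z : q z <= 1 -> dH z = dhuber eta1 (G z) *: dG z.
Proof. by move=> qz; rewrite /dH (@dhuber_eq0 _ eta) ?scale0r ?scaler0 ?addr0 // subr_le0. Qed.

Let m' : R := m - eta1 / 2.
Let huber_m : huber eta1 m = m'.
Proof. by rewrite huber_big // /eta1 gerBl ltW. Qed.
Let m'_gt : mu * (1 + eta / 2) < m'.
Proof.
rewrite mulrDr mulr1 mulrA mu_eta /m' /eta1; have := mu_m; lra.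
Qed.

(** Here [G] is at its maximum [m], so only the function of [q] contributes: the integrand is at
    most [mu * (1 + eta / 2) - m'], by [dhuber_huber]. *)
Let action_outside z : 1 <= q z -> 2^-1 * dotv (dH z) z - Hb z < 0.
Proof.
move=> qz; have Gz : G z = m.
  by apply: contraTeq qz => /q_lt1; rewrite ltNge.
rewrite /dH /Hb dG_m // scaler0 add0r Gz huber_m dotvZl dotvZl dotv_dellq -/q.
have := dhuber_huber eta0 (q z - 1); have /andP[_ ] := dhuber_itv eta0 (q z - 1).
set d := dhuber _ _; set u := huber _ _ => h1 h2.
have -> : 2^-1 * (mu * (d * (2 * q z))) - (m' + mu * u) = mu * ((q z - 1) * d - u) + mu * d - m' by field.
rewrite subr_lt0; apply: le_lt_trans m'_gt.
by rewrite [leRHS]mulrDr mulr1 addrC; apply: lerD; rewrite ?ler_pM2l // ger_pMr.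
Qed.

Let Hb_le z : q z <= 1 -> Hb z <= m'.
Proof.
move=> qz; rewrite Hb_inside // -huber_m; apply: huber_le => //.
by have /andP[] := G0m z.
Qed.

Let Hb_outside z : 1 < q z -> m' < Hb z.
Proof.
move=> qz; have Gz : G z = m.
  by apply: contraTeq qz => /q_lt1; rewrite -leNgt => /ltW.
by rewrite /Hb Gz huber_m ltrDl mulr_gt0 // huber_gt0 // subr_gt0.
Qed.

(** The purpose of composing [G] with [huber]: at a zero of [G] both factors of the gradient,
    [dhuber] of [G] and [dG], vanish, so the local Lipschitz constant of their product is
    arbitrarily small. *)
Let flat_zero z : G z = 0 -> q z < 1 -> flat_at dH z.
Proof.
move=> Gz qz e e0.
have qc : continuous q.
  apply: fct_sum_continuous => l; apply: fctM_continuous; first exact: fct_cst_continuous.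
  by apply: fctM_continuous; exact: coord_continuous.
have [d1 d10 hd1] : exists2 d : R, 0 < d & forall v, `|v - z| < d -> q v < 1.
  have /nbhs_normP [d /= d0 hd] : nbhs z [set v | q v < 1] := qc z _ (lt_nbhsl qz).
  by exists d => // v hv; apply: hd; rewrite /= distrC.
pose N : R := (n + n)%:R.
pose Q := 2 * (N * CG * L) / eta1 + 1.
have NCL : 0 <= N * CG * L by apply: mulr_ge0 => //; apply: mulr_ge0.
have Q0 : 0 < Q by rewrite ltr_wpDl // divr_ge0 ?(ltW eta10) // mulr_ge0.
exists (Num.min d1 (e / Q)); first by rewrite lt_min d10 divr_gt0.
move=> v v'; rewrite !lt_min => /andP[v1 v2] /andP[v1' v2'].
rewrite (dH_inside (ltW (hd1 _ v1))) (dH_inside (ltW (hd1 _ v1'))).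
have -> : dhuber eta1 (G v) *: dG v - dhuber eta1 (G v') *: dG v' =
   dhuber eta1 (G v) *: (dG v - dG v') + (dhuber eta1 (G v) - dhuber eta1 (G v')) *: dG v'.
  by rewrite scalerBr scalerBl addrA subrK.
apply: le_trans (ler_normD _ _) _; rewrite normrZ [X in _ + X]normrZ.
have /andP[d0 _] := dhuber_itv eta10 (G v).
have G0 : 0 <= G v by have /andP[] := G0m v.
have s1 : dhuber eta1 (G v) * `|dG v - dG v'| <= N * CG * (e / Q) / eta1 * (L * `|v - v'|).
  apply: ler_pM => //; apply: le_trans (dhuber_le eta10 G0) _; rewrite ler_pM2r ?invr_gt0 //.
  rewrite -[G v]subr0 -Gz; apply: le_trans (ler_norm _) _; apply: le_trans (has_grad_lip HG GC _ _) _.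
  by apply: ler_wpM2l; [exact: mulr_ge0|exact: ltW].
have s2 : `|dhuber eta1 (G v) - dhuber eta1 (G v')| * `|dG v'| <=
    N * CG * `|v - v'| / eta1 * (L * (e / Q)).
  apply: ler_pM => //.
    apply: le_trans (dhuber_lip eta10 _ _) _; rewrite ler_pM2r ?invr_gt0 //.
    exact: has_grad_lip HG GC _ _.
  rewrite -[dG v']subr0 -(dG_0 Gz); apply: le_trans (GL _ _) _.
  by apply: ler_wpM2l => //; exact: ltW.
rewrite (ger0_norm d0); apply: le_trans (lerD s1 s2) _.
have -> : N * CG * (e / Q) / eta1 * (L * `|v - v'|) + N * CG * `|v - v'| / eta1 * (L * (e / Q)) =
   (2 * (N * CG * L) / eta1) * (e / Q * `|v - v'|) by ring.
have eQ : 0 <= e / Q * `|v - v'| by apply: mulr_ge0 => //; apply: divr_ge0; exact: ltW.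
apply: (@le_trans _ _ (Q * (e / Q * `|v - v'|))); first by rewrite ler_wpM2r // /Q lerDl.
by rewrite mulrA mulrCA divff ?mulr1 // gt_eqF.
Qed.

Theorem fast_periodic_orbit : exists (y : R -> V) (T : R),
  [/\ 0 < T <= 1,
      exists K, forall s t, `|y t - y s - (t - s) *: hamJ (dG (y s))| <= K * (t - s) ^+ 2,
      forall t, y (t + T) = y t & exists t s, y t <> y s].
Proof.
have [KH KH0 dHL] := dH_lip.
have HQ := has_grad_quad has_grad_Hb KH0 dHL.
have Lam0 : 0 <= (n + n)%:R * KH by exact: mulr_ge0.
have Om0 : 0 <= Om by have /andP[h1 h2] := om_itv l0; apply: le_trans h2; apply: le_trans h1; exact: ltW.
have LA0 : 0 <= mu * (2 * Om) by apply: mulr_ge0; [exact: ltW|exact: mulr_ge0].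
have [gam [[K hK] per [t0 ht0] nonflat]] := @periodic_orbit_exists R n Hb dH (fun z => mu *: dq z)
  ((n + n)%:R * KH) KH (mu * (2 * Om)) (CG + mu * (2 * Om * (1 + (1 + eta) / w)))
  r mu w (mu * (1 + eta / 2)) rho j v0 Lam0 HQ KH0 dHL LA0
  (fun v v' => ltac:(by rewrite -scalerBr -dellqB normrZ gtr0_norm // -mulrA ler_pM2l //; exact: (dellq_norm w0 om_itv l0)))
  (fun a v => ltac:(by rewrite /dq dellqZ !scalerA mulrC))
  (fun z => ltac:(rewrite /dH -addrA -scalerBr; apply: le_trans (ler_normD _ _) (lerD _ _);
     [rewrite normrZ; have /andP[d0 d1] := dhuber_itv eta10 (G z); rewrite ger0_norm //;
      apply: le_trans (GC z); rewrite ler_piMl //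
     |rewrite normrZ gtr0_norm // ler_pM2l //; exact: (dhuber_ellq_asymp w0 om_itv eta0 l0)]))
  nonres Hb_continuous r0 w0 rho0 mu_c
  (fun z => ltac:(rewrite /Hb addr_ge0 ?huber_ge0 // mulr_ge0 ?huber_ge0 // ltW //))
  (fun z => ltac:(rewrite -qE /Hb -mulrBr;
     apply: (@le_trans _ _ (mu * huber eta (q z - 1))); [rewrite ler_pM2l //; apply: le_trans (huber_ge eta0 _);
       rewrite opprD addrA // | rewrite lerDr huber_ge0 //]))
  (fun z hz => ltac:(rewrite Hb_inside ?(Gzero hz) ?huber_eq0 //; apply/ltW/q_lt1; rewrite Gzero // lt_eqF //;
    exact: lt_trans c0 mr)).
have cons t s : Hb (gam t) = Hb (gam s).
  apply: (@is_derive_0_is_cst R (fun t => Hb (gam t))) => u.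
  by apply: (is_derive_eq (is_derive_along Lam0 HQ (hK u))); exact: dotv_hamJ.
(* The point with nonnegative integrand lies in [q < 1]; conservation of [Hb] then keeps the whole
   orbit in [q <= 1], where [Hb] depends on [G] alone. *)
have q0 : q (gam t0) < 1 by rewrite ltNge; apply/negP => /action_outside; rewrite ltNge ht0.
have q1 t : q (gam t) <= 1.
  rewrite leNgt; apply/negP => /Hb_outside; rewrite (cons t t0) ltNge => /negP; apply.
  exact/Hb_le/ltW.
have consG t : huber eta1 (G (gam t)) = huber eta1 (G (gam t0)) by rewrite -!Hb_inside //; exact: cons.
have Gge t : 0 <= G (gam t) by have /andP[] := G0m (gam t).
have hK' s t : `|gam t - gam s - (t - s) *: (dhuber eta1 (G (gam s)) *: hamJ (dG (gam s)))| <= K * (t - s) ^+ 2.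
  by rewrite -hamJZ -dH_inside //; exact: hK.
have gam_const : (forall t, dH (gam t) = 0) -> forall t, gam t = gam t0.
  move=> dH0 t; apply/rowP => l.
  apply: (@is_derive_0_is_cst R (fun t => gam t 0 l)) => s.
  apply: (@is_derive_quadratic R _ _ s K) => u; apply: le_trans (hK s u).
  rewrite dH0 /hamJ mul0mx !scaler0 !subr0.
  by have := mx_coord_le (gam u - gam s) 0 l; rewrite !mxE.
(* If [G] vanished on the orbit, the orbit would be constant at a flat point, against [nonflat]. *)
have [G0|Gn0] := eqVneq (G (gam t0)) 0.
  exfalso; have Gt t : G (gam t) = 0.
    apply/eqP; rewrite eq_le Gge andbT leNgt; apply/negP => /(huber_gt0 eta10).
    by rewrite consG G0 huber_eq0 // ltxx.
  apply: (nonflat (gam t0)); first exact: flat_zero.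
  by apply: gam_const => t; rewrite dH_inside // Gt dhuber_eq0 // scale0r.
have Gpos : 0 < G (gam t0) by rewrite lt_def Gn0 Gge.
have Gt t : G (gam t) = G (gam t0).
  have Gp : 0 < G (gam t).
    rewrite lt_def Gge andbT; apply: contraTneq (huber_gt0 eta10 Gpos) => h.
    by rewrite -(consG t) h huber_eq0 // ltxx.
  apply/eqP; rewrite eq_le !leNgt; apply/andP; split; apply/negP => /huber_lt.
    by move=> /(_ _ eta10 Gpos); rewrite consG ltxx.
  by move=> /(_ _ eta10 Gp); rewrite consG ltxx.
(* By conservation this slope is constant along the orbit, which is therefore an orbit of [G] run at
   speed [kap]; rescaling time gives the period [kap <= 1]. *)
pose kap := dhuber eta1 (G (gam t0)).
have kap0 : 0 < kap by exact: dhuber_gt0.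
have kap1 : kap <= 1 by have /andP[] := dhuber_itv eta10 (G (gam t0)).
exists (fun t => gam (t / kap)), kap; split.
- by rewrite kap0 kap1.
- exists (K / kap ^+ 2) => s t.
  have := hK' (s / kap) (t / kap); rewrite Gt -/kap scalerA.
  have -> : (t / kap - s / kap) * kap = t - s by field; rewrite gt_eqF.
  have -> : K * (t / kap - s / kap) ^+ 2 = K / kap ^+ 2 * (t - s) ^+ 2 by field; rewrite gt_eqF.
  exact.
- by move=> t; rewrite mulrDl divff ?gt_eqF // per.
(* A constant orbit has [dH = 0], and its integrand at [t0] would be [- Hb < 0]. *)
apply: contrapT => nex.
have gconst t : gam t = gam t0.
  apply: contrapT => ne; apply: nex; exists (t * kap), (t0 * kap).
  by rewrite !mulfK ?gt_eqF.
have dH0 : dH (gam t0) = 0.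
  have hj : hamJ (dH (gam t0)) = 0.
    apply/rowP => l; rewrite [RHS]mxE.
    have h1 : is_derive t0 (1 : R) (fun t => gam t 0 l) (hamJ (dH (gam t0)) 0 l).
      apply: (@is_derive_quadratic R _ _ t0 K) => u; apply: le_trans (hK t0 u).
      by have := mx_coord_le (gam u - gam t0 - (u - t0) *: hamJ (dH (gam t0))) 0 l; rewrite !mxE.
    have h2 : is_derive t0 (1 : R) (fun t => gam t 0 l) 0.
      have -> : (fun t => gam t 0 l) = cst (gam t0 0 l) by apply/funext => t; rewrite gconst.
      exact: is_derive_cst.
    by have [_ <-] := h1; have [_ <-] := h2.
  apply/rowP => l; rewrite [RHS]mxE; have [i|i] := split_ordP l => ->.
    by have := hamJ_r (dH (gam t0)) i; rewrite hj mxE => /eqP; rewrite eq_sym oppr_eq0 => /eqP.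
  by have := hamJ_l (dH (gam t0)) i; rewrite hj mxE.
move: ht0; rewrite dH0 /dotv big1 ?mulr0 ?sub0r; last by move=> i _; rewrite mxE mul0r.
by rewrite oppr_ge0 Hb_inside // leNgt huber_gt0.
Qed.

End CapacityOfCylinder.

(** * Smooth functions *)

Section SmoothAlgebra.
Variables (R : realType) (V : normedModType R).

(** If the derivatives of the generators stay in the generated algebra, then all iterated
    derivatives of its members do, and smoothness reduces to differentiability of the generators. *)
Inductive fun_alg (S : (V -> R) -> Prop) : (V -> R) -> Prop :=
| fun_alg_gen f : S f -> fun_alg S f
| fun_alg_cst c : fun_alg S (fun _ => c)
| fun_algD f g : fun_alg S f -> fun_alg S g -> fun_alg S (fun x => f x + g x)
| fun_algM f g : fun_alg S f -> fun_alg S g -> fun_alg S (fun x => f x * g x).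

Variable S : (V -> R) -> Prop.
Hypothesis S_diff : forall f, S f -> forall x, differentiable f x.
Hypothesis S_derive : forall f v, S f -> fun_alg S (fun x => 'D_v f x).

Lemma fun_alg_differentiable f : fun_alg S f -> forall x, differentiable f x.
Proof.
elim=> [g /S_diff //|c x|g h _ dg _ dh x|g h _ dg _ dh x].
- exact: differentiable_cst.
- exact: differentiableD.
- exact: differentiableM.
Qed.

Lemma fun_alg_derive f v : fun_alg S f -> fun_alg S (fun x => 'D_v f x).
Proof.
elim=> [g Sg|c|g h Sg IHg Sh IHh|g h Sg IHg Sh IHh].
- exact: S_derive.
- have -> : (fun x : V => 'D_v (fun _ : V => c) x) = (fun _ => 0).
    by apply/funext => x; exact: derive_cst.
  exact: fun_alg_cst.
- have -> : (fun x : V => 'D_v (fun x => g x + h x) x) = (fun x => 'D_v g x + 'D_v h x).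
    apply/funext => x; apply: deriveD; apply: diff_derivable; exact: fun_alg_differentiable.
  exact: fun_algD.
- have -> : (fun x : V => 'D_v (fun x => g x * h x) x) = (fun x => g x * 'D_v h x + h x * 'D_v g x).
    apply/funext => x; apply: deriveM; apply: diff_derivable; exact: fun_alg_differentiable.
  by apply: fun_algD; apply: fun_algM.
Qed.

Lemma fun_alg_smooth f : fun_alg S f -> smooth f.
Proof.
move=> Sf vs; apply: fun_alg_differentiable.
elim: vs => //= v vs IH; exact: fun_alg_derive.
Qed.

End SmoothAlgebra.

Section SmoothTheory.
Variables (R : realType) (V : normedModType R).

Lemma iterD_rcons (W : normedModType R) (f : V -> W) vs v :
  Defs.iterD (rcons vs v) f = Defs.iterD vs (fun x => 'D_v f x).
Proof. by elim: vs => //= u vs ->. Qed.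

Lemma smooth_derive (W : normedModType R) (f : V -> W) v : smooth f -> smooth (fun x => 'D_v f x).
Proof. by move=> sf vs x; rewrite -iterD_rcons. Qed.

Lemma smooth_differentiable (W : normedModType R) (f : V -> W) x : smooth f -> differentiable f x.
Proof. by move=> sf; exact: (sf [::]). Qed.

Let smooth_gen_derive (f : V -> R) v : smooth f -> fun_alg (@smooth R V R) (fun x => 'D_v f x).
Proof. by move=> sf; apply: fun_alg_gen; exact: smooth_derive. Qed.

Lemma smooth_alg (f : V -> R) : fun_alg (@smooth R V R) f -> smooth f.
Proof.
apply: fun_alg_smooth => [g sg x|g v sg]; first exact: smooth_differentiable.
exact: smooth_gen_derive.
Qed.

Lemma smooth_cst (c : R) : smooth (fun _ : V => c).
Proof. by apply: smooth_alg; exact: fun_alg_cst. Qed.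

Lemma smoothD (f g : V -> R) : smooth f -> smooth g -> smooth (fun x => f x + g x).
Proof. by move=> sf sg; apply: smooth_alg; apply: fun_algD; exact: fun_alg_gen. Qed.

Lemma smoothM (f g : V -> R) : smooth f -> smooth g -> smooth (fun x => f x * g x).
Proof. by move=> sf sg; apply: smooth_alg; apply: fun_algM; exact: fun_alg_gen. Qed.

Lemma smooth_sum (I : Type) (r : seq I) (P : pred I) (f : I -> V -> R) :
  (forall i, smooth (f i)) -> smooth (fun x => \sum_(i <- r | P i) f i x).
Proof.
move=> sf; elim: r => [|i r IH].
  by under eq_fun do rewrite big_nil; exact: smooth_cst.
under eq_fun do rewrite big_cons.
by case: (P i) => //; exact: smoothD.
Qed.

Lemma smoothX (f : V -> R) k : smooth f -> smooth (fun x => f x ^+ k).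
Proof.
move=> sf; elim: k => [|k IH]; first exact: smooth_cst.
by under eq_fun do rewrite exprS; exact: smoothM.
Qed.

End SmoothTheory.

Section SmoothComposition.
Variables (R : realType) (V : normedModType R).

(** By the chain rule, the algebra generated by the smooth functions and all [L (f x)] with [L]
    smooth is stable under differentiation. *)
Lemma smooth_comp1 (K : R -> R) (f : V -> R) : smooth K -> smooth f -> smooth (fun x => K (f x)).
Proof.
move=> sK sf.
pose S (g : V -> R) := smooth g \/ exists L : R -> R, smooth L /\ g = (fun x => L (f x)).
apply: (@fun_alg_smooth _ _ S); last by apply: fun_alg_gen; right; exists K.
- move=> g [sg x|[L [sL ->]] x]; first exact: smooth_differentiable.
  by apply: (differentiable_comp (g := L)); exact: smooth_differentiable.
- move=> g v [sg|[L [sL ->]]]; first by apply: fun_alg_gen; left; exact: smooth_derive.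
  have -> : (fun x => 'D_v (fun x => L (f x)) x) = (fun x => 'D_v f x * 'D_1 L (f x)).
    apply/funext => x; have df := smooth_differentiable x sf.
    have dL := smooth_differentiable (f x) sL.
    rewrite deriveE; last exact: (differentiable_comp (g := L)).
    rewrite (diff_comp df dL) /= -(deriveE v df).
    by rewrite -[X in 'd L _ X]mulr1 -/(GRing.scale _ _) linearZ /= -deriveE.
  apply: fun_algM; apply: fun_alg_gen; first by left; exact: smooth_derive.
  by right; exists (fun y => 'D_1 L y); split=> //; exact: smooth_derive.
Qed.

Lemma derive_sum_delta (m : nat) (f : 'rV[R]_m -> R) z v : differentiable f z ->
  'D_v f z = \sum_k v 0 k * 'D_(delta_mx 0 k) f z.
Proof.
move=> df; rewrite deriveE // {1}(row_sum_delta v) linear_sum; apply: eq_bigr => k _.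
by rewrite linearZ -deriveE.
Qed.

Lemma smooth_coord (m : nat) (f : V -> 'rV[R]_m) k : smooth f -> smooth (fun x => f x 0 k).
Proof.
move=> sf vs x.
have -> : Defs.iterD vs (fun x => f x 0 k) = (fun x => Defs.iterD vs f x 0 k).
  elim: vs => //= v vs ->; apply/funext => y.
  by rewrite (derive_mx (@diff_derivable _ _ _ _ _ v (sf vs y))) mxE.
exact: (differentiable_comp (sf vs x) (differentiable_coord _ _ _)).
Qed.

Lemma smooth_rV (m : nat) (f : V -> 'rV[R]_m) :
  (forall k, smooth (fun x => f x 0 k)) -> smooth f.
Proof.
move=> sf vs x.
have [h1 h2] : (forall y k, Defs.iterD vs f y 0 k = Defs.iterD vs (fun x => f x 0 k) y) /\
    forall y, differentiable (Defs.iterD vs f) y.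
  have rdiff (F : V -> 'rV[R]_m) : (forall k y, differentiable (fun x => F x 0 k) y) ->
      forall y, differentiable F y.
    move=> dF y; have -> : F = (fun x => \sum_k F x 0 k *: delta_mx 0 k).
      by apply/funext => z; exact: row_sum_delta.
    have -> : (fun x => \sum_k F x 0 k *: delta_mx 0 k) =
       \sum_k (fun x => F x 0 k *: (delta_mx 0 k : 'rV[R]_m)).
      by apply/funext => z; rewrite fct_sumE.
    by apply: differentiable_sum => k; apply: differentiableZl.
  elim: vs => [|v vs [IH dIH]] /=.
    by split=> // y; apply: rdiff => k z; exact: (sf k [::]).
  have e y k : 'D_v (Defs.iterD vs f) y 0 k = 'D_v (Defs.iterD vs (fun x => f x 0 k)) y.
    rewrite (derive_mx (@diff_derivable _ _ _ _ _ v (dIH y))) mxE; congr ('D_v _ y).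
    by apply/funext => z; exact: IH.
  split=> // y; apply: rdiff => k z.
  have -> : (fun x => 'D_v (Defs.iterD vs f) x 0 k) = Defs.iterD (v :: vs) (fun x => f x 0 k).
    by apply/funext => u; rewrite e.
  exact: sf.
exact: h2.
Qed.

Lemma smooth_comp (m : nat) (K : 'rV[R]_m -> R) (f : V -> 'rV[R]_m) :
  smooth K -> smooth f -> smooth (fun x => K (f x)).
Proof.
move=> sK sf.
pose S (g : V -> R) := smooth g \/ exists L : 'rV[R]_m -> R, smooth L /\ g = (fun x => L (f x)).
apply: (@fun_alg_smooth _ _ S); last by apply: fun_alg_gen; right; exists K.
- move=> g [sg x|[L [sL ->]] x]; first exact: smooth_differentiable.
  by apply: (differentiable_comp (g := L)); exact: smooth_differentiable.
- move=> g v [sg|[L [sL ->]]]; first by apply: fun_alg_gen; left; exact: smooth_derive.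
  have -> : (fun x => 'D_v (fun x => L (f x)) x) =
      (fun x => \sum_k 'D_v f x 0 k * 'D_(delta_mx 0 k) L (f x)).
    apply/funext => x; have df := smooth_differentiable x sf.
    have dL := smooth_differentiable (f x) sL.
    rewrite deriveE; last exact: (differentiable_comp (g := L)).
    rewrite (diff_comp df dL) /= -(deriveE v df) -deriveE //.
    exact: derive_sum_delta.
  elim: (index_enum _) => [|k r IH].
    by under eq_fun do rewrite big_nil; exact: fun_alg_cst.
  under eq_fun do rewrite big_cons.
  apply: fun_algD IH; apply: fun_algM; apply: fun_alg_gen.
    by left; exact: (smooth_coord k (smooth_derive v sf)).
  by right; exists (fun y => 'D_(delta_mx 0 k) L y); split=> //; exact: smooth_derive.
Qed.

End SmoothComposition.

Lemma smooth_comp_rV (R : realType) (V : normedModType R) (m p : nat) (K : 'rV[R]_m -> 'rV[R]_p) (f : V -> 'rV[R]_m) :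
  smooth K -> smooth f -> smooth (fun x => K (f x)).
Proof.
move=> sK sf; apply: smooth_rV => k.
exact: (smooth_comp (smooth_coord k sK) sf).
Qed.

Section SmoothLinear.
Variables (R : realType) (m : nat).
Local Notation V := 'rV[R]_m.

Lemma smooth_coordinate (k : 'I_m) : smooth (fun z : V => z 0 k).
Proof.
apply: (@fun_alg_smooth _ _ (fun f => f = (fun z : V => z 0 k))); last exact: fun_alg_gen.
- by move=> f -> x; exact: differentiable_coord.
- move=> f v ->; have -> : (fun x => 'D_v (fun z : V => z 0 k) x) = (fun _ => v 0 k).
    apply/funext => x; have := congr1 (fun M : V => M 0 k) (derive_mx (@derivable_id R V x v)).
    by rewrite derive_id mxE => ->.
  exact: fun_alg_cst.
Qed.

Lemma smooth_mulmx (p : nat) (A : 'M[R]_(m, p)) : smooth (fun z : V => z *m A).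
Proof.
apply: smooth_rV => k; under eq_fun do rewrite mxE.
apply: smooth_sum => i; apply: smoothM; [exact: smooth_coordinate|exact: smooth_cst].
Qed.

Lemma smooth_has_grad (f : V -> R) : smooth f -> has_grad f (grad f).
Proof.
move=> sf z v t; have df := smooth_differentiable (z + t *: v) sf.
have -> : dotv (grad f (z + t *: v)) v = 'D_v f (z + t *: v).
  by rewrite derive_sum_delta // /dotv; apply: eq_bigr => k _; rewrite mxE mulrC.
have e (h : R) : f (z + (h + t) *: v) = f (h *: v + (z + t *: v)).
  by rewrite scalerDl addrCA.
have dv := derivableP (@diff_derivable _ _ _ _ _ v df).
have E : (fun h : R => h^-1 *: (((fun s : R => f (z + s *: v)) \o shift t) (h *: (1 : R)) - f (z + t *: v))) =
   (fun h : R => h^-1 *: ((f \o shift (z + t *: v)) (h *: v) - f (z + t *: v))).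
  by apply/funext => h /=; rewrite [h *: 1]mulr1 e.
have [d1 d2] := dv.
by apply: DeriveDef; [rewrite /derivable E|rewrite /derive E].
Qed.

End SmoothLinear.

(** * The Hofer-Zehnder capacity is at most c_max *)

Section CompactSupport.
Variables (R : realType) (m : nat).
Local Notation V := 'rV[R]_m.

Lemma compact_sup (f : V -> R) (K : set V) : compact K -> continuous f ->
  exists2 C : R, 0 <= C & forall z, K z -> `|f z| <= C.
Proof.
move=> cK fc; have [K0|K0] := eqVneq K set0.
  by exists 0 => // z; rewrite K0.
have nc : {within K, continuous (fun z => `|f z|)}.
  by apply: continuous_subspaceT; exact: fct_norm_continuous.
have [c _ hc] := @EVT_max_rV R m (fun z => `|f z|) K (proj1 (set0P _) K0) cK nc.
by exists `|f c| => // z Kz; apply: hc; rewrite inE.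
Qed.

Lemma derive_off_compact (f : V -> R) (K : set V) v : compact K ->
  (forall z, ~ K z -> f z = 0) -> forall z, ~ K z -> 'D_v f z = 0.
Proof.
move=> cK f0 z Kz; rewrite -(derive_cst (0 : R) z v); apply: near_eq_derive.
have : nbhs z (~` K).
  apply: open_nbhs_nbhs; split=> //; apply: closed_openC.
  by apply: compact_closed cK; exact: norm_hausdorff.
by apply: filterS => y; exact: f0.
Qed.

Lemma smooth_compact_grad_bounded (f : V -> R) (K : set V) : smooth f -> compact K ->
  (forall z, ~ K z -> f z = 0) -> exists2 C : R, 0 <= C & forall z, `|grad f z| <= C.
Proof.
move=> sf cK f0.
have hk k : exists C : R, 0 <= C /\ forall z, `|'D_(delta_mx 0 k) f z| <= C.
  have sD := smooth_derive (delta_mx 0 k : V) sf.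
  have [C C0 hC] := compact_sup cK (fun z => differentiable_continuous (smooth_differentiable z sD)).
  exists C; split=> // z; have [Kz|nKz] := pselect (K z); first exact: hC.
  by rewrite (derive_off_compact _ cK f0) // normr0.
pose C := \sum_k projT1 (cid (hk k)).
have C0 k : 0 <= projT1 (cid (hk k)) by case: (cid (hk k)) => x [].
exists C; first by apply: sumr_ge0.
move=> z; apply: mx_norm_le => [|a k]; first exact: sumr_ge0.
rewrite mxE; apply: (@le_trans _ _ (projT1 (cid (hk k)))); first by case: (cid (hk k)) => x [].
by rewrite /C (bigD1 k) // lerDl; apply: sumr_ge0 => k0 _; exact: C0.
Qed.

Lemma smooth_compact_grad_lip (f : V -> R) (K : set V) : smooth f -> compact K ->
  (forall z, ~ K z -> f z = 0) ->
  exists2 L : R, 0 <= L & forall z y, `|grad f z - grad f y| <= L * `|z - y|.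
Proof.
move=> sf cK f0.
have hk k : exists L : R, 0 <= L /\
    forall z y, `|'D_(delta_mx 0 k) f z - 'D_(delta_mx 0 k) f y| <= L * `|z - y|.
  have sD := smooth_derive (delta_mx 0 k : V) sf.
  have [C C0 hC] := smooth_compact_grad_bounded sD cK (derive_off_compact _ cK f0).
  exists (m%:R * C); split; first exact: mulr_ge0.
  exact: has_grad_lip (smooth_has_grad sD) hC.
pose L := \sum_k projT1 (cid (hk k)).
have L0 k : 0 <= projT1 (cid (hk k)) by case: (cid (hk k)) => x [].
exists L; first by apply: sumr_ge0.
move=> z y; apply: mx_norm_le => [|a k]; first by apply: mulr_ge0 => //; apply: sumr_ge0 => k0 _.
rewrite !mxE; apply: (@le_trans _ _ (projT1 (cid (hk k)) * `|z - y|)); first by case: (cid (hk k)) => x [].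
by apply: ler_wpM2r => //; rewrite /L (bigD1 k) // lerDl; apply: sumr_ge0 => k0 _; exact: L0.
Qed.

End CompactSupport.

Section SymplecticTransport.
Variables (R : realType) (n : nat).
Local Notation V := 'rV[R]_(n + n).
Local Notation J := (Jmx R n).

Lemma Jmx_sq : J *m J = - 1%:M.
Proof.
rewrite scalar_mx_block opp_block_mx oppr0 /Jmx mulmx_block.
by rewrite !mul0mx !mulmx0 !mul1mx !mulmx1 !addr0 !add0r.
Qed.

Lemma Jmx_tr : J^T = - J.
Proof. by rewrite /Jmx tr_block_mx !trmx0 linearN /= !trmx1 opp_block_mx !oppr0 opprK. Qed.

(** The matrix [- (J *m A^T *m J)] is a right inverse of [A], hence also a left inverse, which
    rearranges to the transposed identity. *)
Lemma symplectic_tr (A : 'M[R]_(n + n)) : A *m J *m A^T = J -> A^T *m J *m A = J.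
Proof.
move=> h.
have h1 : A *m (- (J *m A^T *m J)) = 1%:M.
  by rewrite mulmxN -[J *m _ *m J]mulmxA !mulmxA h Jmx_sq opprK.
have h2 := mulmx1C h1.
have : J *m (- (J *m A^T *m J) *m A) = J by rewrite h2 mulmx1.
by rewrite mulNmx mulmxN !mulmxA Jmx_sq !mulNmx mul1mx opprK.
Qed.

Lemma symplectic_inv (A B : 'M[R]_(n + n)) : A *m J *m A^T = J -> A *m B = 1%:M ->
  B *m J *m B^T = J.
Proof.
move=> hA AB; have BA := mulmx1C AB.
rewrite -{1}hA !mulmxA BA mul1mx -mulmxA -trmx_mul BA trmx1 mulmx1 //.
Qed.

Lemma bilin_mx_eq (p : nat) (M N : 'M[R]_p) :
  (forall u v : 'rV[R]_p, (v *m M *m u^T) 0 0 = (v *m N *m u^T) 0 0) -> M = N.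
Proof.
move=> h; apply/matrixP => i k; have := h (delta_mx 0 k) (delta_mx 0 i).
by rewrite -!rowE trmx_delta -!colE !mxE.
Qed.

Lemma symplecto_jacobian (f : V -> V) (z : V) : differentiable f z ->
  (forall u v, sigma ('D_u f z) ('D_v f z) = sigma u v) ->
  jacobian f z *m J *m (jacobian f z)^T = J.
Proof.
move=> df hs; apply: bilin_mx_eq => u v.
have := hs u v; rewrite /sigma !deriveEjacobian // => <-.
by rewrite trmx_mul !mulmxA.
Qed.

Lemma grad_comp (H : V -> R) (g : V -> V) z : differentiable g z -> differentiable H (g z) ->
  grad (fun x => H (g x)) z = grad H (g z) *m (jacobian g z)^T.
Proof.
move=> dg dH; apply/rowP => i; rewrite !mxE.
rewrite deriveE; last exact: (differentiable_comp (g := H)).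
rewrite (diff_comp dg dH) /= -(deriveE _ dg) -deriveE // derive_sum_delta //.
apply: eq_bigr => k _; rewrite deriveEjacobian // -rowE !mxE mulrC //.
Qed.

Lemma derive_curve (g : V -> V) (y : R -> V) t dy : differentiable g (y t) ->
  is_derive t (1 : R) y dy -> is_derive t (1 : R) (fun s => g (y s)) (dy *m jacobian g (y t)).
Proof.
move=> dg [ey <-]; have dy' : differentiable y t by apply/derivable1_diffP.
have dgy : differentiable (fun s => g (y s)) t by exact: (differentiable_comp (g := g)).
apply: DeriveDef; first exact: diff_derivable.
rewrite deriveE // (diff_comp dy' dg) /= -(deriveE _ dy') -deriveE //.
exact: deriveEjacobian.
Qed.

End SymplecticTransport.

Section NonSqueezing.
Variables (R : realType) (n : nat).
Local Notation V := 'rV[R]_(n + n).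

Lemma hamvfE (H : V -> R) z : hamvf H z = hamJ (grad H z).
Proof. by []. Qed.

(** A point on the rim could be pushed outwards in the [j]-th plane by a factor [1 + s] inside the
    open set; when [r ^+ 2 = 0] there is nothing to scale and the point is moved along an axis. *)
Lemma cylinder_interior (j : 'I_n) (r : R) (A : set V) : open A -> A `<=` cylinder j r ->
  forall z, A z -> z 0 (lshift n j) ^+ 2 + z 0 (rshift n j) ^+ 2 < r ^+ 2.
Proof.
move=> oA Acyl z Az; rewrite lt_neqAle (Acyl z Az) andbT; apply/eqP => e.
have r2 : 0 <= r ^+ 2 by exact: sqr_ge0.
have [d d0 hd] := rV_near_ball (open_nbhs_nbhs (conj oA Az)).
have sub_r (i k : 'I_n) : (rshift n i == lshift n k) = false by rewrite eq_rlshift.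
pose M := `|z 0 (lshift n j)| + `|z 0 (rshift n j)| + 1.
have M0 : 0 < M by rewrite ltr_wpDl // addr_ge0.
pose s := d / (2 * M).
have s0 : 0 < s by rewrite divr_gt0 // mulr_gt0.
have [x0|xn0] := eqVneq (r ^+ 2) 0.
  pose y : V := \row_l (if l == lshift n j then d / 2 else z 0 l).
  have /Acyl : A y.
    apply: hd => k; rewrite mxE; case: eqP => [->|_]; last by rewrite subrr normr0.
    have : z 0 (lshift n j) ^+ 2 = 0.
      apply/eqP; rewrite eq_le sqr_ge0 andbT -x0 -e lerDl; exact: sqr_ge0.
    move=> /eqP; rewrite sqrf_eq0 => /eqP ->; rewrite subr0 gtr0_norm ?divr_gt0 //.
    by rewrite ltr_pdivrMr // ltr_pMr // ltr1n.
  rewrite /cylinder /= !mxE eqxx eq_rlshift x0; apply/negP; rewrite -ltNge.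
  by rewrite ltr_pwDl ?sqr_ge0 // exprn_gt0 // divr_gt0.
have rp : 0 < r ^+ 2 by rewrite lt_def xn0.
pose y : V := \row_l (if (l == lshift n j) || (l == rshift n j) then (1 + s) * z 0 l else z 0 l).
have /Acyl : A y.
  apply: hd => k; rewrite mxE; case: ifP => [hk|_]; last by rewrite subrr normr0.
  have -> : (1 + s) * z 0 k - z 0 k = s * z 0 k by ring.
  have zM : `|z 0 k| <= M.
    rewrite /M; have := normr_ge0 (z 0 (lshift n j)); have := normr_ge0 (z 0 (rshift n j)).
    by move: hk => /orP[]/eqP -> ? ?; lra.
  rewrite normrM gtr0_norm //; apply: (@le_lt_trans _ _ (s * M)); first by rewrite ler_pM2l.
  have -> : s * M = d / 2 by rewrite /s; field; rewrite gt_eqF.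
  by rewrite ltr_pdivrMr // ltr_pMr // ltr1n.
rewrite /cylinder /= !mxE !eqxx orbT /= !exprMn -mulrDr e; apply/negP; rewrite -ltNge.
rewrite ltr_pMl // expr_gt1 // ?ltrDl //.
by rewrite addr_ge0 // ltW.
Qed.

Lemma HZ_admissible_le (O : set V) (H : V -> R) (m r : R) (f : V -> V) (j : 'I_n) :
  HZ_admissible O H m -> 0 < r -> symplectomorphism f -> f @` O `<=` cylinder j r ->
  m <= pi * r ^+ 2.
Proof.
move=> [sH [K [cK KO HK]] [U [oU [z0 Uz0] UO HU]] Hm fast] r0 [g [fg gf sf sg hsig]] fO.
rewrite leNgt; apply/negP => mr.
have m0 : 0 < m by apply: lt_trans mr; rewrite mulr_gt0 ?pi_gt0 // exprn_gt0.
have fc : continuous f by move=> z; apply: differentiable_continuous; exact: smooth_differentiable.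
have gc : continuous g by move=> z; apply: differentiable_continuous; exact: smooth_differentiable.
pose F (z : V) := H (g z).
have sF : smooth F by exact: smooth_comp.
pose K' := f @` K.
have cK' : compact K' by apply: continuous_compact => //; exact: continuous_subspaceT.
have FK' z : ~ K' z -> F z = 0.
  by move=> nK; apply: HK => Kg; apply: nK; exists (g z).
have [CG CG0 hCG] := smooth_compact_grad_bounded sF cK' FK'.
have [L L0 hL] := smooth_compact_grad_lip sF cK' FK'.
(* [m - F] is 0 on the image of the plateau and [m] off the compact set [K'], as
   [fast_periodic_orbit] demands; it is written so as to fit [has_gradD] and [has_gradZ]. *)
pose G (z : V) := m + - 1 * F z.
pose dG (z : V) : V := 0 + (- 1) *: grad F z.
have HG : has_grad G dG.
  apply: has_gradD; last by apply: has_gradZ; exact: smooth_has_grad.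
  by move=> z v t; rewrite /dotv big1 => [|i _]; [exact: is_derive_cst|rewrite mxE mul0r].
have dGE z : dG z = - grad F z by rewrite /dG add0r scaleN1r.
have GL v v' : `|dG v - dG v'| <= L * `|v - v'|.
  by rewrite !dGE -opprD normrN; exact: hL.
have GC v : `|dG v| <= CG by rewrite dGE normrN.
have G0m v : 0 <= G v <= m.
  have [h1 h2] := Hm (g v); rewrite /G mulN1r -/(F v) subr_ge0 h2 /= gerBl //.
have oA : open (g @^-1` O°) by apply: open_comp => [x _|]; [exact: gc|exact: open_interior].
have Acyl : g @^-1` O° `<=` cylinder j r.
  by move=> z /= hz; apply: fO; exists (g z); [exact: interior_subset|exact: gf].
have hcyl := cylinder_interior oA Acyl.
have K'0 : K' !=set0.
  exists (f z0); exists z0 => //; apply: contrapT => /HK; rewrite HU //.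
  by move/eqP; rewrite gt_eqF.
pose qj (z : V) := z 0 (lshift n j) ^+ 2 + z 0 (rshift n j) ^+ 2.
have qjc : continuous qj.
  by apply: fctD_continuous; apply: fctM_continuous; exact: coord_continuous.
(* The support is compact inside the open image, so the maximum of [qj] on it is strictly below
   [r ^ 2]; this provides [theta]. *)
have [c cK'c hc] := EVT_max_rV K'0 cK' (continuous_subspaceT qjc).
rewrite inE in cK'c.
have cA : (g @^-1` O°) c by move: cK'c => [y Ky <-] /=; rewrite fg; exact: KO.
have r2 : 0 < r ^+ 2 by rewrite exprn_gt0.
have theta1 : qj c / r ^+ 2 < 1 by rewrite ltr_pdivrMr // mul1r; exact: hcyl.
have [B B0 hB] := compact_sup cK' (@norm_continuous _ V).
have Gsupp (z : V) : G z != m ->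
    (z 0 (lshift n j) ^+ 2 + z 0 (rshift n j) ^+ 2) / r ^+ 2 <= qj c / r ^+ 2 /\ `|z| <= B.
  move=> Gz; have Kz : K' z.
    apply: contrapT => /FK' Fz; move: Gz; rewrite /G Fz mulr0 addr0 eqxx //.
  split; first by rewrite ler_pM2r ?invr_gt0 //; apply: hc; rewrite inE.
  by have := hB z Kz; rewrite normr_id.
have [rho rho0 hrho] : exists2 rho : R, 0 < rho & forall z : V, (forall k, `|z 0 k - f z0 0 k| < rho) -> (g @^-1` U) z.
  apply: rV_near_ball; apply: open_nbhs_nbhs; split; last by rewrite /= fg.
  by apply: open_comp => [x _|//]; exact: gc.
have Gzero (z : V) : (forall l, `|z 0 l - f z0 0 l| < rho) -> G z = 0.
  by move=> /hrho Uz; rewrite /G /F HU // mulN1r subrr.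
have [y [T [/andP[T0 T1] [Ky hy] yper [t1 [s1 yne]]]]] :=
  fast_periodic_orbit HG L0 GL GC G0m theta1 Gsupp rho0 Gzero r0 mr.
(* Orbits of [m - F] are those of [F] run backwards, and [g] carries the latter to orbits of [H]. *)
pose zeta (t : R) := g (y (- t)).
have dy t : is_derive t (1 : R) y (hamJ (dG (y t))) by exact: is_derive_quadratic (hy t).
have dyN t : is_derive t (1 : R) (fun s => y (- s)) (hamJ (grad F (y (- t)))).
  apply: (@is_derive_quadratic R V _ t Ky) => s; apply: le_trans (_ : Ky * (- s - - t) ^+ 2 <= _).
    apply: le_trans (hy (- t) (- s)); rewrite dGE.
    have -> : (- s - - t) *: hamJ (- grad F (y (- t))) = (s - t) *: hamJ (grad F (y (- t))).
      by rewrite /hamJ mulNmx scalerN -scaleNr; congr (_ *: _); ring.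
    exact: lexx.
  by rewrite -[X in _ <= _ * X]sqrrN le_eqVlt; apply/orP; left; apply/eqP; ring.
have jacg z : (jacobian g z)^T *m (Jmx R n)^T *m jacobian g z = (Jmx R n)^T.
  have dfz := smooth_differentiable (g z) sf.
  have dgz : differentiable g (f (g z)) by exact: smooth_differentiable.
  have hf := symplecto_jacobian dfz (hsig (g z)).
  have fg1 : jacobian f (g z) *m jacobian g z = 1%:M.
    have h := diff_comp dfz dgz.
    have e : g \o f = id by apply/funext => x /=; rewrite fg.
    apply/row_matrixP => i; rewrite !rowE mulmxA mulmx1.
    rewrite -[delta_mx 0 i *m _](deriveEjacobian _ dfz) -{2}[z]gf -(deriveEjacobian _ dgz) (deriveE _ dgz) (deriveE _ dfz).
    by rewrite -[LHS]/(('d g (f (g z)) \o 'd f (g z)) _) -h e -deriveE // derive_id.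
  have hg := symplectic_tr (symplectic_inv hf fg1).
  by rewrite Jmx_tr mulmxN mulNmx hg.
have dzeta t : is_derive t (1 : R) zeta (hamvf H (zeta t)).
  have dgy : differentiable g (y (- t)) by exact: smooth_differentiable.
  apply: (is_derive_eq (derive_curve dgy (dyN t))).
  rewrite hamvfE /hamJ grad_comp //; last exact: smooth_differentiable.
  by rewrite -/(zeta t) -!mulmxA [_^T *m (_ *m _)]mulmxA jacg.
have perz : periodic_solution H zeta T.
  split=> [t|]; first by have [] := dzeta t.
  split=> [t|t]; first by rewrite derive1E; have [] := dzeta t.
  by rewrite /zeta -[in LHS]yper opprD subrK.
apply: yne; have := fast zeta T T0 T1 perz (- t1) (- s1).
by rewrite /zeta !opprK => /(can_inj gf).
Qed.

Theorem c_HZ_le_c_max (O : set V) : (c_HZ O <= c_max O)%E.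
Proof.
apply: ge_ereal_sup => _ [m [H adm] <-]; apply: le_ereal_inf_tmp => _ [r [r0 [f [j [sf fO]]]] <-].
by rewrite lee_fin; exact: HZ_admissible_le adm r0 sf fO.
Qed.

End NonSqueezing.

(** * Antiderivatives and cutoff functions *)

Section SmoothReal.
Variable R : realType.

Lemma derive1_line (f : R -> R) (x v d : R) : is_derive x (1 : R) f d ->
  differentiable f x /\ 'D_v f x = v * d.
Proof.
move=> [ef <-]; have df : differentiable f x by apply/derivable1_diffP.
by split=> //; rewrite !deriveE // -[X in 'd f x X]mulr1 -/(GRing.scale _ _) linearZ.
Qed.

Lemma smooth_of_derive (V : normedModType R) (f : V -> R) : (forall x, differentiable f x) ->
  (forall v, smooth (fun x => 'D_v f x)) -> smooth f.
Proof.
move=> df sf vs x; case: (lastP vs) => [|vs' v]; first exact: df.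
by rewrite iterD_rcons; exact: sf.
Qed.

Lemma smooth_of_derive1 (f df : R -> R) : (forall x, is_derive x (1 : R) f (df x)) ->
  smooth df -> smooth f.
Proof.
move=> hf sdf; apply: smooth_of_derive => [x|v].
  by have [] := derive1_line 1 (hf x).
have -> : (fun x => 'D_v f x) = (fun x => v * df x).
  by apply/funext => x; have [] := derive1_line v (hf x).
by apply: smoothM => //; exact: smooth_cst.
Qed.

(** Every derivative of [phi] is a smooth function of [phi], so the functions [K (phi x)] form a
    class stable under differentiation. This covers the exponential and the inverse functions of
    [smooth_inverse]. *)
Lemma smooth_autonomous (phi om : R -> R) : (forall x, is_derive x (1 : R) phi (om (phi x))) ->
  smooth om -> smooth phi.
Proof.
move=> hphi som.
pose S (g : R -> R) := exists K : R -> R, smooth K /\ g = (fun x => K (phi x)).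
have dS (K : R -> R) x : smooth K -> is_derive x (1 : R) (fun x => K (phi x)) ('D_1 K (phi x) * om (phi x)).
  move=> sK; have dK := derivableP (@diff_derivable _ _ _ _ _ (1 : R) (smooth_differentiable (phi x) sK)).
  exact: (@is_derive1_comp R K phi _ _ _ dK (hphi x)).
have sid : smooth (@id R).
  by apply: (smooth_of_derive1 (df := fun _ => 1)); exact: smooth_cst.
apply: (@fun_alg_smooth _ _ S); last by apply: fun_alg_gen; exists id.
- by move=> g [K [sK ->]] x; have [] := derive1_line 1 (dS K x sK).
- move=> g v [K [sK ->]]; apply: fun_alg_gen; exists (fun y => v * ('D_1 K y * om y)).
  split; last by apply/funext => x; have [] := derive1_line v (dS K x sK).
  apply: smoothM; first exact: smooth_cst.
  by apply: smoothM => //; exact: smooth_derive.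
Qed.

Lemma smooth_id : smooth (@id R).
Proof. by apply: (smooth_of_derive1 (df := fun _ => 1)); exact: smooth_cst. Qed.

Lemma smooth_expR : smooth (@expR R).
Proof. by apply: (smooth_autonomous (om := id)); exact: smooth_id. Qed.

Section Reciprocal.
Variable V : normedModType R.

Lemma smooth_inv (f : V -> R) : (forall x, f x != 0) -> smooth f -> smooth (fun x => (f x)^-1).
Proof.
move=> f0 sf.
have dV x : differentiable (fun x => (f x)^-1) x.
  have dinv : differentiable (@GRing.inv R) (f x).
    by have [] := derive1_line 1 (is_deriveV (f0 x : id (f x) != 0) (is_derive_id (f x) (1 : R))).
  exact: (differentiable_comp (smooth_differentiable x sf) dinv).
pose S (g : V -> R) := smooth g \/ g = (fun x => (f x)^-1).
apply: (@fun_alg_smooth _ _ S); last by apply: fun_alg_gen; right.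
- by move=> g [sg x|-> x] //; exact: smooth_differentiable.
- move=> g v [sg|->]; first by apply: fun_alg_gen; left; exact: smooth_derive.
  have -> : (fun x => 'D_v (fun x => (f x)^-1) x) = (fun x => (- 1 * 'D_v f x) * ((f x)^-1 * (f x)^-1)).
    apply/funext => x; rewrite deriveV // ?[_ *: _]mulrC; last exact: diff_derivable (smooth_differentiable x sf).
    rewrite -exprVn; ring.
  apply: fun_algM; last by apply: fun_algM; apply: fun_alg_gen; right.
  apply: fun_alg_gen; left; apply: smoothM; [exact: smooth_cst|exact: smooth_derive].
Qed.

Lemma smooth_ln (f : V -> R) : (forall x, 0 < f x) -> smooth f -> smooth (fun x => ln (f x)).
Proof.
move=> f0 sf.
have dl x : differentiable (@ln R) (f x) by have [] := derive1_line 1 (is_derive1_ln (f0 x)).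
have df x := smooth_differentiable x sf.
have dlf x : differentiable (fun x => ln (f x)) x by exact: (differentiable_comp (df x) (dl x)).
apply: smooth_of_derive => // v.
have -> : (fun x => 'D_v (fun x => ln (f x)) x) = (fun x => 'D_v f x * (f x)^-1).
  apply/funext => x; rewrite deriveE // (diff_comp (df x) (dl x)) /= -(deriveE _ (df x)) -deriveE //.
  by have [] := derive1_line ('D_v f x) (is_derive1_ln (f0 x)).
apply: smoothM; first exact: smooth_derive.
by apply: smooth_inv => // x; rewrite gt_eqF.
Qed.

End Reciprocal.

Lemma is_derive_continuous (f df : R -> R) : (forall x, is_derive x (1 : R) f (df x)) -> continuous f.
Proof.
by move=> h x; apply: differentiable_continuous; have [] := derive1_line 1 (h x).
Qed.

Lemma is_derive_mvt (f df : R -> R) (a b : R) : a <= b ->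
  (forall x, a <= x <= b -> is_derive x (1 : R) f (df x)) ->
  exists2 c, a <= c <= b & f b - f a = df c * (b - a).
Proof.
move=> ab h.
have [x||c] := @MVT_segment R f df a b ab.
- by rewrite in_itv /= => /andP[/ltW ax /ltW xb]; apply: h; rewrite ax.
- apply: continuous_in_subspaceT => x; rewrite inE /= in_itv /= => hx.
  by apply: differentiable_continuous; have [] := derive1_line 1 (h x hx).
- by rewrite in_itv /=; exists c.
Qed.

Lemma is_derive_nondecreasing (f df : R -> R) (a b : R) : a <= b ->
  (forall x, a <= x <= b -> is_derive x (1 : R) f (df x)) ->
  (forall x, a <= x <= b -> 0 <= df x) -> f a <= f b.
Proof.
move=> ab h df0; have [c hc e] := is_derive_mvt ab h.
by rewrite -subr_ge0 e mulr_ge0 ?subr_ge0 //; exact: df0.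
Qed.

(** The integral from [- N] is a primitive on the interval from [- N] to [N] only; normalized at 0,
    these primitives agree for different [N] and glue. *)
Lemma continuous_antiderivative (f : R -> R) : continuous f ->
  exists F : R -> R, forall x, is_derive x (1 : R) F (f x).
Proof.
move=> fc.
pose F (N x : R) := (\int[lebesgue_measure]_(t in `[- N, x]) f t)%R.
have dF N x : `|x| < N -> is_derive x (1 : R) (F N) (f x).
  rewrite ltr_norml => /andP[Nx xN].
  have ig : lebesgue_measure.-integrable `[- N, N] (EFin \o f).
    by apply: continuous_compact_integrable; [exact: segment_compact|exact: continuous_subspaceT].
  have [] := @continuous_FTC1 R f (BLeft (- N)) x N xN ig _ (fc x).
    by rewrite lte_fin.
  by rewrite derive1E => h1 h2; exact: DeriveDef.
pose D N x := F N x - F N 0.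
have DD N M x : `|x| < N -> `|x| < M -> D N x = D M x.
  move=> xN xM.
  pose g y := D N y - D M y.
  have dg y : `|y| <= `|x| -> is_derive y (1 : R) g 0.
    move=> yx; have h1 := dF N y (le_lt_trans yx xN); have h2 := dF M y (le_lt_trans yx xM).
    apply: (is_derive_eq (is_deriveB (is_deriveB h1 (is_derive_cst (F N 0) y 1)) (is_deriveB h2 (is_derive_cst (F M 0) y 1)))).
    by rewrite !subr0 subrr.
  have g0 : g 0 = 0 by rewrite /g /D !subrr.
  suff : g x = 0 by move/eqP; rewrite subr_eq0 => /eqP.
  have [x0|x0] := lerP 0 x.
    have [y /andP[y0 yx]|c _] := is_derive_mvt x0 (df := fun _ => 0) (f := g); last by rewrite g0 subr0 mul0r.
    by apply: dg; rewrite !ger0_norm.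
  have [y /andP[y0 yx]|c _] := is_derive_mvt (ltW x0) (df := fun _ => 0) (f := g).
    by apply: dg; rewrite !ler0_norm ?lerN2 // ltW.
  by rewrite g0 sub0r mul0r => /eqP; rewrite oppr_eq0 => /eqP.
exists (fun x => D (`|x| + 1) x) => x0.
have d1 : is_derive x0 (1 : R) (D (`|x0| + 2)) (f x0).
  have h1 : is_derive x0 (1 : R) (F (`|x0| + 2)) (f x0) by apply: dF; rewrite ltrDl.
  by apply: (is_derive_eq (is_deriveB h1 (is_derive_cst (F (`|x0| + 2) 0) x0 1))); rewrite subr0.
have nr : {near x0, D (`|x0| + 2) =1 (fun x => D (`|x| + 1) x)}.
  near=> x; apply: DD; last by rewrite ltrDl.
  have : `|x0 - x| < 1 by near: x; exact: nbhsx_ballx.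
  have := ler_distD x0 x 0; rewrite !subr0 distrC; lra.
exact: near_eq_is_derive nr d1.
Unshelve. all: by end_near. Qed.

End SmoothReal.

Section Cutoff.
Variable R : realType.

Lemma is_derive_pow (V : normedModType R) (f : V -> R) (x v : V) (d : R) k : is_derive x v f d ->
  is_derive x v (fun y => f y ^+ k) (k%:R * f x ^+ k.-1 * d).
Proof.
move=> df; elim: k => [|k IH]; first by rewrite !mul0r; exact: is_derive_cst.
have -> : (fun y => f y ^+ k.+1) = f * (fun y => f y ^+ k) by apply/funext => y; rewrite exprS.
apply: (is_derive_eq (is_deriveM df IH)); rewrite /GRing.scale /=.
by case: k {IH} => [|k] /=; rewrite -natr1 ?exprS; ring.
Qed.

(* [flat_exp k] is [x^-k exp(-1/x)] for [x > 0], extended by [0]. *)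
Definition flat_exp (k : nat) (x : R) : R := if 0 < x then x^-1 ^+ k * expR (- x^-1) else 0.

Lemma flat_exp_le0 k x : x <= 0 -> flat_exp k x = 0.
Proof. by rewrite /flat_exp ltNge => ->. Qed.

Lemma flat_exp_ge0 k x : 0 <= flat_exp k x.
Proof.
rewrite /flat_exp; case: ifP => // x0.
by rewrite mulr_ge0 ?expR_ge0 // exprn_ge0 // invr_ge0 ltW.
Qed.

Lemma flat_exp_gt0 x : 0 < x -> 0 < flat_exp 0 x.
Proof. by move=> x0; rewrite /flat_exp x0 mul1r expR_gt0. Qed.

(** From the exponential series at [x^-1]; the quadratic bound yields the zero derivative at the
    origin. *)
Lemma flat_exp_quad k x : flat_exp k x <= k.+2`!%:R * x ^+ 2.
Proof.
rewrite /flat_exp; case: ifP => x0; last by rewrite mulr_ge0 // sqr_ge0.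
have y0 : 0 <= x^-1 by rewrite invr_ge0 ltW.
have : x^-1 ^+ k.+2 <= k.+2`!%:R * expR x^-1.
  have := expR_ge1Dxn k.+1 y0; rewrite -lerBrDl => h.
  rewrite mulrC -ler_pdivrMr ?ltr0n ?fact_gt0 //; apply: le_trans h _.
  by rewrite gerBl.
rewrite -(ler_pM2r (expR_gt0 (- x^-1))) -(mulrA (k.+2`!%:R)) -expRD subrr expR0 mulr1 => h.
have x2 : 0 < x ^+ 2 by rewrite exprn_gt0.
have := ler_wpM2r (ltW x2) h; apply: le_trans.
rewrite le_eqVlt; apply/orP; left; apply/eqP.
rewrite 2!exprSr; field; by rewrite gt_eqF.
Qed.

Lemma flat_exp_derive k x :
  is_derive x (1 : R) (flat_exp k) (flat_exp k.+2 x - k%:R * flat_exp k.+1 x).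
Proof.
have [x0|x0|->] := ltgtP x 0.
- rewrite !flat_exp_le0 ?(ltW x0) // mulr0 subr0.
  have nr : \near x, (fun _ : R => 0) x = flat_exp k x.
    by near=> y; rewrite flat_exp_le0 // ltW //; near: y; exact: lt_nbhsl.
  exact: (near_eq_is_derive nr (is_derive_cst (0 : R) x 1)).
- pose g (y : R) := y^-1 ^+ k * expR (- y^-1).
  have nr : {near x, g =1 flat_exp k}.
    near=> y; rewrite /flat_exp ifT //; near: y; exact: lt_nbhsr.
  apply: (near_eq_is_derive nr).
  have di : is_derive x (1 : R) (fun y : R => y^-1) (- x ^- 2).
    apply: (is_derive_eq (is_deriveV (_ : id x != 0) (is_derive_id x (1 : R)))); first by rewrite gt_eqF.
    by rewrite /GRing.scale /= mulr1.
  have de := @is_derive1_comp R expR (fun y => - y^-1) x _ _ (is_derive_expR _) (is_deriveN di).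
  apply: (is_derive_eq (is_deriveM (is_derive_pow k di) de)).
  rewrite /flat_exp x0 /GRing.scale /=; case: k {g nr} => [|k] /=; rewrite -exprVn -?natr1 ?exprS; ring.
- rewrite !flat_exp_le0 // mulr0 subr0.
  apply: (@is_derive_quadratic R R _ 0 k.+2`!%:R) => t.
  by rewrite scaler0 !subr0 (flat_exp_le0 k (lexx 0)) subr0 ger0_norm ?flat_exp_ge0 // flat_exp_quad.
Unshelve. all: by end_near. Qed.
Lemma smooth_flat_exp k : smooth (flat_exp k).
Proof.
apply: (@fun_alg_smooth _ _ (fun f => exists k, f = flat_exp k)); last by apply: fun_alg_gen; exists k.
- by move=> f [j ->] x; have [] := derive1_line 1 (flat_exp_derive j x).
- move=> f v [j ->].
  have -> : (fun x => 'D_v (flat_exp j) x) =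
      (fun x => v * (flat_exp j.+2 x + (- j%:R) * flat_exp j.+1 x)).
    apply/funext => x; have [_ ->] := derive1_line v (flat_exp_derive j x).
    by rewrite mulNr.
  apply: fun_algM; first exact: fun_alg_cst.
  apply: fun_algD; first by apply: fun_alg_gen; exists j.+2.
  by apply: fun_algM; [exact: fun_alg_cst|apply: fun_alg_gen; exists j.+1].
Qed.

Definition smooth_step (x : R) : R := flat_exp 0 x * (flat_exp 0 x + flat_exp 0 (1 - x))^-1.

Lemma smooth_step_den x : 0 < flat_exp 0 x + flat_exp 0 (1 - x).
Proof.
have [x0|x0] := lerP x 0.
  by rewrite ltr_wpDl ?flat_exp_ge0 // flat_exp_gt0 // subr_gt0 (le_lt_trans x0).
by rewrite ltr_wpDr ?flat_exp_ge0 // flat_exp_gt0.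
Qed.

Lemma smooth_affine (a b : R) : smooth (fun x : R => a * x + b).
Proof.
apply: smoothD; last exact: smooth_cst.
by apply: smoothM; [exact: smooth_cst|exact: smooth_id].
Qed.

Lemma smooth_step_smooth : smooth smooth_step.
Proof.
apply: smoothM; first exact: smooth_flat_exp.
apply: smooth_inv => [x|]; first by rewrite gt_eqF // smooth_step_den.
apply: smoothD; first exact: smooth_flat_exp.
have -> : (fun x : R => flat_exp 0 (1 - x)) = (fun x => flat_exp 0 (-1 * x + 1)).
  by apply/funext => x; rewrite mulN1r addrC.
by apply: smooth_comp1; [exact: smooth_flat_exp|exact: smooth_affine].
Qed.

Lemma smooth_step_itv x : 0 <= smooth_step x <= 1.
Proof.
have h := smooth_step_den x; apply/andP; split.
  by rewrite mulr_ge0 ?flat_exp_ge0 // invr_ge0 ltW.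
by rewrite ler_pdivrMr // mul1r lerDl flat_exp_ge0.
Qed.

Lemma smooth_step0 x : x <= 0 -> smooth_step x = 0.
Proof. by move=> x0; rewrite /smooth_step flat_exp_le0 // mul0r. Qed.

Lemma smooth_step1 x : 1 <= x -> smooth_step x = 1.
Proof.
move=> x1; rewrite /smooth_step [flat_exp 0 (1 - x)]flat_exp_le0 ?subr_le0 // addr0 divff //.
by rewrite gt_eqF // flat_exp_gt0 // (lt_le_trans ltr01).
Qed.

(** [Theta] is minus a primitive of a bump with values in [0, 1] that equals 1 on [[2 * d, b - d]].
    The slope is thus at most 1 while the total drop is at least [b - 3 * d], above
    [L = b - 5 * d]. *)
Lemma smooth_cutoff (L b : R) : 0 <= L -> L < b -> exists (Theta dTheta : R -> R) (a m : R),
  [/\ smooth Theta, (forall t, is_derive t (1 : R) Theta (dTheta t)),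
      (forall t, `|dTheta t| <= 1) & 0 < a] /\
  [/\ L <= m, (forall t, t <= a -> Theta t = m), (forall t, b <= t -> Theta t = 0) &
      forall t, 0 <= Theta t <= m].
Proof.
move=> L0 Lb; pose d := (b - L) / 5.
have d0 : 0 < d by rewrite divr_gt0 // subr_gt0.
pose pl (t : R) := smooth_step (d^-1 * t + -1) * smooth_step (- d^-1 * t + b / d).
have spl : smooth pl.
  apply: smoothM; apply: (smooth_comp1 smooth_step_smooth); exact: smooth_affine.
have pl01 t : 0 <= pl t <= 1.
  have /andP[h1 h2] := smooth_step_itv (d^-1 * t + -1).
  have /andP[h3 h4] := smooth_step_itv (- d^-1 * t + b / d).
  by rewrite mulr_ge0 // mulr_ile1.
have e1 t : d^-1 * t + -1 = (t - d) / d by field; rewrite gt_eqF.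
have e2 t : - d^-1 * t + b / d = (b - t) / d by field; rewrite gt_eqF.
have pla t : t <= d -> pl t = 0.
  by move=> td; rewrite /pl e1 [X in X * _]smooth_step0 ?mul0r // pmulr_lle0 ?invr_gt0 // subr_le0.
have plb t : b <= t -> pl t = 0.
  by move=> td; rewrite /pl e2 [X in _ * X]smooth_step0 ?mulr0 // pmulr_lle0 ?invr_gt0 // subr_le0.
have pl1 t : 2 * d <= t <= b - d -> pl t = 1.
  move=> /andP[h1 h2]; rewrite /pl e1 e2.
  have -> : smooth_step ((t - d) / d) = 1 by apply: smooth_step1; rewrite ler_pdivlMr // mul1r; lra.
  have -> : smooth_step ((b - t) / d) = 1 by apply: smooth_step1; rewrite ler_pdivlMr // mul1r; lra.
  by rewrite mulr1.
have [F dF] := continuous_antiderivative (fun x => differentiable_continuous (smooth_differentiable x spl)).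
have Fle s t : s <= t -> F s <= F t.
  by move=> st; apply: (is_derive_nondecreasing st (fun x _ => dF x)) => x _; have /andP[] := pl01 x.
have Fcst s t : s <= t -> (forall x, s <= x <= t -> pl x = 0) -> F s = F t.
  move=> st h; have [c hc e] := is_derive_mvt st (fun x _ => dF x).
  by move: e; rewrite h // mul0r => /eqP; rewrite subr_eq0 => /eqP.
have Fa t : t <= d -> F t = F d.
  by move=> td; apply: Fcst => // x /andP[_ xd]; exact: pla.
have Fb t : b <= t -> F b = F t.
  by move=> td; apply: Fcst => // x /andP[bx _]; exact: plb.
have dTheta t : is_derive t (1 : R) (fun t => F b - F t) (- pl t).
  by apply: (is_derive_eq (is_deriveB (is_derive_cst (F b) t 1) (dF t))); rewrite sub0r.
have sTheta : smooth (fun t => F b - F t).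
  apply: (smooth_of_derive1 dTheta).
  have -> : (fun t => - pl t) = (fun t => -1 * pl t) by apply/funext => t; rewrite mulN1r.
  by apply: smoothM => //; exact: smooth_cst.
exists (fun t => F b - F t), (fun t => - pl t), d, (F b - F d); split; split=> //.
- by move=> t; rewrite normrN ger0_norm; have /andP[] := pl01 t.
- have h : 2 * d <= b - d by rewrite /d; lra.
  have [c hc e] := is_derive_mvt h (fun x _ => dF x).
  rewrite pl1 // mul1r in e.
  have h1 : F d <= F (2 * d) by apply: Fle; lra.
  have h2 : F (b - d) <= F b by apply: Fle; lra.
  have -> : L = b - 5 * d by rewrite /d; field.
  lra.
- by move=> t td; rewrite (Fa t td).
- by move=> t bt; rewrite (Fb t bt) subrr.
- move=> t; have [td|td] := lerP t d.
    rewrite (Fa t td) lexx andbT subr_ge0 Fle //; rewrite /d; lra.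
  rewrite lerD2l lerN2 (Fle _ _ (ltW td)) andbT subr_ge0.
  by have [tb|tb] := lerP t b; [exact: Fle|rewrite (Fb _ (ltW tb))].
Qed.

End Cutoff.

(** * Lower bound for the Hofer-Zehnder capacity *)

Section ConvexGeometry.
Variables (R : realType) (n : nat).
Local Notation V := 'rV[R]_n.
Implicit Types (A P X Y : set V) (x p : V).

Lemma centrally_symmetricN A x : centrally_symmetric A -> A x -> A (- x).
Proof. by move=> sA Ax; rewrite sA; exists x. Qed.

Lemma symmetric_body_ball A : convex_body A -> centrally_symmetric A ->
  exists2 rho : R, 0 < rho & forall v, `|v| <= rho -> A v.
Proof.
move=> [_ [cA [x0 Ax0]]] sA; have [d d0 hd] := rV_near_ball Ax0.
exists (d / 2); first by rewrite divr_gt0.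
move=> v vd.
have hv w : `|w| <= d / 2 -> A (x0 + w).
  move=> wd; apply: hd => k; rewrite mxE [x0 0 k + _]addrC addrK.
  by apply: le_lt_trans (rV_coord_le w k) _; apply: le_lt_trans wd _; rewrite ltr_pdivrMr // ltr_pMr // ltr1n.
have h1 := hv v vd.
have h2 : A (- (x0 + - v)) by apply: (centrally_symmetricN sA); apply: hv; rewrite normrN.
have := cA _ _ h1 h2 (1 / 2) ltac:(lra) ltac:(lra).
suff -> : 1 / 2 *: (x0 + v) + (1 - 1 / 2) *: - (x0 - v) = v by [].
by apply/rowP => k; rewrite !mxE; field.
Qed.

Lemma dotv0r x : dotv x 0 = 0.
Proof. by rewrite /dotv big1 // => i _; rewrite [X in _ * X]mxE mulr0. Qed.

Lemma dotv_continuous (x : V) : continuous (fun p : V => dotv x p).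
Proof.
apply: fct_sum_continuous => i; apply: fctM_continuous; first exact: fct_cst_continuous.
exact: coord_continuous.
Qed.

(** The covector points from the nearest point [q0] of [P] to [p], and is normalized at the midpoint
    of its values at [q0] and [p]. *)
Lemma compact_convex_separation P p : compact P -> convex_set_of P -> P 0 -> ~ P p ->
  exists x : V, (forall q, P q -> dotv x q <= 1) /\ 1 < dotv x p.
Proof.
move=> cP vP P0 Pp.
pose f (q : V) := - dotv (p - q) (p - q).
have fc : continuous f.
  have -> : f = (fun q => - 1 * \sum_(i < n) (p - q) 0 i * (p - q) 0 i) by apply/funext => q; rewrite mulN1r.
  apply: fctM_continuous; first exact: fct_cst_continuous.
  have hc i : continuous (fun q : V => (p - q) 0 i).
    have -> : (fun q : V => (p - q) 0 i) = (fun q : V => p 0 i - q 0 i) by apply/funext => q; rewrite !mxE.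
    by apply: fctB_continuous; [exact: fct_cst_continuous|exact: coord_continuous].
  by apply: fct_sum_continuous => i; exact: fctM_continuous.
have [q0 Pq0 hq0] := @EVT_max_rV R n f P (ex_intro _ 0 P0) cP (continuous_subspaceT fc).
rewrite inE in Pq0.
pose a := p - q0.
have an0 : 0 < dotv a a.
  rewrite ltNge; apply/negP => /dotv_eq0 /eqP; rewrite subr_eq0 => /eqP e.
  by apply: Pp; rewrite e.
have haq q : P q -> dotv a q <= dotv a q0.
  move=> Pq; rewrite -subr_ge0 leNgt; apply/negP; rewrite subr_lt0 => lt.
  pose u := q - q0.
  have au : 0 < dotv a u by rewrite dotvC dotvBl !(dotvC _ a) subr_gt0.
  pose K := dotv u u + dotv a u.
  have uu : 0 <= dotv u u by exact: dotv_ge0.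
  have K0 : 0 < K by rewrite /K; lra.
  pose t := dotv a u / K.
  have t0 : 0 < t by rewrite divr_gt0.
  have t1 : t <= 1 by rewrite ler_pdivrMr // mul1r lerDr.
  have /(_ (t *: q + (1 - t) *: q0)) := hq0.
  rewrite inE => /(_ (vP _ _ Pq Pq0 t (ltW t0) t1)); rewrite lerN2.
  have -> : p - (t *: q + (1 - t) *: q0) = a - t *: u.
    by apply/rowP => k; rewrite !mxE; ring.
  rewrite -/a (dotvBl (a - t *: u) a) dotvZl (dotvC a (a - _)) (dotvC u (a - _)) (dotvBl a a) (dotvBl u a) !dotvZl (dotvC u a).
  apply/negP; rewrite -ltNge.
  have e : t * K = dotv a u by rewrite /t divfK // gt_eqF.
  have -> : dotv a a - t * dotv a u - t * (dotv a u - t * dotv u u) =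
     dotv a a - t * (2 * dotv a u - t * dotv u u) by ring.
  rewrite gtrBl mulr_gt0 // subr_gt0.
  have : t * dotv u u <= dotv u u * 1 by rewrite mulrC ler_wpM2l.
  have : t * dotv u u <= t * K by rewrite ler_pM2l // /K; lra.
  rewrite e; lra.
have a0 : 0 <= dotv a q0 by have := haq 0 P0; rewrite dotv0r.
have ap : dotv a q0 < dotv a p.
  by rewrite -subr_gt0 -(dotvC p) -(dotvC q0) -dotvBl.
pose b := (dotv a q0 + dotv a p) / 2.
have b0 : 0 < b by rewrite /b; lra.
exists (b^-1 *: a); split=> [q Pq|]; rewrite dotvZl mulrC.
  by rewrite ler_pdivrMr // mul1r; apply: le_trans (haq q Pq) _; rewrite /b; lra.
by rewrite ltr_pdivlMr // mul1r /b; lra.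
Qed.

Lemma hpolar_closed (r : R) X : closed (hpolar r X).
Proof.
have -> : hpolar r X = \bigcap_(x in X) [set p | dotv p x <= r] by [].
apply: closed_bigI => x Xx.
have -> : [set p | dotv p x <= r] = (fun p => dotv x p) @^-1` [set t | t <= r].
  by apply/funext => p /=; rewrite dotvC.
apply: (closed_comp (f := fun p => dotv x p)); last exact: closed_le.
by move=> p _; exact: dotv_continuous.
Qed.

Lemma ball_dotv_le (rho h : R) Y p : 0 < rho -> (forall v, `|v| <= rho -> Y v) ->
  (forall y, Y y -> dotv y p <= h) -> rho * `|p| <= h.
Proof.
move=> rho0 hY hp.
have h0 : 0 <= h.
  have := hp 0; rewrite dotvC dotv0r.
  by apply; apply: hY; rewrite normr0 ltW.
rewrite -ler_pdivlMl //; apply: rV_norm_le => [|k]; first by rewrite mulr_ge0 // invr_ge0 ltW.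
rewrite ler_pdivlMl //.
pose v : V := (rho * Num.sg (p 0 k)) *: delta_mx 0 k.
have := hp v; rewrite dotvZl -mulrA; set d := dotv _ _.
have -> : d = p 0 k.
  rewrite /d /dotv (bigD1 k) //= big1 ?addr0 => [|i ik]; rewrite !mxE eqxx ?eqxx ?mul1r //=.
  by rewrite (negbTE ik) mul0r.
rewrite -normrEsg; apply; apply: hY.
apply: rV_norm_le => [|i]; first exact: ltW.
rewrite !mxE eqxx /= normrM normrM (gtr0_norm rho0).
apply: (@le_trans _ _ (rho * 1 * 1)); last by rewrite !mulr1.
apply: ler_pM; rewrite ?mulr_ge0 ?(ltW rho0) //; last by case: (_ == _); rewrite ?normr1 ?normr0.
by apply: ler_wpM2l; [exact: ltW|rewrite normr_sg lern1 leq_b1].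
Qed.

(** Let [h] be the maximum of [dotv y p] over [Y]. The ball in [Y] gives [rho |p| <= h], so
    replacing a maximizer by a point of a fine net loses at most [(1 - th) h]; hence
    [th h <= th]. *)
Lemma finite_norming_net Y (rho th : R) : compact Y -> 0 < rho -> (forall v, `|v| <= rho -> Y v) ->
  0 < th -> th < 1 ->
  exists2 bs : seq V, (forall b, b \in bs -> Y b) &
    forall p, (forall b, b \in bs -> `|dotv b p| <= th) -> forall y, Y y -> dotv y p <= 1.
Proof.
move=> cY rho0 hY th0 th1.
pose eta := (1 - th) * rho / n.+1%:R.
have eta0 : 0 < eta by rewrite !mulr_gt0 ?invr_gt0 ?subr_gt0.
have := cY; rewrite compact_cover => /(_ V Y (fun y => ball y eta)).
case=> [y Yy|y Yy|D DY cov]; first exact: ball_open.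
  by exists y => //; exact: ballxx.
exists (finmap.enum_fset D) => [b bD|p hp y Yy]; first by have := DY b bD; rewrite inE.
have pc : {within Y, continuous (fun y : V => dotv y p)}.
  apply: continuous_subspaceT; have -> : (fun y : V => dotv y p) = (fun y => dotv p y).
    by apply/funext => z; rewrite dotvC.
  exact: dotv_continuous.
have [z Yz hz] := @EVT_max_rV R n _ Y (ex_intro _ y Yy) cY pc.
have {}hz v : Y v -> dotv v p <= dotv z p by move=> Yv; apply: hz; rewrite inE.
apply: le_trans (hz y Yy) _; set h := dotv z p in hz *.
rewrite inE in Yz; have [b /= bD zb] := cov z Yz.
have hr := ball_dotv_le rho0 hY hz.
have bz : `|z - b| <= eta by move: zb; rewrite -ball_normE /= distrC => /ltW.
have h1 : h <= th + n%:R * (eta * `|p|).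
  have -> : h = dotv b p + dotv (z - b) p by rewrite dotvBl /h; ring.
  apply: lerD; first by apply: le_trans (hp b bD); exact: ler_norm.
  apply: le_trans (ler_norm _) _; apply: le_trans (dotv_le _ _) _.
  by rewrite ler_wpM2l // ler_wpM2r.
have h2 : n%:R * (eta * `|p|) <= (1 - th) * h.
  have -> : n%:R * (eta * `|p|) = n%:R / n.+1%:R * ((1 - th) * (rho * `|p|)) by rewrite /eta; ring.
  apply: (@le_trans _ _ (1 * ((1 - th) * (rho * `|p|)))).
    apply: ler_wpM2r; first by rewrite !mulr_ge0 ?subr_ge0 // ltW.
    by rewrite ler_pdivrMr // mul1r ler_nat.
  by rewrite mul1r ler_wpM2l // subr_ge0 ltW.
have : th * h <= th * 1 by lra.
by rewrite ler_pM2l.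
Qed.

End ConvexGeometry.

(** * The isoperimetric inequality for closed orbits *)

Section PeriodBound.
Variables (R : realType) (n : nat).
Local Notation V := 'rV[R]_n.

Lemma is_derive_coord (x : R -> V) t dx i : is_derive t (1 : R) x dx ->
  is_derive t (1 : R) (fun t => x t 0 i) (dx 0 i).
Proof.
move=> [ex <-]; have dx' : differentiable x t by apply/derivable1_diffP.
have d : differentiable (fun t => x t 0 i) t.
  exact: (differentiable_comp dx' (differentiable_coord _ _ _)).
apply: DeriveDef; first exact: diff_derivable.
by rewrite (derive_mx ex) mxE.
Qed.

Lemma is_derive_dotv (x p : R -> V) t dx dp : is_derive t (1 : R) x dx -> is_derive t (1 : R) p dp ->
  is_derive t (1 : R) (fun t => dotv (x t) (p t)) (dotv (p t) dx + dotv (x t) dp).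
Proof.
move=> hx hp; have -> : (fun t => dotv (x t) (p t)) = \sum_(i < n) ((fun t => x t 0 i) * (fun t => p t 0 i)).
  by apply/funext => u; rewrite fct_sumE.
have h i := is_deriveM (is_derive_coord i hx) (is_derive_coord i hp).
apply: (is_derive_eq (is_derive_sum h)).
by rewrite /dotv -big_split /=; apply: eq_bigr => i _; rewrite addrC.
Qed.

Lemma is_derive_dotv_cst (b : V) (p : R -> V) t dp : is_derive t (1 : R) p dp ->
  is_derive t (1 : R) (fun t => dotv b (p t)) (dotv b dp).
Proof.
move=> hp; apply: (is_derive_eq (is_derive_dotv (is_derive_cst b t 1) hp)).
by rewrite dotv0r add0r.
Qed.

Variable k : nat.
Implicit Types (l : seq V).

Definition psum l (x : V) : R := \sum_(a <- l) dotv a x ^+ (2 * k).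
Definition dpsum l (x : V) : V := \sum_(a <- l) ((2 * k)%:R * dotv a x ^+ (2 * k).-1) *: a.
(** The sum of the absolute coefficients of [dpsum]: it bounds the pairing of [dpsum] with any
    vector that is bounded on [l], and its integral plays the part of a length. *)
Definition apsum l (x : V) : R := \sum_(a <- l) (2 * k)%:R * `|dotv a x| ^+ (2 * k).-1.

Lemma apsum_ge0 l x : 0 <= apsum l x.
Proof. by apply: sumr_ge0 => a _; rewrite mulr_ge0 // exprn_ge0. Qed.

Lemma dotv_dpsum l x w : dotv w (dpsum l x) = \sum_(a <- l) (2 * k)%:R * dotv a x ^+ (2 * k).-1 * dotv w a.
Proof.
rewrite /dpsum; elim: l => [|a l IH]; first by rewrite !big_nil dotv0r.
by rewrite !big_cons dotvDr dotvZr IH.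
Qed.

Lemma dotv_dpsum_self l x : dotv x (dpsum l x) = (2 * k)%:R * psum l x.
Proof.
rewrite dotv_dpsum /psum mulr_sumr; apply: eq_bigr => a _; rewrite (dotvC x) -mulrA.
case: k => [|m]; first by rewrite muln0 mulr0n !mul0r.
by rewrite -exprSr mul2n.
Qed.

Lemma dotv_dpsum_le l x w B : 0 <= B -> (forall a, a \in l -> `|dotv w a| <= B) ->
  `|dotv w (dpsum l x)| <= apsum l x * B.
Proof.
move=> B0 hB; rewrite dotv_dpsum /apsum mulr_suml; apply: le_trans (ler_norm_sum _ _ _) _.
rewrite big_seq [leRHS]big_seq; apply: ler_sum => a al.
by rewrite !normrM normrX normr_nat; apply: ler_pM; rewrite ?mulr_ge0 ?exprn_ge0 ?hB.
Qed.

Lemma apsum_continuous l : continuous (apsum l).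
Proof.
apply: fct_sum_continuous => a; apply: fctM_continuous; first exact: fct_cst_continuous.
have h : continuous (fun x => `|dotv a x|) by apply: fct_norm_continuous; exact: dotv_continuous.
by elim: ((2 * k).-1) => [|m IH]; [exact: fct_cst_continuous|under eq_fun do rewrite exprS; exact: fctM_continuous].
Qed.

Variables (las lbs : seq V) (q lam c T : R) (x p : R -> V).
Hypotheses (q0 : 0 <= q) (hq : forall a b, a \in las -> b \in lbs -> `|dotv b a| <= q).
Hypothesis hx : forall t, is_derive t (1 : R) x (lam *: dpsum lbs (p t)).
Hypothesis hp : forall t, is_derive t (1 : R) p (- lam *: dpsum las (x t)).
Hypothesis hc : forall t, psum las (x t) + psum lbs (p t) = c.
Hypotheses (T0 : 0 < T) (xT : x T = x 0) (pT : p T = p 0).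

(* [M] and [L] are the lengths of the two projections of the orbit. Recentring
   the [p]-curve at the midpoint of two points that cut it into halves of equal
   length puts it at distance at most a quarter of its length, hence the factor 4. *)
Lemma closed_orbit_length (M L : R -> R) :
  (forall t, is_derive t (1 : R) M (`|lam| * apsum las (x t))) ->
  (forall t, is_derive t (1 : R) L (`|lam| * apsum lbs (p t))) ->
  4 * (k%:R * c * `|lam| * T) <= q * (M T - M 0) * (L T - L 0).
Proof.
move=> dM dL.
have Mle u v : u <= v -> M u <= M v.
  move=> uv; apply: (is_derive_nondecreasing uv (fun t _ => dM t)) => t _.
  by rewrite mulr_ge0 // apsum_ge0.
have bp b u v : b \in lbs -> u <= v -> `|dotv b (p v) - dotv b (p u)| <= q * (M v - M u).
  move=> bl uv.
  have dle t : `|dotv b (- lam *: dpsum las (x t))| <= q * (`|lam| * apsum las (x t)).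
    rewrite dotvZr normrM normrN mulrCA; apply: ler_wpM2l => //.
    by rewrite mulrC; apply: dotv_dpsum_le => // a al; exact: hq.
  have side (e : R) : `|e| = 1 -> e * (dotv b (p v) - dotv b (p u)) <= q * (M v - M u).
    move=> e1.
    have d t : is_derive t (1 : R) (fun t => q * M t - e * dotv b (p t))
        (q * (`|lam| * apsum las (x t)) - e * dotv b (- lam *: dpsum las (x t))).
      exact: is_deriveB (is_deriveZ q (dM t)) (is_deriveZ e (is_derive_dotv_cst b (hp t))).
    have : q * M u - e * dotv b (p u) <= q * M v - e * dotv b (p v).
      apply: (is_derive_nondecreasing uv (fun t _ => d t)) => t _.
      by rewrite subr_ge0; apply: le_trans (dle t); apply: le_trans (ler_norm _) _; rewrite normrM e1 mul1r.
    by lra.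
  have := side 1 (normr1 _); have := side (- 1) ltac:(by rewrite normrN1).
  by rewrite ler_norml; lra.
have [tau /andP[tau0 tauT] Mtau] : exists2 tau, 0 <= tau <= T & M tau = (M 0 + M T) / 2.
  have m0T := Mle _ _ (ltW T0).
  have [||tau] := @IVT R M 0 T ((M 0 + M T) / 2) (ltW T0).
  - apply: continuous_subspaceT; exact: is_derive_continuous dM.
  - by rewrite min_l // max_r //; lra.
  - by rewrite in_itv /= => h1 h2; exists tau.
pose ctr := 2^-1 *: (p 0 + p tau).
have bctr b t : b \in lbs -> 0 <= t <= T -> `|dotv b (p t - ctr)| <= q * ((M T - M 0) / 4).
  move=> bl /andP[t0 tT].
  have -> : dotv b (p t - ctr) = 2^-1 * ((dotv b (p t) - dotv b (p 0)) + (dotv b (p t) - dotv b (p tau))).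
    by rewrite /ctr dotvDr dotvNr dotvZr dotvDr; field.
  rewrite normrM ger0_norm ?invr_ge0 //.
  have [tt|tt] := lerP t tau.
    have h1 := bp b 0 t bl t0; have h2 := bp b t tau bl tt.
    rewrite [`|dotv b (p tau) - _|]distrC in h2.
    have := ler_normD (dotv b (p t) - dotv b (p 0)) (dotv b (p t) - dotv b (p tau)).
    move: h1 h2; rewrite Mtau; nra.
  have h1 := bp b tau t bl (ltW tt); have h2 := bp b t T bl tT.
  rewrite pT [`|dotv b (p 0) - _|]distrC in h2.
  have := ler_normD (dotv b (p t) - dotv b (p 0)) (dotv b (p t) - dotv b (p tau)).
  move: h1 h2; rewrite Mtau; nra.
(* A primitive of [p - ctr] paired with the velocity of [x]. By homogeneity of the two sums the
   action is explicit, and [W] grows by [T * (lam * k * c)] over a period. *)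
pose W t := 2^-1 * dotv (x t) (p t) - dotv ctr (x t) + t * (lam * k%:R * c).
have dW t : is_derive t (1 : R) W (lam * dotv (p t - ctr) (dpsum lbs (p t))).
  have d1 := is_deriveZ (2^-1 : R) (is_derive_dotv (hx t) (hp t)).
  have d2 := is_derive_dotv_cst ctr (hx t).
  have d3 : is_derive t (1 : R) (fun t => t * (lam * k%:R * c)) (lam * k%:R * c).
    apply: (is_derive_eq (is_deriveM (is_derive_id t (1 : R)) (is_derive_cst (lam * k%:R * c) t 1))).
    by rewrite /GRing.scale /=; ring.
  apply: (is_derive_eq (is_deriveD (is_deriveB d1 d2) d3)).
  by rewrite /GRing.scale /= !dotvZr !dotv_dpsum_self dotvBl -(hc t) dotv_dpsum_self natrM; field.
have WT : W T - W 0 = T * (lam * k%:R * c) by rewrite /W xT pT; ring.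
have dWle t : 0 <= t <= T -> `|lam * dotv (p t - ctr) (dpsum lbs (p t))| <= q * ((M T - M 0) / 4) * (`|lam| * apsum lbs (p t)).
  move=> ht; rewrite normrM mulrCA; apply: ler_wpM2l => //; rewrite mulrC.
  apply: dotv_dpsum_le; first by rewrite mulr_ge0 // divr_ge0 // subr_ge0 Mle // ltW.
  by move=> b bl; rewrite dotvC; exact: bctr.
set K := q * ((M T - M 0) / 4) in dWle.
have side (e : R) : `|e| = 1 -> e * (W T - W 0) <= K * (L T - L 0).
  move=> e1.
  have d t := is_deriveB (is_deriveZ K (dL t)) (is_deriveZ e (dW t)).
  have : K * L 0 - e * W 0 <= K * L T - e * W T.
    apply: (is_derive_nondecreasing (ltW T0) (fun t _ => d t)) => t ht.
    by rewrite subr_ge0; apply: le_trans (dWle t ht); apply: le_trans (ler_norm _) _; rewrite normrM e1 mul1r.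
  by lra.
have -> : q * (M T - M 0) * (L T - L 0) = 4 * (K * (L T - L 0)) by rewrite /K; field.
rewrite ler_pM2l //.
have [l0|l0] := lerP 0 lam.
  by rewrite ger0_norm //; apply: le_trans (side 1 (normr1 _)); rewrite WT mul1r; lra.
rewrite ltr0_norm //; apply: le_trans (side (-1) ltac:(by rewrite normrN1)); rewrite WT; lra.
Qed.

(** The product of the lengths [m] and [l] is bounded by [4 m l <= (m + l)^2], and their sum by
    [|lam| * D * T]; so the factor 4 becomes 16. *)
Lemma closed_orbit_period (D : R) : (forall t, apsum las (x t) + apsum lbs (p t) <= D) ->
  16 * (k%:R * c * `|lam| * T) <= q * (`|lam| * D * T) ^+ 2.
Proof.
move=> hD.
have xc : continuous x by move=> t; apply: differentiable_continuous; apply/derivable1_diffP; have [] := hx t.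
have pc : continuous p by move=> t; apply: differentiable_continuous; apply/derivable1_diffP; have [] := hp t.
have [M dM] : exists M : R -> R, forall t, is_derive t (1 : R) M (`|lam| * apsum las (x t)).
  apply: continuous_antiderivative; apply: fctM_continuous; first exact: fct_cst_continuous.
  exact: (fct_comp_continuous xc (@apsum_continuous las)).
have [L dL] : exists L : R -> R, forall t, is_derive t (1 : R) L (`|lam| * apsum lbs (p t)).
  apply: continuous_antiderivative; apply: fctM_continuous; first exact: fct_cst_continuous.
  exact: (fct_comp_continuous pc (@apsum_continuous lbs)).
have h := closed_orbit_length dM dL.
have hM : M 0 <= M T.
  apply: (is_derive_nondecreasing (ltW T0) (fun t _ => dM t)) => t _; by rewrite mulr_ge0 // apsum_ge0.
have hL : L 0 <= L T.
  apply: (is_derive_nondecreasing (ltW T0) (fun t _ => dL t)) => t _; by rewrite mulr_ge0 // apsum_ge0.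
have hML : M T + L T - (M 0 + L 0) <= `|lam| * D * T.
  have [t _ e] := is_derive_mvt (ltW T0) (fun t _ => is_deriveD (dM t) (dL t)).
  move: e; rewrite subr0 => e.
  apply: (@le_trans _ _ ((`|lam| * apsum las (x t) + `|lam| * apsum lbs (p t)) * T)).
    by rewrite -e.
  by rewrite ler_pM2r // -mulrDr ler_wpM2l.
set m := M T - M 0 in h *; set l := L T - L 0 in h *.
have m0 : 0 <= m by rewrite subr_ge0.
have l0 : 0 <= l by rewrite subr_ge0.
have ml : m + l <= `|lam| * D * T by rewrite /m /l; lra.
apply: (@le_trans _ _ (q * (m + l) ^+ 2)).
  have : 0 <= q * (m - l) ^+ 2 by rewrite mulr_ge0 // sqr_ge0.
  move: h; rewrite -mulrA => h; nra.
have ml0 := addr_ge0 m0 l0; have D0 := le_trans ml0 ml.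
by apply: ler_wpM2l => //; rewrite ler_sqr ?nnegrE.
Qed.

End PeriodBound.

(** Young's inequality without roots: the induction step adds
    [(y - mu) * (y ^ m.+1 - mu ^ m.+1) >= 0]. *)
Lemma young_pow (R : realDomainType) (m : nat) (y mu : R) : 0 <= y -> 0 <= mu ->
  m.+1%:R * mu * y ^+ m <= m%:R * y ^+ m.+1 + mu ^+ m.+1.
Proof.
move=> y0 mu0; elim: m => [|m IH]; first by rewrite mul0r add0r expr0 expr1 mul1r mulr1.
have h1 : 0 <= (y - mu) * (y ^+ m.+1 - mu ^+ m.+1).
  have [ym|ym] := lerP mu y.
    by rewrite mulr_ge0 // subr_ge0 // lerXn2r.
  by rewrite mulr_le0 // subr_le0 ?lerXn2r ?(ltW ym) // ?nnegrE.
have := ler_wpM2l y0 IH; rewrite [y ^+ m.+2]exprS [mu ^+ m.+2]exprS -!natr1; move: h1; rewrite exprS.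
set Y := y ^+ m; set Z := mu ^+ m.+1; nra.
Qed.

(** * The Hamiltonian built from a smoothed gauge *)

Section LagrangianHamiltonian.
Variables (R : realType) (n k : nat) (las lbs : seq 'rV[R]_n).
Hypothesis k0 : (0 < k)%N.
Local Notation V := 'rV[R]_(n + n).

Lemma is_derive_rV (U : normedModType R) (m : nat) (x : U -> 'rV[R]_m) t v (dx : 'rV[R]_m) :
  (forall i, is_derive t v (fun t => x t 0 i) (dx 0 i)) -> is_derive t v x dx.
Proof.
move=> h; have ex : derivable x t v.
  by apply/derivable_mxP => i j; rewrite (ord1 i); have [] := h j.
apply: DeriveDef => //; apply/rowP => i; rewrite (derive_mx ex) mxE.
by have [_ ->] := h i.
Qed.

Lemma is_derive_coordinate (m : nat) (i : 'I_m) (z v : 'rV[R]_m) :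
  is_derive z v (fun z => z 0 i) (v 0 i).
Proof.
apply: DeriveDef; first by apply: diff_derivable; exact: differentiable_coord.
have := congr1 (fun M : 'rV[R]_m => M 0 i) (derive_mx (@derivable_id R _ z v)).
by rewrite derive_id mxE => ->.
Qed.

Lemma is_derive_psum (U : normedModType R) (l : seq 'rV[R]_n) (f : U -> 'rV[R]_n) z v (df : 'rV[R]_n) :
  (forall i, is_derive z v (fun z => f z 0 i) (df 0 i)) ->
  is_derive z v (fun z => psum k l (f z)) (dotv (dpsum k l (f z)) df).
Proof.
move=> h.
have hd a : is_derive z v (fun z => dotv a (f z)) (dotv a df).
  have -> : (fun z => dotv a (f z)) = \sum_(i < n) (a 0 i \*: (fun z => f z 0 i)).
    by apply/funext => u; rewrite fct_sumE.
  exact: (is_derive_sum (fun i => is_deriveZ (a 0 i) (h i))).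
rewrite dotvC dotv_dpsum /psum; elim: l => [|a l IH].
  by under eq_fun do rewrite big_nil; rewrite big_nil; exact: is_derive_cst.
under eq_fun do rewrite big_cons; rewrite big_cons.
apply: (is_derive_eq (is_deriveD (is_derive_pow (2 * k) (hd a)) IH)).
by rewrite (dotvC df a).
Qed.

Definition gauge_sum (z : V) : R := psum k las (lsubmx z) + psum k lbs (rsubmx z).

Lemma psum_ge0 l (x : 'rV[R]_n) : 0 <= psum k l x.
Proof. by apply: sumr_ge0 => a _; rewrite exprM exprn_ge0 // sqr_ge0. Qed.

Lemma gauge_sum_ge0 z : 0 <= gauge_sum z.
Proof. by rewrite addr_ge0 ?psum_ge0. Qed.

Lemma gauge_sum_smooth : smooth gauge_sum.
Proof.
have h l (f : V -> 'rV[R]_n) : (forall i, smooth (fun z => f z 0 i)) -> smooth (fun z => psum k l (f z)).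
  move=> sf; apply: smooth_sum => a; apply: smoothX; apply: smooth_sum => i.
  by apply: smoothM => //; exact: smooth_cst.
apply: smoothD; apply: h => i.
  have -> : (fun z : V => lsubmx z 0 i) = (fun z => z 0 (lshift n i)) by apply/funext => z; rewrite mxE.
  exact: smooth_coordinate.
have -> : (fun z : V => rsubmx z 0 i) = (fun z => z 0 (rshift n i)) by apply/funext => z; rewrite mxE.
exact: smooth_coordinate.
Qed.

Lemma gauge_sum_derive (z v : V) : is_derive z v gauge_sum
  (dotv (dpsum k las (lsubmx z)) (lsubmx v) + dotv (dpsum k lbs (rsubmx z)) (rsubmx v)).
Proof.
apply: is_deriveD; apply: is_derive_psum => i.
  have -> : (fun z : V => lsubmx z 0 i) = (fun z => z 0 (lshift n i)) by apply/funext => y; rewrite mxE.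
  by rewrite mxE; exact: is_derive_coordinate.
have -> : (fun z : V => rsubmx z 0 i) = (fun z => z 0 (rshift n i)) by apply/funext => y; rewrite mxE.
by rewrite mxE; exact: is_derive_coordinate.
Qed.

Variables (eps kap : R) (Theta dTheta : R -> R).
Hypotheses (eps0 : 0 < eps) (kap0 : 0 < kap).
Hypotheses (sTheta : smooth Theta) (hTheta : forall t, is_derive t (1 : R) Theta (dTheta t)).
Hypothesis dTheta1 : forall t, `|dTheta t| <= 1.

(* The shift by [eps] keeps the [k]-th root smooth at the origin. *)
Definition eps_root (c : R) : R := expR (k%:R^-1 * ln (c + eps)).
Definition gauge_ham (z : V) : R := kap * Theta (eps_root (gauge_sum z)).
Definition gauge_speed (c : R) : R := kap * (dTheta (eps_root c) * (eps_root c * (k%:R^-1 * (c + eps)^-1))).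

Lemma gauge_sum_eps z : 0 < gauge_sum z + eps.
Proof. by rewrite ltr_wpDl // gauge_sum_ge0. Qed.

Lemma eps_root_smooth : smooth (fun z => eps_root (gauge_sum z)).
Proof.
apply: (smooth_comp1 (@smooth_expR R)); apply: smoothM; first exact: smooth_cst.
apply: (smooth_ln gauge_sum_eps); apply: smoothD; [exact: gauge_sum_smooth|exact: smooth_cst].
Qed.

Lemma gauge_ham_smooth : smooth gauge_ham.
Proof.
apply: smoothM; first exact: smooth_cst.
exact: (smooth_comp1 sTheta eps_root_smooth).
Qed.

Lemma gauge_speedP c : 0 < c + eps ->
  is_derive c (1 : R) (fun c => kap * Theta (eps_root c)) (gauge_speed c).
Proof.
move=> ce.
have d0 : is_derive c (1 : R) (fun c => c + eps) 1.
  by apply: (is_derive_eq (is_deriveD (is_derive_id c (1 : R)) (is_derive_cst eps c 1))); rewrite addr0.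
have d1 := @is_derive1_comp R (@ln R) (fun c => c + eps) c _ _ (is_derive1_ln ce) d0.
have d2 : is_derive c (1 : R) (fun c => k%:R^-1 * ln (c + eps)) (k%:R^-1 * (c + eps)^-1).
  by apply: (is_derive_eq (is_deriveZ (k%:R^-1) d1)); rewrite mulr1.
have d3 := @is_derive1_comp R (@expR R) _ c _ _ (is_derive_expR _) d2.
have d4 := @is_derive1_comp R Theta _ c _ _ (hTheta (eps_root c)) d3.
exact: (is_derive_eq (is_deriveZ kap d4)).
Qed.

Lemma gauge_ham_vf z : hamvf gauge_ham z =
  row_mx (gauge_speed (gauge_sum z) *: dpsum k lbs (rsubmx z))
         (- gauge_speed (gauge_sum z) *: dpsum k las (lsubmx z)).
Proof.
have dG := smooth_differentiable z gauge_sum_smooth.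
have hK := gauge_speedP (gauge_sum_eps z).
have [dK _] := derive1_line 1 hK.
have hD v : 'D_v gauge_ham z = gauge_speed (gauge_sum z) * 'D_v gauge_sum z.
  rewrite deriveE; last exact: (differentiable_comp dG dK).
  rewrite (diff_comp dG dK) /= -(deriveE v dG) -deriveE //.
  by have [_ ->] := derive1_line ('D_v gauge_sum z) hK; rewrite mulrC.
have dotd (w : 'rV[R]_n) i : dotv w (delta_mx 0 i) = w 0 i.
  rewrite /dotv (bigD1 i) //= big1 ?addr0 => [|j ji]; rewrite mxE !eqxx ?mulr1 //=.
  by rewrite (negbTE ji) mulr0.
have -> : hamvf gauge_ham z = hamJ (row_mx (gauge_speed (gauge_sum z) *: dpsum k las (lsubmx z))
    (gauge_speed (gauge_sum z) *: dpsum k lbs (rsubmx z))); last by rewrite hamJ_row_mx scaleNr.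
rewrite hamvfE; congr hamJ; apply/rowP => j; rewrite mxE hD.
have [_ ->] := gauge_sum_derive z (delta_mx 0 j).
have [i|i] := split_ordP j => ->.
  rewrite row_mxEl mxE; congr (_ * _).
  have -> : lsubmx (delta_mx 0 (lshift n i) : V) = delta_mx 0 i.
    by apply/rowP => l; rewrite !mxE eq_lshift.
  have -> : rsubmx (delta_mx 0 (lshift n i) : V) = 0.
    by apply/rowP => l; rewrite !mxE eq_rlshift andbF.
  by rewrite dotv0r addr0 dotd.
rewrite row_mxEr mxE; congr (_ * _).
have -> : lsubmx (delta_mx 0 (rshift n i) : V) = 0.
  by apply/rowP => l; rewrite !mxE eq_lrshift andbF.
have -> : rsubmx (delta_mx 0 (rshift n i) : V) = delta_mx 0 i.
  by apply/rowP => l; rewrite !mxE eq_rshift.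
by rewrite dotv0r add0r dotd.
Qed.

Lemma dpsum_eq0 l (x : 'rV[R]_n) : psum k l x <= 0 -> dpsum k l x = 0.
Proof.
rewrite /psum /dpsum; elim: l => [|a l IH]; first by rewrite !big_nil.
have h1 : 0 <= dotv a x ^+ (2 * k) by rewrite exprM exprn_ge0 // sqr_ge0.
have h2 := psum_ge0 l x.
rewrite !big_cons => h; rewrite IH ?addr0; last by move: h; rewrite /psum in h2 *; lra.
have : dotv a x ^+ (2 * k) == 0 by rewrite eq_le h1 andbT; move: h; rewrite /psum in h2; lra.
rewrite expf_eq0 => /andP[_ /eqP ->].
by rewrite expr0n; case: k k0 => [|[|m]] //= _; rewrite mulr0 scale0r.
Qed.

Lemma apsum_le l (x : 'rV[R]_n) mu : 0 <= mu ->
  mu * apsum k l x <= (2 * k).-1%:R * psum k l x + (size l)%:R * mu ^+ (2 * k).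
Proof.
move=> mu0; rewrite /apsum /psum; elim: l => [|a l IH]; first by rewrite !big_nil !mulr0 mul0r addr0.
rewrite !big_cons /= -natr1.
have e : (2 * k)%N = (2 * k).-1.+1 by rewrite prednK // muln_gt0.
have := young_pow (2 * k).-1 (normr_ge0 (dotv a x)) mu0.
rewrite -e [`|_| ^+ (2 * k)]exprM real_normK ?num_real // -exprM.
move: IH; lra.
Qed.

Variable q : R.
Hypotheses (q0 : 0 <= q) (hq : forall a b, a \in las -> b \in lbs -> `|dotv b a| <= q).
Local Notation nterms := ((size las + size lbs).+1%:R : R).
Hypothesis slow : kap * q * expR (k%:R^-1 * ln nterms) < 4.

(** [gauge_sum] is a constant [c] on the orbit, so the orbit solves the system of
    [closed_orbit_period]. Unless it is constant, this bounds [T] from below, and the bound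
    [kap * c^(1/k)] on [|gauge_speed c| * k * c] then contradicts [slow] for [T <= 1]. *)
Lemma gauge_ham_no_fast_orbit g T : 0 < T -> T <= 1 -> periodic_solution gauge_ham g T ->
  forall t s, g t = g s.
Proof.
move=> T0 T1 [dg [vg gT]].
pose x t := lsubmx (g t); pose p t := rsubmx (g t); pose lam t := gauge_speed (gauge_sum (g t)).
have hg t : is_derive t (1 : R) g (row_mx (lam t *: dpsum k lbs (p t)) (- lam t *: dpsum k las (x t))).
  by apply: DeriveDef => //; rewrite -derive1E vg gauge_ham_vf.
have hx t : is_derive t (1 : R) x (lam t *: dpsum k lbs (p t)).
  apply: is_derive_rV => i; have := is_derive_coord (lshift n i) (hg t); rewrite row_mxEl.
  by have -> : (fun t => x t 0 i) = (fun t => g t 0 (lshift n i)) by apply/funext => u; rewrite mxE.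
have hp t : is_derive t (1 : R) p (- lam t *: dpsum k las (x t)).
  apply: is_derive_rV => i; have := is_derive_coord (rshift n i) (hg t); rewrite row_mxEr.
  by have -> : (fun t => p t 0 i) = (fun t => g t 0 (rshift n i)) by apply/funext => u; rewrite mxE.
have cG t s : gauge_sum (g t) = gauge_sum (g s).
  apply: (@is_derive_0_is_cst R (fun t => gauge_sum (g t))) => u.
  have d1 := is_derive_psum las (fun i => is_derive_coord i (hx u)).
  have d2 := is_derive_psum lbs (fun i => is_derive_coord i (hp u)).
  apply: (is_derive_eq (is_deriveD d1 d2)).
  by rewrite !dotvZr (dotvC (dpsum k lbs _)); ring.
have gcst : (forall t, lam t *: dpsum k lbs (p t) = 0) -> (forall t, lam t *: dpsum k las (x t) = 0) ->
    forall t s, g t = g s.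
  move=> h1 h2 t s; apply/rowP => i; apply: (@is_derive_0_is_cst R (fun t => g t 0 i)) => u.
  have := is_derive_coord i (hg u); rewrite scaleNr h1 h2 oppr0.
  by rewrite row_mx0 [X in is_derive _ _ _ X]mxE.
pose c := gauge_sum (g 0).
have hc t : psum k las (x t) + psum k lbs (p t) = c by exact: cG.
have lamE t : lam t = gauge_speed c by rewrite /lam (cG t 0).
have [l0|ln0] := eqVneq (gauge_speed c) 0.
  by apply: gcst => t; rewrite lamE l0 scale0r.
have [c0|c0] := lerP c 0.
  by apply: gcst => t; rewrite dpsum_eq0 ?scaler0 //; have := hc t;
     have := psum_ge0 las (x t); have := psum_ge0 lbs (p t); lra.
exfalso.
(* [(c / nterms) ^ (1 / 2k)]: with this weight the error terms of Young's inequality add up to at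
   most [c], and the two [apsum] to at most [2 k c / mu]. *)
pose mu := expR ((2 * k)%:R^-1 * (ln c - ln nterms)).
have mu0 : 0 < mu by exact: expR_gt0.
have kn0 : k%:R != 0 :> R by rewrite pnatr_eq0 -lt0n.
have muk : mu ^+ (2 * k) = c / nterms.
  rewrite /mu -expRM_natl mulrA divff ?mul1r; last by rewrite pnatr_eq0 muln_eq0 /= -lt0n.
  by rewrite expRD expRN !lnK ?posrE.
have mu2 : mu ^+ 2 * expR (k%:R^-1 * ln nterms) = expR (k%:R^-1 * ln c).
  rewrite /mu -expRM_natl -expRD; congr expR; rewrite natrM; field; exact: kn0.
have hD t : apsum k las (x t) + apsum k lbs (p t) <= (2 * k)%:R * c / mu.
  rewrite ler_pdivlMr // mulrC mulrDr.
  have h1 := apsum_le las (x t) (ltW mu0); have h2 := apsum_le lbs (p t) (ltW mu0).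
  apply: le_trans (lerD h1 h2) _; rewrite muk.
  have e : (2 * k)%:R = (2 * k).-1%:R + 1 :> R by rewrite natr1 prednK // muln_gt0.
  have hN : (size las)%:R * (c / nterms) + (size lbs)%:R * (c / nterms) <= c.
    rewrite -mulrDl -natrD mulrA ler_pdivrMr // mulrC ler_wpM2l ?(ltW c0) // ler_nat.
    exact: leqnSn.
  move: hN; have := hc t; rewrite e.
  set P1 := psum _ _ _; set P2 := psum _ _ _; move=> eP hN; rewrite -eP in hN *.
  move: hN; set A := _ * (_ / _); set B := _ * (_ / _); lra.
have hx' t : is_derive t (1 : R) x (gauge_speed c *: dpsum k lbs (p t)) by rewrite -(lamE t).
have hp' t : is_derive t (1 : R) p (- gauge_speed c *: dpsum k las (x t)) by rewrite -(lamE t).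
have xT : x T = x 0 by rewrite /x -[T]add0r gT.
have pT : p T = p 0 by rewrite /p -[T]add0r gT.
have main := closed_orbit_period q0 hq hx' hp' hc T0 xT pT hD.
have lam0 : 0 < `|gauge_speed c| by rewrite normr_gt0.
have ce : 0 < c + eps by rewrite addr_gt0.
have k0' : 0 < k%:R :> R by rewrite ltr0n.
have lam_le : `|gauge_speed c| * (k%:R * c) <= kap * expR (k%:R^-1 * ln c).
  have Nc : eps_root c * c <= expR (k%:R^-1 * ln c) * (c + eps).
    rewrite /eps_root -{2}[c]lnK ?posrE // -[X in _ <= _ * X]lnK ?posrE // -!expRD ler_expR.
    have hk : k%:R^-1 <= 1 :> R by rewrite invf_le1 // ler1n.
    have hl : ln c <= ln (c + eps) by rewrite ler_ln ?posrE // lerDl ltW.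
    nra.
  have -> : kap * expR (k%:R^-1 * ln c) = kap * (1 * (expR (k%:R^-1 * ln c) * (c + eps) * (c + eps)^-1)).
    by rewrite mul1r mulfK ?gt_eqF.
  have -> : `|gauge_speed c| * (k%:R * c) = kap * (`|dTheta (eps_root c)| * (eps_root c * c * (c + eps)^-1)).
    have eN : 0 < eps_root c by exact: expR_gt0.
    have pk : 0 < k%:R^-1 * (c + eps)^-1 by rewrite mulr_gt0 ?invr_gt0.
    rewrite /gauge_speed 3!normrM (gtr0_norm kap0) (gtr0_norm eN) (gtr0_norm pk).
    by field; rewrite kn0 gt_eqF.
  rewrite ler_pM2l //; apply: ler_pM => //.
    by rewrite !mulr_ge0 ?invr_ge0 ?expR_ge0 // ltW.
  by rewrite ler_pM2r // invr_gt0.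
have main2 : 4 * mu ^+ 2 <= q * `|gauge_speed c| * T * (k%:R * c).
  set l := `|gauge_speed c| in lam0 main *.
  have P0 : 0 < 4 * (k%:R * c * l * T) by rewrite !mulr_gt0.
  rewrite -(ler_pM2l P0).
  have -> : 4 * (k%:R * c * l * T) * (q * l * T * (k%:R * c)) = q * (l * ((2 * k)%:R * c / mu) * T) ^+ 2 * mu ^+ 2.
    by rewrite natrM; field; rewrite gt_eqF.
  apply: le_trans (_ : 16 * (k%:R * c * l * T) * mu ^+ 2 <= _); first by rewrite le_eqVlt; apply/orP; left; apply/eqP; ring.
  by rewrite ler_wpM2r // sqr_ge0.
have : 4 * mu ^+ 2 <= q * (kap * expR (k%:R^-1 * ln c)).
  apply: le_trans main2 _.
  have -> : q * `|gauge_speed c| * T * (k%:R * c) = q * (`|gauge_speed c| * (k%:R * c)) * T by ring.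
  have h : q * (`|gauge_speed c| * (k%:R * c)) <= q * (kap * expR (k%:R^-1 * ln c)) by exact: ler_wpM2l.
  apply: le_trans h; apply: ler_piMr T1.
  by rewrite !mulr_ge0 // ltW.
rewrite -mu2; apply/negP; rewrite -ltNge.
have -> : q * (kap * (mu ^+ 2 * expR (k%:R^-1 * ln nterms))) = kap * q * expR (k%:R^-1 * ln nterms) * mu ^+ 2 by ring.
by rewrite ltr_pM2r // exprn_gt0.
Qed.

End LagrangianHamiltonian.

Lemma bernoulli (R : realDomainType) (x : R) m : 0 <= x -> x <= 1 -> 1 - m%:R * x <= (1 - x) ^+ m.
Proof.
move=> x0 x1; elim: m => [|m IH]; first by rewrite mul0r subr0 expr0.
rewrite exprS -natr1; have : 0 <= m%:R :> R by [].
have h : 0 <= 1 - x by lra.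
have := ler_wpM2l h IH; nra.
Qed.

Lemma lee_of_lt (R : realType) (u : R) (z : \bar R) : 0 < u ->
  (forall c, 0 < c -> c < u -> (c%:E <= z)%E) -> (u%:E <= z)%E.
Proof.
move=> u0 h; case: z h => [r| |] h.
- rewrite lee_fin leNgt; apply/negP => ru.
  have [r0|r0] := lerP r 0.
    by have := h (u / 2) ltac:(lra) ltac:(lra); rewrite lee_fin; lra.
  by have := h ((r + u) / 2) ltac:(lra) ltac:(lra); rewrite lee_fin; lra.
- exact: leey.
- by have := h (u / 2) ltac:(lra) ltac:(lra).
Qed.

Section LowerBound.
Variables (R : realType) (n : nat).
Local Notation V := 'rV[R]_n.

Lemma psum_term k (l : seq V) (x : V) a : a \in l -> dotv a x ^+ (2 * k) <= psum k l x.
Proof.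
rewrite /psum; elim: l => // b l IH; rewrite inE big_cons => /orP[/eqP <-|/IH h].
  by rewrite lerDl; exact: psum_ge0.
by apply: le_trans h _; rewrite lerDr exprM exprn_ge0 // sqr_ge0.
Qed.

Lemma hpolar_body (X : set V) : convex_body X -> centrally_symmetric X ->
  compact (hpolar 1 X) /\ exists2 rho : R, 0 < rho & forall v, `|v| <= rho -> hpolar 1 X v.
Proof.
move=> bX sX; have [rho rho0 hrho] := symmetric_body_ball bX sX.
have [cX _] := bX; split.
  apply: (subclosed_compact _ (@rV_ball_compact R n rho^-1 _)); first exact: hpolar_closed.
    by rewrite invr_ge0 ltW.
  move=> p hp /=; rewrite -[rho^-1]mulr1 ler_pdivlMl //.
  by apply: ball_dotv_le hrho _ => // y Xy; rewrite dotvC; exact: hp.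
have [B B0 hB] := compact_sup cX (@norm_continuous _ V).
have nB : 0 < n%:R * B + 1 by rewrite ltr_wpDl // mulr_ge0.
exists (n%:R * B + 1)^-1; first by rewrite invr_gt0.
move=> v hv x Xx; apply: le_trans (ler_norm _) _; apply: le_trans (dotv_le _ _) _.
have xB : `|x| <= B by have := hB x Xx; rewrite normr_id.
apply: (@le_trans _ _ (n%:R * ((n%:R * B + 1)^-1 * B))); first by rewrite ler_wpM2l // ler_pM.
by rewrite mulrCA mulrC ler_pdivrMr // mul1r lerDl.
Qed.

Lemma bipolar (X : set V) x : convex_body X -> X 0 ->
  (forall y, hpolar 1 X y -> dotv y x <= 1) -> X x.
Proof.
move=> [cX [vX _]] X0 h; apply: contrapT => nx.
have [v [hv]] := compact_convex_separation cX vX X0 nx.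
by apply/negP; rewrite -leNgt; apply: h => y; exact: hv.
Qed.

Theorem c_HZ_ge (X P : set V) (s : R) : 0 < s ->
  convex_body X -> centrally_symmetric X -> convex_body P -> centrally_symmetric P ->
  hpolar s X `<=` P -> ((4 * s)%:E <= c_HZ (prodXP X P))%E.
Proof.
move=> s0 bX sX bP sP XP; apply: lee_of_lt => [|c c0 cs]; first by rewrite mulr_gt0.
pose u := c / (4 * s).
have u0 : 0 < u by rewrite divr_gt0 // mulr_gt0.
have u1 : u < 1 by rewrite ltr_pdivrMr ?mul1r // mulr_gt0.
(* Six factors [th] are lost below, four in the height of the cutoff, one in [kap] and one in
   [E * th <= 1]; Bernoulli's inequality gives [th ^ 6 >= u]. *)
pose th := 1 - (1 - u) / 6.
have th0 : 0 < th by rewrite /th; lra.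
have th1 : th < 1 by rewrite /th; lra.
have cth : c <= 4 * s * th ^+ 6.
  have -> : c = 4 * s * u by rewrite /u mulrC divfK // gt_eqF // mulr_gt0.
  rewrite ler_pM2l ?mulr_gt0 //; have := @bernoulli R ((1 - u) / 6) 6 ltac:(lra) ltac:(lra).
  by rewrite -/th; apply: le_trans; lra.
have [rX rX0 hrX] := symmetric_body_ball bX sX.
have [cX _] := bX; have [cP _] := bP.
have X0 : X 0 by apply: hrX; rewrite normr0 ltW.
have [cY [rY rY0 hrY]] := hpolar_body bX sX.
have [las las_in las_net] := finite_norming_net cY rY0 hrY th0 th1.
have [bs bs_in bs_net] := finite_norming_net cX rX0 hrX th0 th1.
(* The factor [s^-1] makes the unit body of these forms the polar for [s]; it is also the source of
   the pairing bound [q = s^-1]. *)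
pose lbs := [seq s^-1 *: b | b <- bs].
have si0 : 0 <= s^-1 by rewrite invr_ge0 ltW.
have hq a b : a \in las -> b \in lbs -> `|dotv b a| <= s^-1.
  move=> /las_in ha /mapP[b' /bs_in hb ->]; rewrite dotvZl normrM ger0_norm //.
  apply: ler_piMr => //; rewrite dotvC ler_norml ha // andbT lerNl -dotvNr.
  by apply: ha; exact: centrally_symmetricN.
pose nt : R := (size las + size lbs).+1%:R.
have nt1 : 1 <= nt by rewrite ler1n.
have lth : 0 < - ln th by rewrite oppr_gt0 ln_lt0 // th0.
(* The number of forms enters as [nt ^ (1 / k)]; this [k] brings it down to at most [1 / th]. *)
pose k := (Num.truncn (ln nt / - ln th)).+1.
have k0 : (0 < k)%N by [].
have kR0 : 0 < k%:R :> R by rewrite ltr0n.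
pose E := expR (k%:R^-1 * ln nt).
have E0 : 0 < E by exact: expR_gt0.
have Eth : E * th <= 1.
  rewrite /E -[X in _ * X <= _]lnK ?posrE // -expRD -[X in _ <= X]expR0 ler_expR -lerBrDr sub0r.
  rewrite mulrC ler_pdivrMr // mulrC -ler_pdivrMr //.
  by rewrite /k -natr1; apply/ltW; rewrite natr1; exact: truncnS_gt.
have th43 : th ^+ 4 < th ^+ 3 by rewrite exprS gtr_pMl // exprn_gt0.
have th32 : th ^+ 3 < th ^+ 2 by rewrite exprS gtr_pMl // exprn_gt0.
have [Th [dTh [a [m [[sTh hTh dTh1 a0] [Lm Tha Thb Th01]]]]]] :=
  smooth_cutoff (exprn_ge0 4 (ltW th0)) th43.
have m0 : 0 < m by apply: lt_le_trans Lm; rewrite exprn_gt0.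
have ab : a < th ^+ 3.
  by rewrite ltNge; apply/negP => /Thb; rewrite Tha // => m00; rewrite m00 ltxx in m0.
pose kap := 4 * s * th / E.
have kap0 : 0 < kap by rewrite divr_gt0 // !mulr_gt0.
have slow : kap * s^-1 * E < 4.
  have -> : kap * s^-1 * E = 4 * th by rewrite /kap; field; rewrite !gt_eqF.
  by rewrite gtr_pMr.
(* [eps ^ (1 / k) = a / 2] is the value of [N] at the origin, which thus lies in the open plateau
   [N < a]. *)
pose eps := expR (k%:R * ln (a / 2)).
have eps0 : 0 < eps by exact: expR_gt0.
pose H := gauge_ham k las lbs eps kap Th.
(* A [k]-th root of [2k]-th powers approximates the square of the gauge, so [N < th ^ 2] bounds each
   form by [th]. *)
pose N (z : 'rV[R]_(n + n)) := eps_root k eps (gauge_sum k las lbs z).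
have Nc : continuous N.
  move=> z; apply: differentiable_continuous; apply: smooth_differentiable.
  exact: eps_root_smooth.
have oN r : open [set z | N z < r].
  have -> : [set z | N z < r] = N @^-1` [set t | t < r] by [].
  by apply: open_comp; [move=> z _; exact: Nc|exact: open_lt].
have NO z : N z < th ^+ 2 -> prodXP X P z.
  move=> Nz; have y0 := gauge_sum_eps k las lbs eps0 z.
  have Gz : gauge_sum k las lbs z < th ^+ (2 * k).
    apply: lt_trans (_ : gauge_sum k las lbs z + eps < _); first by rewrite ltrDl.
    have -> : gauge_sum k las lbs z + eps = N z ^+ k.
      by rewrite /N /eps_root -expRM_natl mulrA divff ?mul1r ?lnK ?posrE // gt_eqF.
    by rewrite exprM ltrXn2r ?expR_ge0 // -lt0n.
  have bound (b y : V) : dotv b y ^+ (2 * k) <= gauge_sum k las lbs z -> `|dotv b y| <= th.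
    move=> h; rewrite leNgt; apply/negP => lt.
    have : th ^+ (2 * k) < `|dotv b y| ^+ (2 * k).
      by rewrite ltrXn2r ?(ltW th0) // muln_eq0 /= -lt0n.
    by rewrite [`|_| ^+ (2 * k)]exprM real_normK ?num_real // -exprM ltNge (le_trans h (ltW Gz)).
  have := psum_ge0 k las (lsubmx z); have := psum_ge0 k lbs (rsubmx z).
  move=> g1 g2; split.
    apply: bipolar => // y hy; apply: las_net hy => b bl; apply: bound.
    by apply: le_trans (psum_term k _ bl) _; rewrite lerDl.
  apply: XP => y Xy.
  have : dotv y (s^-1 *: rsubmx z) <= 1.
    apply: bs_net Xy => b bl; rewrite dotvZr -dotvZl; apply: bound.
    by apply: le_trans (psum_term k _ (map_f _ bl)) _; rewrite lerDr.
  by rewrite dotvZr mulrC ler_pdivrMr // mul1r dotvC.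
have sub_int z : N z < th ^+ 2 -> (prodXP X P)° z.
  move=> Nz; have nb : nbhs z [set z | N z < th ^+ 2] by apply: open_nbhs_nbhs; split=> //; exact: oN.
  by apply: filterS nb => y; exact: NO.
have [BX BX0 hBX] := compact_sup cX (@norm_continuous _ V).
have [BP BP0 hBP] := compact_sup cP (@norm_continuous _ V).
have bO z : prodXP X P z -> `|z| <= BX + BP.
  move=> [Xz Pz]; apply: rV_norm_le => [|i]; first exact: addr_ge0.
  have := hBX _ Xz; have := hBP _ Pz; rewrite !normr_id => hp hx.
  have [j|j] := split_ordP i => ->.
    by have := rV_coord_le (lsubmx z) j; rewrite mxE; lra.
  by have := rV_coord_le (rsubmx z) j; rewrite mxE; lra.
have N0 : N 0 = a / 2.
  have -> : N 0 = expR (k%:R^-1 * ln eps).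
    rewrite /N /eps_root /gauge_sum; congr (expR (_ * ln _)).
    have psum0 l : psum k l 0 = 0 :> R.
      by rewrite /psum big1 // => b _; rewrite dotv0r expr0n muln_eq0.
    have -> : lsubmx (0 : 'rV[R]_(n + n)) = 0 by apply/rowP => i; rewrite !mxE.
    have -> : rsubmx (0 : 'rV[R]_(n + n)) = 0 by apply/rowP => i; rewrite !mxE.
    by rewrite !psum0 !add0r.
  by rewrite /eps expRK mulrA mulVf ?gt_eqF // mul1r lnK // posrE divr_gt0.
apply: (@le_trans _ _ (kap * m)%:E).
  rewrite lee_fin; apply: le_trans cth _.
  apply: (@le_trans _ _ (4 * s * th * th * m)).
    have -> : 4 * s * th ^+ 6 = 4 * s * th * th * th ^+ 4 by ring.
    by rewrite ler_wpM2l // !mulr_ge0 // ltW.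
  rewrite ler_pM2r // /kap ler_pdivlMr // -[leRHS]mulr1.
  have -> : 4 * s * th * th * E = 4 * s * th * (E * th) by ring.
  by rewrite ler_wpM2l // !mulr_ge0 // ltW.
apply: ereal_sup_ubound; exists (kap * m) => //; exists H; split.
- exact: gauge_ham_smooth.
- exists [set z | N z <= th ^+ 3]; split.
  + apply: (subclosed_compact _ (@rV_ball_compact R (n + n) (BX + BP) _)); last first.
    * by move=> z /= Nz; apply: bO; apply: NO; exact: le_lt_trans th32.
    * exact: addr_ge0.
    * have -> : [set z | N z <= th ^+ 3] = N @^-1` [set t | t <= th ^+ 3] by [].
      by apply: closed_comp; [move=> z _; exact: Nc|exact: closed_le].
  + by move=> z /= Nz; apply: sub_int; exact: le_lt_trans th32.
  + move=> z /= /negP; rewrite -ltNge => /ltW /Thb h.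
    by rewrite /H /gauge_ham h mulr0.
- exists [set z | N z < a]; split.
  + exact: oN.
  + by exists 0; rewrite /= N0; lra.
  + by move=> z /= Nz; apply: NO; apply: lt_trans Nz _; apply: lt_trans th32.
  + by move=> z /= Nz; rewrite /H /gauge_ham Tha // ltW.
- move=> z; have /andP[h1 h2] := Th01 (N z); split; first by rewrite mulr_ge0 // ltW.
  by rewrite /H /gauge_ham ler_pM2l.
- by move=> g T; exact: (gauge_ham_no_fast_orbit k0 eps0 kap0 hTh dTh1 si0 hq slow).
Qed.

End LowerBound.

(** * Upper bound for c_max *)

Section AreaFunction.
Variable R : realType.

(* [w] majorizes the half-width [sqrt (1 - t^2)] of the unit disc, so a primitive
   of [w] grows on [0, 1] by at least the area pi/4 of the quarter disc. *)
Lemma smooth_half_disc (e : R) : 0 < e -> exists (w G : R -> R) (d : R),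
  [/\ smooth w, (forall t, is_derive t (1 : R) G (w t)), 0 < d & forall t, d <= w t] /\
  [/\ forall t, `|t| <= 1 -> w t ^+ 2 <= 1 - t ^+ 2 + e, pi / 4 <= G 1 & G (-1) <= - (pi / 4)].
Proof.
move=> e0.
(* Its fourth root is a smooth positive majorant of [sqrt |1 - t^2|] on the whole line. *)
pose q (t : R) := (1 + -1 * t ^+ 2) ^+ 2 + e ^+ 2.
have q0 t : 0 < q t by rewrite ltr_wpDl ?sqr_ge0 // exprn_gt0.
have sq : smooth q.
  apply: smoothD; last exact: smooth_cst.
  apply: smoothX; apply: smoothD; first exact: smooth_cst.
  by apply: smoothM; [exact: smooth_cst|apply: smoothX; exact: smooth_id].
pose w (t : R) := expR (4^-1 * ln (q t)).
have sw : smooth w.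
  apply: (smooth_comp1 (@smooth_expR R)); apply: smoothM; first exact: smooth_cst.
  exact: smooth_ln.
have w0 t : 0 < w t by exact: expR_gt0.
have w4 t : w t ^+ 4 = q t by rewrite /w -expRM_natl mulrA divff // mul1r lnK // posrE.
have w_ge t r : 0 <= r -> r ^+ 4 <= q t -> r <= w t.
  move=> r0 h; rewrite leNgt; apply/negP => lt.
  by have := ltrXn2r 4 (ltW (w0 t)) lt; rewrite w4 /= ltNge h.
have [G0 dG0] := continuous_antiderivative (fun x => differentiable_continuous (smooth_differentiable x sw)).
pose G t := G0 t - G0 0.
have dG t : is_derive t (1 : R) G (w t).
  by apply: (is_derive_eq (is_deriveB (dG0 t) (is_derive_cst (G0 0) t 1))); rewrite subr0.
have wsin t : `|cos t| <= w (sin t).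
  apply: w_ge => //.
  have -> : `|cos t| ^+ 4 = (cos t ^+ 2) ^+ 2 by rewrite -exprM -normrX ger0_norm // (exprM _ 2 2) sqr_ge0.
  by rewrite cos2sin2 /q mulN1r lerDl sqr_ge0.
(* Under the substitution [sin t] the area becomes the integral of [cos^2], with primitive
   [(t + sin t * cos t) / 2]. *)
pose h (t : R) := G (sin t) - 2^-1 * (t + sin t * cos t).
have dh t : is_derive t (1 : R) h (w (sin t) * cos t - cos t ^+ 2).
  have d1 := @is_derive1_comp R G (@sin R) t _ _ (dG (sin t)) (is_derive_sin t).
  have d2 := is_deriveM (is_derive_sin t) (is_derive_cos t).
  apply: (is_derive_eq (is_deriveB d1 (is_deriveZ (2^-1 : R) (is_deriveD (is_derive_id t (1 : R)) d2)))).
  by rewrite /GRing.scale /= mulrN -!expr2 sin2cos2; field.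
have h0 : h 0 = 0 by rewrite /h sin0 mul0r addr0 mulr0 subr0 /G subrr.
have pi0 := pi_gt0 R.
have dh0 t : - (pi / 2) <= t <= pi / 2 -> 0 <= w (sin t) * cos t - cos t ^+ 2.
  move=> ht; have c0 : 0 <= cos t by exact: cos_ge0_pihalf.
  have := wsin t; rewrite ger0_norm // => hw.
  by rewrite expr2 -mulrBl mulr_ge0 // subr_ge0.
exists w, G, (expR (4^-1 * ln (e ^+ 2))); split; split=> //.
- exact: expR_gt0.
- move=> t; rewrite ler_expR ler_pM2l ?invr_gt0 // ler_ln ?posrE ?exprn_gt0 //.
  by rewrite lerDr sqr_ge0.
- move=> t t1; have t2 : 0 <= 1 - t ^+ 2 by rewrite subr_ge0 -real_normK ?num_real // exprn_ile1.
  rewrite -(@ler_pXn2r _ 2) ?nnegrE ?sqr_ge0 //; last by rewrite addr_ge0 // ltW.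
  rewrite -exprM w4 /q mulN1r; nra.
- have : h 0 <= h (pi / 2).
    apply: (is_derive_nondecreasing _ (fun x _ => dh x)) => [|t /andP[t0 t1]]; first by lra.
    by apply: dh0; lra.
  by rewrite h0 /h sin_pihalf cos_pihalf; lra.
- have : h (- (pi / 2)) <= h 0.
    apply: (is_derive_nondecreasing _ (fun x _ => dh x)) => [|t /andP[t0 t1]]; first by lra.
    by apply: dh0; lra.
  by rewrite h0 /h sinN cosN sin_pihalf cos_pihalf; lra.
Qed.

(** The inverse solves [phi' = 1 / w (phi)], so [smooth_autonomous] applies; the lower bound [d] on
    the slope makes [G] surjective. *)
Lemma smooth_inverse (w G : R -> R) (d : R) : smooth w -> (forall t, is_derive t (1 : R) G (w t)) ->
  0 < d -> (forall t, d <= w t) ->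
  exists phi : R -> R, [/\ cancel G phi, cancel phi G, smooth phi &
    forall y, is_derive y (1 : R) phi (w (phi y))^-1].
Proof.
move=> sw dG d0 dw.
have Gc := is_derive_continuous dG.
have Gd a b : a <= b -> d * (b - a) <= G b - G a.
  move=> ab; have [c _ ->] := is_derive_mvt ab (fun x _ => dG x).
  by rewrite ler_wpM2r // subr_ge0.
have Glt a b : a < b -> G a < G b.
  move=> ab; rewrite -subr_gt0; apply: lt_le_trans (Gd _ _ (ltW ab)).
  by rewrite mulr_gt0 // subr_gt0.
have Ginj : injective G.
  move=> a b e; have [/Glt|/Glt|//] := ltgtP a b; by rewrite e ltxx.
have Gsurj y : exists x, G x = y.
  pose M := `|y - G 0| / d.
  have M0 : 0 <= M by rewrite divr_ge0 // ltW.
  have Md : d * M = `|y - G 0| by rewrite /M mulrC divfK // gt_eqF.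
  have h1 := Gd 0 M M0; have := Gd (- M) 0 ltac:(by rewrite oppr_le0).
  rewrite subr0 in h1; rewrite sub0r opprK => h2; rewrite Md in h1 h2.
  have h3 := ler_norm (y - G 0); have h4 : - (y - G 0) <= `|y - G 0| by rewrite -normrN ler_norm.
  have MM : - M <= M by lra.
  have [||c _ hc] := @IVT R G (- M) M y MM; [exact: continuous_subspaceT| |by exists c].
  by rewrite min_l ?max_r; lra.
pose phi y := projT1 (cid (Gsurj y)).
have phiK : cancel phi G by move=> y; rewrite /phi; case: cid.
have GK : cancel G phi by move=> x; apply: Ginj; rewrite phiK.
have w0 t : w t != 0 by rewrite gt_eqF // (lt_le_trans d0).
have dphi y : is_derive y (1 : R) phi (w (phi y))^-1.
  rewrite -{1}[y]phiK; apply: is_derive_inverse => //.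
  - by apply: filterE => x; exact: GK.
  - by apply: filterE => x; exact: Gc.
exists phi; split=> //.
by apply: (smooth_autonomous dphi); exact: smooth_inv.
Qed.

End AreaFunction.

(** * Linear symplectic maps and cotangent lifts *)

Section SymplecticMaps.
Variables (R : realType) (n : nat).
Local Notation V := 'rV[R]_(n + n).

Lemma sigmaE (u v : V) : sigma u v =
  \sum_(i < n) (v 0 (lshift n i) * u 0 (rshift n i) - v 0 (rshift n i) * u 0 (lshift n i)).
Proof.
have -> : sigma u v = - dotv (hamJ v) u.
  rewrite /sigma /hamJ Jmx_tr mulmxN dotvNl opprK /dotv mxE.
  by apply: eq_bigr => i _; rewrite [_^T _ _]mxE.
rewrite dotv_split -big_split -sumrN.
by apply: eq_bigr => i _; rewrite hamJ_l hamJ_r /= opprD mulNr opprK addrC.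
Qed.

Lemma symplectomorphism_comp (f h : V -> V) :
  symplectomorphism f -> symplectomorphism h -> symplectomorphism (fun z => f (h z)).
Proof.
move=> [f' [ff' f'f sf sf' sigf]] [h' [hh' h'h sh sh' sigh]].
exists (fun z => h' (f' z)); split; [by move=> z; rewrite ff'|by move=> z; rewrite h'h| | |].
- exact: smooth_comp_rV.
- exact: smooth_comp_rV.
- move=> z u v.
  have dh := smooth_differentiable z sh; have df := smooth_differentiable (h z) sf.
  have e w : 'D_w (fun z => f (h z)) z = 'D_('D_w h z) f (h z).
    rewrite deriveE; last exact: (differentiable_comp (g := f)).
    rewrite (deriveE w dh).
    rewrite (deriveE _ df).
    exact: (congr1 (fun L : V -> V => L w) (diff_comp dh df)).
  by rewrite (e u) (e v) sigf sigh.
Qed.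

Lemma derive_mulmx (S : 'M[R]_(n + n)) z u : 'D_u (fun z : V => z *m S) z = u *m S.
Proof.
suff [] : is_derive z u (fun z : V => z *m S) (u *m S) by [].
apply: is_derive_rV => i; rewrite mxE.
have -> : (fun t : V => (t *m S) 0 i) = \sum_k ((fun t : V => t 0 k) * (fun=> S k i)).
  by apply/funext => t; rewrite fct_sumE mxE.
apply: (is_derive_eq (is_derive_sum (fun k => is_deriveM (is_derive_coordinate k z u) (is_derive_cst (S k i) z u)))).
by apply: eq_bigr => k _; rewrite scaler0 add0r mulrC.
Qed.

Lemma symplectomorphism_mulmx (S S' : 'M[R]_(n + n)) : S *m S' = 1%:M ->
  S *m Jmx R n *m S^T = Jmx R n -> symplectomorphism (fun z : V => z *m S).
Proof.
move=> SS' hS; have S'S := mulmx1C SS'.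
exists (fun z => z *m S'); split.
- by move=> z; rewrite -mulmxA SS' mulmx1.
- by move=> z; rewrite -mulmxA S'S mulmx1.
- exact: smooth_mulmx.
- exact: smooth_mulmx.
- move=> z u v; rewrite !derive_mulmx /sigma trmx_mul !mulmxA.
  by rewrite -(mulmxA v) -(mulmxA v) hS.
Qed.

Lemma symplectomorphism_block (A B : 'M[R]_n) : A *m B = 1%:M ->
  symplectomorphism (fun z : V => z *m block_mx A 0 0 B^T).
Proof.
move=> AB; have BA := mulmx1C AB.
apply: (@symplectomorphism_mulmx _ (block_mx B 0 0 A^T)).
  rewrite mulmx_block !mulmx0 !mul0mx !addr0 !add0r AB -trmx_mul AB trmx1.
  by rewrite -scalar_mx_block.
rewrite /Jmx tr_block_mx !trmx0 trmxK !mulmx_block !mulmx0 !mul0mx !addr0 !add0r !mulmx1.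
by rewrite !mul0mx mulmxN mulmx1 mulNmx -trmx_mul AB trmx1.
Qed.

Variable j : 'I_n.

(* The canonical lift of a coordinate change [phi] of the [j]-th position;
   [psi] stands for [1 / phi']. *)
Definition cotangent_lift (phi psi : R -> R) (z : V) : V :=
  \row_l (if l == lshift n j then phi (z 0 (lshift n j))
          else if l == rshift n j then z 0 (rshift n j) * psi (z 0 (lshift n j)) else z 0 l).

Lemma cotangent_lift_l phi psi z : cotangent_lift phi psi z 0 (lshift n j) = phi (z 0 (lshift n j)).
Proof. by rewrite mxE eqxx. Qed.

Lemma cotangent_lift_r phi psi z :
  cotangent_lift phi psi z 0 (rshift n j) = z 0 (rshift n j) * psi (z 0 (lshift n j)).
Proof. by rewrite mxE eq_rlshift eqxx. Qed.

Lemma cotangent_lift_other phi psi z l : l != lshift n j -> l != rshift n j ->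
  cotangent_lift phi psi z 0 l = z 0 l.
Proof. by rewrite mxE => /negbTE -> /negbTE ->. Qed.

Lemma cotangent_lift_smooth (phi psi : R -> R) : smooth phi -> smooth psi -> smooth (cotangent_lift phi psi).
Proof.
move=> sphi spsi; apply: smooth_rV => l.
have [->|ll] := eqVneq l (lshift n j).
  under eq_fun do rewrite cotangent_lift_l.
  by apply: smooth_comp1 => //; exact: smooth_coordinate.
have [->|lr] := eqVneq l (rshift n j).
  under eq_fun do rewrite cotangent_lift_r.
  apply: smoothM; first exact: smooth_coordinate.
  by apply: smooth_comp1 => //; exact: smooth_coordinate.
under eq_fun do rewrite cotangent_lift_other //.
exact: smooth_coordinate.
Qed.

(** In the [j]-th plane the derivative is triangular with diagonal entries [phi'] and [psi], of
    product 1; the term with [psi'] cancels by antisymmetry. *)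
Lemma cotangent_lift_sigma (phi psi : R -> R) z u v : smooth phi -> smooth psi ->
  (forall t, 'D_(1 : R) phi t * psi t = 1) ->
  sigma ('D_u (cotangent_lift phi psi) z) ('D_v (cotangent_lift phi psi) z) = sigma u v.
Proof.
move=> sphi spsi h.
have dl := diff_derivable (smooth_differentiable z (cotangent_lift_smooth sphi spsi)).
have comp (K : R -> R) w : smooth K ->
    is_derive z w (fun z : V => K (z 0 (lshift n j))) (w 0 (lshift n j) * 'D_1 K (z 0 (lshift n j))).
  move=> sK; have dK := smooth_differentiable (z 0 (lshift n j)) sK.
  have dc : differentiable (fun z : V => z 0 (lshift n j)) z by exact: differentiable_coord.
  have [_ dcE] := is_derive_coordinate (lshift n j) z w.
  apply: DeriveDef.
    by apply: diff_derivable; exact: (differentiable_comp (g := K)).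
  rewrite deriveE; last exact: (differentiable_comp (g := K)).
  rewrite (diff_comp dc dK) /= -(deriveE w dc) dcE -deriveE //.
  by have [_ ->] := derive1_line (w 0 (lshift n j)) (derivableP (@diff_derivable _ _ _ _ _ (1 : R) dK)).
have coord w l : 'D_w (cotangent_lift phi psi) z 0 l = 'D_w (fun z => cotangent_lift phi psi z 0 l) z.
  by rewrite derive_mx // mxE.
have eL w : 'D_w (cotangent_lift phi psi) z 0 (lshift n j) =
    w 0 (lshift n j) * 'D_1 phi (z 0 (lshift n j)).
  rewrite coord; under eq_fun do rewrite cotangent_lift_l.
  by have [_ ->] := comp phi w sphi.
have eR w : 'D_w (cotangent_lift phi psi) z 0 (rshift n j) =
    z 0 (rshift n j) * (w 0 (lshift n j) * 'D_1 psi (z 0 (lshift n j))) + psi (z 0 (lshift n j)) * w 0 (rshift n j).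
  rewrite coord; under eq_fun do rewrite cotangent_lift_r.
  by have [_ ->] := is_deriveM (is_derive_coordinate (rshift n j) z w) (comp psi w spsi).
have eO w l : l != lshift n j -> l != rshift n j -> 'D_w (cotangent_lift phi psi) z 0 l = w 0 l.
  move=> l1 l2; rewrite coord; under eq_fun do rewrite cotangent_lift_other //.
  by have [_ ->] := is_derive_coordinate l z w.
move: (eL u) (eR u) (eO u) (eL v) (eR v) (eO v).
move: ('D_u (cotangent_lift phi psi) z) ('D_v (cotangent_lift phi psi) z) => Du Dv eLu eRu eOu eLv eRv eOv.
rewrite !sigmaE (bigD1 j) //= [RHS](bigD1 j) //=; congr (_ + _).
  rewrite eLu eLv eRu eRv; have := h (z 0 (lshift n j)).
  set D := 'D_1 phi _; set P := psi _; set D' := 'D_1 psi _ => DP.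
  have -> : v 0 (rshift n j) * u 0 (lshift n j) = D * P * (v 0 (rshift n j) * u 0 (lshift n j)) by rewrite DP mul1r.
  have -> : v 0 (lshift n j) * u 0 (rshift n j) = D * P * (v 0 (lshift n j) * u 0 (rshift n j)) by rewrite DP mul1r.
  ring.
by apply: eq_bigr => i ij; rewrite !eOu ?eOv ?eq_lshift ?eq_rshift ?eq_lrshift ?eq_rlshift.
Qed.

Lemma cotangent_lift_symplectomorphism (phi G w : R -> R) :
  cancel G phi -> cancel phi G -> smooth phi -> smooth G -> smooth w ->
  (forall y, is_derive y (1 : R) phi (w (phi y))^-1) -> (forall t, is_derive t (1 : R) G (w t)) ->
  (forall t, 0 < w t) -> symplectomorphism (cotangent_lift phi (fun y => w (phi y))).
Proof.
move=> Gphi phiG sphi sG sw dphi dG w0.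
have wn0 t : w t != 0 by rewrite gt_eqF.
have swphi : smooth (fun y => w (phi y)) by exact: smooth_comp1.
have swi : smooth (fun t => (w t)^-1) by exact: smooth_inv.
have lift_ext (phi1 psi1 phi2 psi2 : R -> R) z : (forall t, phi2 (phi1 t) = t) ->
    (forall t, psi1 t * psi2 (phi1 t) = 1) ->
    cotangent_lift phi2 psi2 (cotangent_lift phi1 psi1 z) = z.
  move=> h1 h2; apply/rowP => l.
  have [->|ll] := eqVneq l (lshift n j); first by rewrite !cotangent_lift_l h1.
  have [->|lr] := eqVneq l (rshift n j).
    by rewrite !cotangent_lift_r cotangent_lift_l -mulrA h2 mulr1.
  by rewrite !cotangent_lift_other.
exists (cotangent_lift G (fun t => (w t)^-1)); split.
- by move=> z; apply: lift_ext => // t; rewrite divff.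
- by move=> z; apply: lift_ext => // t; rewrite Gphi mulVf.
- exact: cotangent_lift_smooth.
- exact: cotangent_lift_smooth.
- move=> z u v; apply: cotangent_lift_sigma => // t.
  by have [_ ->] := dphi t; rewrite mulVf.
Qed.

End SymplecticMaps.

Section UpperBound.
Variables (R : realType) (n : nat).
Local Notation V := 'rV[R]_n.

(** [A] maps [y] to [y + (dotv y a) b], a rank-one perturbation of the identity with determinant
    [dl], and [B] is its inverse by the Sherman-Morrison formula. As [b] has [j]-th coordinate 1,
    [a = p - e] turns the [j]-th coordinate into [dotv y p]; the choice of [b] does the same for [x]
    in [B^T]. *)
Lemma rank_one_frame (x p : V) (j : 'I_n) : dotv x p = 1 -> x 0 j != 1 -> p 0 j != 1 ->
  exists A B : 'M[R]_n, [/\ A *m B = 1%:M, forall y : V, (y *m A) 0 j = dotv y p &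
    forall y : V, (y *m B^T) 0 j = dotv y x].
Proof.
move=> xp xj pj.
pose e : V := delta_mx 0 j.
pose a := p - e; pose b := (1 - x 0 j)^-1 *: (e - x).
have dote (y : V) : dotv y e = y 0 j.
  rewrite /dotv (bigD1 j) //= big1 ?addr0 => [|i ij]; rewrite [e _ _]mxE !eqxx ?mulr1 //=.
  by rewrite (negbTE ij) mulr0.
have x1 : 1 - x 0 j != 0 by rewrite subr_eq0 eq_sym.
have bj : b 0 j = 1 by rewrite !mxE !eqxx /= mulVf.
have aj : a 0 j = p 0 j - 1 by rewrite !mxE !eqxx.
pose dl := (p 0 j - 1) / (1 - x 0 j).
have dl0 : dl != 0 by rewrite mulf_neq0 ?invr_neq0 // subr_eq0.
have ba : dotv b a = dl - 1.
  rewrite /b /a /dl dotvZl dotvDr dotvNr dote dotvBl xp dotvC dote [(e - x) 0 j]mxE [e 0 j]mxE !eqxx /=.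
  by rewrite [(- x) 0 j]mxE; field.
have mulab (y : V) c : y *m (c *: (a^T *m b)) = (c * dotv y a) *: b.
  rewrite -scalemxAr mulmxA -scalerA; congr (_ *: _).
  have -> : y *m a^T = (dotv y a)%:M.
    by apply/rowP => i; rewrite !mxE (ord1 i) eqxx mulr1n; apply: eq_bigr => l _; rewrite !mxE.
  by rewrite mul_scalar_mx.
pose A : 'M[R]_n := 1%:M + 1 *: (a^T *m b).
pose B : 'M[R]_n := 1%:M + - dl^-1 *: (a^T *m b).
exists A, B; split.
- apply/row_matrixP => i; rewrite !rowE mulmx1 mulmxA [_ *m A]mulmxDr mulmx1 mulab mul1r.
  set d := dotv _ _; rewrite mulmxDr mulmx1 mulab dotvDl dotvZl ba -/d addrAC -addrA -scalerDl.
  have -> : - dl^-1 * (d + d * (dl - 1)) + d = 0 by field.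
  by rewrite scale0r addr0.
- move=> y; rewrite mulmxDr mulmx1 mulab mul1r mxE [X in _ + X]mxE bj mulr1.
  by rewrite /a dotvDr dotvNr dote; ring.
- move=> y; rewrite /B linearD /= trmx1 linearZ /= trmx_mul trmxK mulmxDr mulmx1 -scalemxAr mulmxA.
  have -> : y *m b^T = (dotv y b)%:M.
    by apply/rowP => i; rewrite !mxE (ord1 i) eqxx mulr1n; apply: eq_bigr => l _; rewrite !mxE.
  rewrite mul_scalar_mx mxE [X in _ + X]mxE [X in _ + _ * X]mxE aj.
  by rewrite /b dotvZr dotvDr dotvNr dote /dl; field; rewrite x1 subr_eq0.
Qed.

(** Scaling by [lam] avoids the excluded values of [rank_one_frame]: the absolute value [1 + |x_j|]
    keeps [x_j / lam] below 1, and the sign makes [lam * p_j] nonpositive. *)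
Lemma symplectic_frame (x p : V) (j : 'I_n) : dotv x p = 1 ->
  exists (A B : 'M[R]_n) (lam : R), [/\ lam != 0, A *m B = 1%:M,
    forall y : V, (y *m A) 0 j = lam * dotv y p & forall y : V, (y *m B^T) 0 j = lam^-1 * dotv y x].
Proof.
move=> xp.
have [lam [l0 h1 h2]] : exists lam, [/\ lam != 0, lam^-1 * x 0 j != 1 & lam * p 0 j != 1].
  have m0 : 0 < 1 + `|x 0 j| by rewrite ltr_wpDr.
  have hx := ler_norm (x 0 j); have hx' : - x 0 j <= `|x 0 j| by rewrite -normrN ler_norm.
  have [pj|pj] := lerP (p 0 j) 0.
    exists (1 + `|x 0 j|); split; first by rewrite gt_eqF.
      by rewrite lt_eqF // mulrC ltr_pdivrMr // mul1r; lra.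
    by rewrite lt_eqF //; nra.
  exists (- (1 + `|x 0 j|)); split; first by rewrite oppr_eq0 gt_eqF.
    by rewrite lt_eqF // invrN mulNr -mulrN mulrC ltr_pdivrMr // mul1r; lra.
  by rewrite lt_eqF //; nra.
have xp' : dotv (lam^-1 *: x) (lam *: p) = 1 by rewrite dotvZl dotvZr xp mulr1 mulVf.
have [||A [B [AB hA hB]]] := rank_one_frame (j := j) xp'; rewrite ?mxE //.
by exists A, B, lam; split=> // y; [rewrite hA dotvZr|rewrite hB dotvZr].
Qed.

Theorem c_max_le (X P : set V) (s : R) : 0 < s -> (0 < n)%N ->
  centrally_symmetric X -> convex_body P -> centrally_symmetric P ->
  ~ hpolar s X `<=` P -> (c_max (prodXP X P) <= (4 * s)%:E)%E.
Proof.
move=> s0 n0 sX bP sP /existsNP[p /not_implyP[hp nP]].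
have [rP rP0 hrP] := symmetric_body_ball bP sP.
have P0 : P 0 by apply: hrP; rewrite normr0 ltW.
have [cP [vP _]] := bP.
have [x0 [hx0 x0p]] := compact_convex_separation cP vP P0 nP.
(* As [tau > 1], dividing by it keeps the pairing of [X] with [p0] bounded by [s]. *)
pose tau := dotv x0 p; pose p0 := tau^-1 *: p.
have tau0 : 0 < tau by apply: lt_trans x0p.
have x0p0 : dotv x0 p0 = 1 by rewrite dotvZr mulVf // gt_eqF.
have Xp x : X x -> `|dotv x p0| <= s.
  have hxp y : X y -> dotv y p0 <= s.
    move=> Xy; rewrite dotvZr mulrC ler_pdivrMr // dotvC; apply: le_trans (hp y Xy) _.
    by rewrite ler_pMr // ltW.
  move=> Xx; rewrite ler_norml hxp // andbT lerNl -dotvNl.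
  by apply: hxp; exact: centrally_symmetricN.
have Px y : P y -> `|dotv y x0| <= 1.
  move=> Py; rewrite dotvC ler_norml hx0 // andbT lerNl -dotvNr.
  by apply: hx0; exact: centrally_symmetricN.
have [A [B [lam [l0 AB hA hB]]]] := symplectic_frame (Ordinal n0) x0p0.
set j := Ordinal n0 in hA hB.
have L0 : 0 < `|lam| by rewrite normr_gt0.
apply/lee_addgt0Pr => eps eps0.
pose e := eps / (4 * s).
have e0 : 0 < e by rewrite divr_gt0 // mulr_gt0.
have [w [G [d [[sw dG d0 dw] [w_le G1 GN1]]]]] := smooth_half_disc e0.
have pi0 := pi_gt0 R.
(* The disc of radius [rho] has the area [4 * s] of the rectangle. *)
pose rho := Num.sqrt (4 * s / pi).
have rho2 : rho ^+ 2 = 4 * s / pi by rewrite sqr_sqrtr // divr_ge0 ?mulr_ge0 // ltW.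
have rho0 : 0 < rho by rewrite sqrtr_gt0 divr_gt0 // mulr_gt0.
pose al := 4 * (`|lam| * s) / pi.
have al0 : 0 < al by rewrite divr_gt0 // !mulr_gt0.
have al_rho : `|lam|^-1 * al = rho ^+ 2.
  have F (a c : R) : a != 0 -> c != 0 -> a^-1 * (4 * (a * s) / c) = 4 * s / c.
    by move=> ha hc; field; rewrite hc.
  by rewrite rho2 /al F ?gt_eqF.
(* [al * (pi / 4) = |lam| * s], so [G'] maps [[- rho, rho]] over the position side of the rectangle,
   and its inverse brings positions into [[- rho, rho]]. As [al / |lam| = rho ^ 2], the lifted
   momentum is at most [rho * w u] with [u = t / rho], which [smooth_half_disc] places in the disc
   of radius [r]. *)
pose G' (t : R) := al * G (rho^-1 * t); pose w' (t : R) := al / rho * w (rho^-1 * t).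
have drho t : is_derive t (1 : R) (fun t => rho^-1 * t) rho^-1.
  by apply: (is_derive_eq (is_deriveZ rho^-1 (is_derive_id t (1 : R)))); rewrite /GRing.scale /= mulr1.
have dG' t : is_derive t (1 : R) G' (w' t).
  apply: (is_derive_eq (is_deriveZ al (@is_derive1_comp R G (fun t => rho^-1 * t) t _ _ (dG _) (drho t)))).
  by rewrite /GRing.scale /= /w'; ring.
have sw' : smooth w'.
  apply: smoothM; first exact: smooth_cst.
  apply: (smooth_comp1 sw); apply: smoothM; [exact: smooth_cst|exact: smooth_id].
have d'0 : 0 < al / rho * d by rewrite mulr_gt0 // divr_gt0.
have dw' t : al / rho * d <= w' t by rewrite ler_wpM2l // divr_ge0 // ltW.
have w'0 t : 0 < w' t by exact: lt_le_trans (dw' t).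
have sG' : smooth G' by exact: smooth_of_derive1 dG' sw'.
have [phi [GK phiK sphi dphi]] := smooth_inverse sw' dG' d'0 dw'.
pose f z := cotangent_lift j phi (fun y => w' (phi y)) (z *m block_mx A 0 0 B^T).
have sf : symplectomorphism f.
  apply: (symplectomorphism_comp (f := cotangent_lift j phi _)); last exact: symplectomorphism_block.
  exact: (cotangent_lift_symplectomorphism j GK phiK sphi sG' sw' dphi dG' w'0).
have G'mono a b : a <= b -> G' a <= G' b.
  by move=> ab; apply: (is_derive_nondecreasing ab (fun x _ => dG' x)) => x _; exact: ltW.
have Ginj := can_inj GK.
have al_pi : al * (pi / 4) = `|lam| * s.
  have F (a c : R) : c != 0 -> 4 * a / c * (c / 4) = a by move=> hc; field.
  by rewrite /al F // gt_eqF.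
have G'rho : `|lam| * s <= G' rho.
  rewrite /G' mulVf ?gt_eqF //; apply: le_trans (_ : al * (pi / 4) <= _); last by rewrite ler_pM2l.
  by rewrite al_pi.
have G'Nrho : G' (- rho) <= - (`|lam| * s).
  rewrite /G' mulrN mulVf ?gt_eqF //; apply: (@le_trans _ _ (al * - (pi / 4))); first by rewrite ler_pM2l.
  by rewrite mulrN al_pi.
pose r := rho * Num.sqrt (1 + e).
have e1 : 0 < 1 + e by rewrite addr_gt0.
have r2 : r ^+ 2 = rho ^+ 2 * (1 + e) by rewrite exprMn [Num.sqrt (1 + e) ^+ 2]sqr_sqrtr // ltW.
apply: ereal_inf_lbound; exists r; last first.
  have F (c : R) : c != 0 -> c * (4 * s / c * (1 + e)) = 4 * s + 4 * s * e by move=> hc; field.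
  have se : 4 * s * e = eps by rewrite /e [LHS]mulrC divfK // gt_eqF // mulr_gt0.
  by rewrite r2 rho2 -EFinD F ?gt_eqF // se.
split; first by rewrite mulr_gt0 // sqrtr_gt0.
exists f, j; split=> // _ [z [Xz Pz] <-].
pose y := z *m block_mx A 0 0 B^T.
have yE : y = row_mx (lsubmx z *m A) (rsubmx z *m B^T).
  by rewrite /y -{1}[z]hsubmxK mul_row_block !mulmx0 addr0 add0r.
have yl : `|y 0 (lshift n j)| <= `|lam| * s.
  by rewrite yE row_mxEl hA normrM ler_wpM2l // Xp.
have yr : `|y 0 (rshift n j)| <= `|lam|^-1.
  by rewrite yE row_mxEr hB normrM normfV ler_piMr ?invr_ge0 // Px.
rewrite /cylinder /= /f -/y cotangent_lift_l cotangent_lift_r.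
set t := phi _.
have Gt : G' t = y 0 (lshift n j) by rewrite /t phiK.
have t_rho : `|t| <= rho.
  have [y1 y2] : - (`|lam| * s) <= y 0 (lshift n j) /\ y 0 (lshift n j) <= `|lam| * s.
    by move: yl; rewrite ler_norml => /andP[].
  rewrite ler_norml; apply/andP; split; rewrite leNgt; apply/negP => lt.
    have := G'mono _ _ (ltW lt); rewrite Gt => h.
    by move: lt; rewrite (Ginj (- rho) t) ?ltxx // Gt; apply/eqP; rewrite eq_le h andbT; lra.
  have := G'mono _ _ (ltW lt); rewrite Gt => h.
  by move: lt; rewrite (Ginj rho t) ?ltxx // Gt; apply/eqP; rewrite eq_le h; lra.
pose u := rho^-1 * t.
have tu : t = rho * u by rewrite /u mulVKf // gt_eqF.
have u1 : `|u| <= 1 by rewrite /u normrM gtr0_norm ?invr_gt0 // mulrC ler_pdivrMr // mul1r.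
have yw : (y 0 (rshift n j) * w' t) ^+ 2 <= rho ^+ 2 * w u ^+ 2.
  have hw : 0 <= w u by apply: le_trans (dw u); exact: ltW.
  rewrite -exprMn -[X in X <= _]real_normK ?num_real // ler_sqr ?nnegrE ?mulr_ge0 ?(ltW rho0) //.
  rewrite normrM (gtr0_norm (w'0 t)) /w' -/u mulrA.
  apply: ler_wpM2r => //; apply: (@le_trans _ _ (`|lam|^-1 * (al / rho))).
    by apply: ler_wpM2r => //; rewrite divr_ge0 // ltW.
  by rewrite mulrA al_rho expr2 mulfK // gt_eqF.
apply: le_trans (_ : (rho * u) ^+ 2 + rho ^+ 2 * w u ^+ 2 <= _); first by rewrite tu lerD2l -tu.
rewrite r2 exprMn -mulrDr ler_pM2l ?exprn_gt0 //.
have := w_le u u1; lra.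
Qed.

End UpperBound.

(** * Comparison of the two bounds *)

Theorem theorem1 (R : realType) (hbar : R) (n : nat) (X P : set 'rV[R]_n) :
  0 < hbar -> (0 < n)%N ->
  convex_body X -> centrally_symmetric X ->
  convex_body P -> centrally_symmetric P ->
  hpolar hbar X `<=` P ->
  [/\ c_max (prodXP X P) = c_HZ (prodXP X P),
      ((4 * hbar)%:E <= c_HZ (prodXP X P))%E &
      (hpolar hbar X = P -> c_HZ (prodXP X P) = (4 * hbar)%:E)].

Proof.
move=> h0 n0 bX sX bP sP XP.
have le1 : (c_HZ (prodXP X P) <= c_max (prodXP X P))%E by exact: c_HZ_le_c_max.
have ge4 : ((4 * hbar)%:E <= c_HZ (prodXP X P))%E by exact: c_HZ_ge.
have dichotomy (s : R) : 0 < s ->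
    (c_max (prodXP X P) <= (4 * s)%:E)%E \/ ((4 * s)%:E <= c_HZ (prodXP X P))%E.
  move=> s0; have [h|h] := pselect (hpolar s X `<=` P); [right; exact: c_HZ_ge|left; exact: c_max_le].
have ge1 : (c_max (prodXP X P) <= c_HZ (prodXP X P))%E.
  rewrite leNgt; apply/negP.
  move: ge4 dichotomy; case: (c_HZ _) => [r| |] => r4 dichotomy lt; last 2 first.
  - by move: lt; rewrite ltNge leey.
  - by move: r4; rewrite leeNy_eq.
  rewrite lee_fin in r4.
  (* If both values are finite, [4 * s] is their midpoint; if [c_max] is infinite, any [s] above
     [r / 4] serves. *)
  have [s [s0 rs sm]] : exists s : R, [/\ 0 < s, r < 4 * s & ((4 * s)%:E < c_max (prodXP X P))%E].
    case: (c_max _) lt => [m| |] //; last by exists ((r + 4) / 4); rewrite ltry; split=> //; lra.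
    by rewrite lte_fin => rm; exists ((r + m) / 8); rewrite lte_fin; split; lra.
  have [h|] := dichotomy s s0; first by have := le_lt_trans h sm; rewrite ltxx.
  by rewrite lee_fin leNgt rs.
split=> //; first by apply/eqP; rewrite eq_le ge1 le1.
move=> XPE; apply/eqP; rewrite eq_le ge4 andbT; apply/lee_addgt0Pr => e e0.
(* [c_max_le] needs a polar not contained in [P], so it is applied slightly above [hbar]. *)
pose s := hbar + e / 4.
have -> : ((4 * hbar)%:E + e%:E = (4 * s)%:E)%E by rewrite -EFinD /s; congr EFin; field.
have s0 : 0 < s by rewrite addr_gt0 // divr_gt0.
apply: le_trans le1 _; apply: c_max_le => //.
rewrite -XPE => sub.
have [rho rho0 hrho] := symmetric_body_ball bX sX.
(* A nonzero vector, since [0 < n]. Scaled so that its maximum over [X] is [s], it lies in the polar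
   for [s] but not in the one for [hbar < s]. *)
pose v : 'rV[R]_n := rho *: const_mx 1.
have [cX _] := bX.
have X0 : X 0 by apply: hrho; rewrite normr0 ltW.
have [y Xy hy] := @EVT_max_rV R n (fun x => dotv v x) X (ex_intro _ 0 X0) cX (continuous_subspaceT (@dotv_continuous R n v)).
have {}hy x : X x -> dotv v x <= dotv v y by move=> Xx; apply: hy; rewrite inE.
have Xv : X v.
  apply: hrho; apply: rV_norm_le => [|i]; first exact: ltW.
  by rewrite !mxE mulr1 gtr0_norm.
have vy : 0 < dotv v y.
  apply: lt_le_trans (hy v Xv); rewrite /dotv (bigD1 (Ordinal n0)) //= !mxE mulr1.
  rewrite ltr_pwDl ?mulr_gt0 //; apply: sumr_ge0 => i _; rewrite !mxE mulr1.
  by rewrite mulr_ge0 // ltW.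
have /sub /(_ y) : hpolar s X ((s / dotv v y) *: v).
  move=> x Xx; rewrite dotvZl -mulrA ler_piMr ?(ltW s0) // mulrC ler_pdivrMr // mul1r.
  exact: hy.
rewrite dotvZl divfK ?gt_eqF // => /(_ (set_mem Xy)); apply/negP; rewrite -ltNge.
by rewrite /s ltrDl divr_gt0.
Qed.
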